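(* Let $n>m>0$ and let $R$ be a commutative ring such that $\mathcal{B}_k(R)$ is Cohen–Macaulay (of dimension $k-1$) for all $k\ge1$, and such that for all $k>\ell$, $\mathcal{T}_{k,\ell}(R)$ is connected whenever $\ell\ge2$ and simply connected whenever $\ell\ge3$. Then $\mathcal{T}_{n,m}(R)$ is $(m-2)$-connected.
   Context: A flag in $R^n$ is a chain $0\subsetneq V_1\subsetneq\cdots\subsetneq V_k\subsetneq R^n$ of free direct summands; complete if $k=n-1$, good if a subflag of a complete flag. The Tits complex $\mathcal{T}_n(R)$ has vertices the direct summands $V$ of $R^n$, $0\ne V\ne R^n$, with $V$ and $R^n/V$ free, and a $k$-simplex for every good flag with $k+1$ terms. For $n>m\ge1$, $\mathcal{T}_{n,m}(R)$ is the full subcomplex of $\mathcal{T}_n(R)$ on vertices of rank at most $m$. $\mathcal{B}_k(R)$: vertices are vectors of $R^k$ lying in a basis, simplices are subsets extendable to a basis of $R^k$. Cohen–Macaulay of dimension $d$: $d$-dimensional, $(d-1)$-connected, and the link of every $p$-simplex is $(d-p-1)$-dimensional and $(d-p-2)$-connected. $(-1)$-connected means nonempty. *)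

(* Defs.v *)
From HB Require Import structures.
From mathcomp Require Import all_boot all_order all_algebra.
From mathcomp Require Import all_classical all_reals all_analysis.
From mathcomp Require Import Rstruct Rstruct_topology.
From Stdlib Require List.

Set Implicit Arguments.
Unset Strict Implicit.
Unset Printing Implicit Defensive.
Import Order.TTheory GRing.Theory Num.Theory.
Local Open Scope classical_set_scope.
Local Open Scope ring_scope.

Notation RR := Rdefinitions.R.

(* Abstract simplicial complexes.  A complex on a vertex type V is a   *)
(* predicate on finite lists of vertices (a list represents the finite *)
(* set of its entries); the simplices are the nonempty lists satisfying *)
(* the predicate.  A p-simplex is a simplex with p+1 distinct vertices *)
(* (we count with duplicate-free lists).                               *)
Definition complex (V : Type) := seq V -> Prop.

Definition in_closed_simplex (V : Type) (s : seq V) (a : V -> RR) : Prop :=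
  (forall v, ~ List.In v s -> a v = 0) /\ (forall v, 0 <= a v) /\
  \sum_(v <- s) a v = 1.

Definition realization (V : Type) (K : complex V) : set (V -> RR) :=
  fun a => exists s, K s /\ List.NoDup s /\ in_closed_simplex s a.

Definition coords (V : Type) (s : seq V) (a : V -> RR) : 'rV[RR]_(size s) :=
  \row_(i < size s) a (tnth (in_tuple s) i).

(* open sets of |K| for the weak (coherent) topology: U is open iff its
   trace on every closed simplex is open in the Euclidean topology *)
Definition real_open (V : Type) (K : complex V) (U : set (V -> RR)) : Prop :=
  U `<=` realization K /\
  forall s, K s -> List.NoDup s ->
    exists O : set 'rV[RR]_(size s), open O /\
      forall a, in_closed_simplex s a -> (U a <-> O (coords s a)).

Definition cont_into (V : Type) (K : complex V) (p : nat)
    (X : set 'rV[RR]_p) (f : 'rV[RR]_p -> V -> RR) : Prop :=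
  (forall x, X x -> realization K (f x)) /\
  forall U, real_open K U ->
    exists O : set 'rV[RR]_p, open O /\ forall x, X x -> (O x <-> U (f x)).

Definition sphere (j : nat) : set 'rV[RR]_j.+1 :=
  [set x | \sum_(i < j.+1) x ord0 i ^+ 2 = 1].
Definition disk (j : nat) : set 'rV[RR]_j.+1 :=
  [set x | \sum_(i < j.+1) x ord0 i ^+ 2 <= 1].

Definition k_connected (V : Type) (K : complex V) (k : int) : Prop :=
  ((-1 <= k)%R -> exists a, realization K a) /\
  forall j : nat, (j%:Z <= k)%R ->
    forall f, cont_into K (@sphere j) f ->
      exists g, cont_into K (@disk j) g /\ forall x, @sphere j x -> g x = f x.

Definition has_dim (V : Type) (K : complex V) (d : int) : Prop :=
  (forall s, K s -> List.NoDup s -> ((size s)%:Z <= d + 1)%R) /\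
  ((0 <= d)%R -> exists s, K s /\ List.NoDup s /\ (size s)%:Z = d + 1).

Definition link (V : Type) (K : complex V) (s : seq V) : complex V :=
  fun t => t <> [::] /\ (forall v, List.In v t -> ~ List.In v s) /\ K (s ++ t).

Definition cohen_macaulay (V : Type) (K : complex V) (d : int) : Prop :=
  has_dim K d /\ k_connected K (d - 1) /\
  forall (p : nat) (s : seq V), K s -> List.NoDup s -> size s = p.+1 ->
    has_dim (link K s) (d - p%:Z - 1) /\ k_connected (link K s) (d - p%:Z - 2).

Section LinAlg.
Variable A : comNzRingType.

Definition lin_indep (n r : nat) (b : 'I_r -> 'rV[A]_n) : Prop :=
  forall c : 'I_r -> A, \sum_(i < r) c i *: b i = 0 -> forall i, c i = 0.

Definition span (n r : nat) (b : 'I_r -> 'rV[A]_n) : set 'rV[A]_n :=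
  [set x | exists c : 'I_r -> A, x = \sum_(i < r) c i *: b i].

Definition basis_of (n r : nat) (V : set 'rV[A]_n) (b : 'I_r -> 'rV[A]_n) :=
  lin_indep b /\ V = span b.

Definition is_basis (n r : nat) (b : 'I_r -> 'rV[A]_n) := basis_of setT b.

Definition free_of_rank (n : nat) (V : set 'rV[A]_n) (r : nat) :=
  exists b : 'I_r -> 'rV[A]_n, basis_of V b.

Definition free (n : nat) (V : set 'rV[A]_n) := exists r, free_of_rank V r.

Definition submodule (n : nat) (V : set 'rV[A]_n) :=
  V 0 /\ (forall x y, V x -> V y -> V (x + y)) /\
  (forall (a : A) x, V x -> V (a *: x)).

Definition complement (n : nat) (V W : set 'rV[A]_n) :=
  submodule W /\ V `&` W = [set 0] /\
  forall x, exists v w, V v /\ W w /\ x = v + w.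

Definition direct_summand (n : nat) (V : set 'rV[A]_n) :=
  submodule V /\ exists W, complement V W.

(* V is free, a direct summand, and A^n/V is free; the quotient A^n/V is
   isomorphic to any complement of V, so we ask for a free complement *)
Definition tits_vertex (n : nat) (V : set 'rV[A]_n) :=
  V <> [set 0] /\ V <> setT /\ free V /\ submodule V /\
  exists W, complement V W /\ free W.

Definition complete_flag (n : nat) (F : 'I_n.-1 -> set 'rV[A]_n) :=
  (forall i, free (F i) /\ direct_summand (F i) /\
             F i <> [set 0] /\ F i <> setT) /\
  (forall i j : 'I_n.-1, (i < j)%N -> F i `<` F j).

Definition tits (n : nat) : complex (set 'rV[A]_n) :=
  fun s => s <> [::] /\ (forall V, List.In V s -> tits_vertex V) /\
    exists F, complete_flag F /\ forall V, List.In V s -> exists i, V = F i.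

Definition tits_trunc (n m : nat) : complex (set 'rV[A]_n) :=
  fun s => tits (n:=n) s /\
    forall V, List.In V s -> exists r, (r <= m)%N /\ free_of_rank V r.

Definition Bcomplex (k : nat) : complex 'rV[A]_k :=
  fun s => s <> [::] /\ exists b : 'I_k -> 'rV[A]_k, is_basis b /\
    forall v, List.In v s -> exists i, v = b i.

End LinAlg.

Arguments tits A n : clear implicits.
Arguments tits_trunc A n m : clear implicits.
Arguments Bcomplex A k : clear implicits.

(* Main.v *)
Require Import Defs.
From mathcomp Require Import all_boot all_order all_algebra.
From mathcomp Require Import all_classical all_reals all_analysis.
From mathcomp Require Import Rstruct Rstruct_topology fingroup perm zify ring lra.
From Stdlib Require List.

Set Implicit Arguments.
Unset Strict Implicit.
Unset Printing Implicit Defensive.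
Import Order.TTheory GRing.Theory Num.Theory numFieldNormedType.Exports.
Import Defs.
Local Open Scope classical_set_scope.
Local Open Scope ring_scope.

(* Put Y = T_{n,m}.  Let [flagged r] be the complex whose simplices are partial
   bases sigma joined with flags V_0 < ... < V_p of ranks in [r, m] such that
   sigma extends to a basis of V_0 (and |sigma| <= m if there is no V_0).
   - [flagged (m+1)] is the (m-1)-skeleton of B_n, hence (m-2)-connected.
   - [flagged r] arises from [flagged (r+1)] by attaching, for every V of rank r,
     a cone over the join B(V) * Y_{>V}, isomorphic to B_r * T_{n-r,m-r}.  The
     factors are (r-2)- and (m-r-2)-connected (the second one by induction on m),
     so their join is (m-2)-connected, and attaching cones over such subcomplexes
     keeps [flagged r] (m-2)-connected.
   - |Y| is a retract of |flagged 1|: spread the part of a point carried by vectors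
     over its superlevel sets, and replace each superlevel set by its span.
   For the cone step, a map from a sphere is first made simplicial on the nerve of
   a partition of unity of small multiplicity; it is then pushed off the new
   vertices by an explicit homotopy, which sends a low-dimensional skeleton of
   their preimage to B(V) and the dual skeleton to Y_{>V}. *)

(** * Continuity on a subset of a topological space *)

(** One count shapes the cone step. A sphere of dimension j <= m-2 has a nerve whose simplices have
    at most m vertices. Maps into an (r-2)-connected complex extend over simplices with at most r
    vertices, maps into an (m-r-2)-connected one over simplices with at most m-r. Inside a nerve
    simplex the faces with at most r vertices can therefore go to B(V), while a chain of larger
    faces, counted together with the vertices already mapped to Y_{>V}, has length at most m-r and
    can go to Y_{>V}. This plays the part of the connectivity of a join. Extensions are made over
    finite complexes and homotopies are given by min-max formulas in barycentric coordinates, so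
    continuity is that of real functions: a map from a compact set meets finitely many vertices, and
    there the weak topology is coordinatewise. On the algebraic side, if V is a summand contained in
    W and both are free, of ranks d and d+1, then W/V is stably free of rank 1, hence free. So every
    complete flag consists of the spans of the initial segments of a basis, and flags become
    matrices. *)

Section ContinuityOnASubset.
Variables (T : topologicalType) (X : set T).

Definition cont_on (f : T -> RR) := forall x, X x -> f @ within X (nbhs x) --> f x.

Lemma cont_on_cst (c : RR) : cont_on (fun=> c).
Proof. by move=> x _; exact: cvg_cst. Qed.

Lemma cont_onD f g : cont_on f -> cont_on g -> cont_on (fun x => f x + g x).
Proof. by move=> cf cg x Xx; exact: (@cvgD RR RR^o _ _ _ f g _ _ (cf x Xx) (cg x Xx)). Qed.

Lemma cont_onN f : cont_on f -> cont_on (fun x => - f x).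
Proof. by move=> cf x Xx; exact: (@cvgN RR RR^o _ _ _ f _ (cf x Xx)). Qed.

Lemma cont_onB f g : cont_on f -> cont_on g -> cont_on (fun x => f x - g x).
Proof. by move=> cf cg; apply: cont_onD => //; exact: cont_onN. Qed.

Lemma cont_onM f g : cont_on f -> cont_on g -> cont_on (fun x => f x * g x).
Proof. by move=> cf cg x Xx; exact: (@cvgM RR _ _ _ f g _ _ (cf x Xx) (cg x Xx)). Qed.

Lemma cont_on_comp (h : RR -> RR) f : continuous h -> cont_on f -> cont_on (fun x => h (f x)).
Proof.
by move=> ch cf x Xx; apply: (cvg_comp f h (cf x Xx)); exact: ch.
Qed.

Lemma cont_onV f : (forall x, X x -> f x != 0) -> cont_on f -> cont_on (fun x => (f x)^-1).
Proof. by move=> f0 cf x Xx; apply: (@cvgV RR _ _ _ f); [exact: f0 | exact: cf]. Qed.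

Lemma cont_on_abs f : cont_on f -> cont_on (fun x => `|f x|).
Proof. by move=> cf x Xx; exact: (@cvg_norm RR RR^o _ _ _ f _ (cf x Xx)). Qed.

Lemma cont_on_eq f g : (forall x, X x -> f x = g x) -> cont_on f -> cont_on g.
Proof.
move=> fg cf x Xx; rewrite -(fg _ Xx).
apply: cvg_trans (cf x Xx); apply: near_eq_cvg.
by rewrite nearE /within /=; apply: filterE => y Xy; exact: fg.
Qed.

Lemma cont_on_max f g : cont_on f -> cont_on g -> cont_on (fun x => Num.max (f x) (g x)).
Proof.
move=> cf cg.
apply: (@cont_on_eq (fun x => (f x + g x + `|f x - g x|) * 2^-1)).
  by move=> x _; rewrite maxr_absE.
by apply: cont_onM; [apply: cont_onD; [exact: cont_onD|exact/cont_on_abs/cont_onB]|exact: cont_on_cst].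
Qed.

Lemma cont_on_min f g : cont_on f -> cont_on g -> cont_on (fun x => Num.min (f x) (g x)).
Proof.
move=> cf cg.
apply: (@cont_on_eq (fun x => (f x + g x - `|f x - g x|) * 2^-1)).
  by move=> x _; rewrite minr_absE.
by apply: cont_onM; [apply: cont_onB; [exact: cont_onD|exact/cont_on_abs/cont_onB]|exact: cont_on_cst].
Qed.

Lemma cont_on_big (I : Type) (op : RR -> RR -> RR) idx (r : seq I) (P : pred I)
    (F : I -> T -> RR) :
  (forall f g, cont_on f -> cont_on g -> cont_on (fun x => op (f x) (g x))) ->
  (forall i, P i -> cont_on (F i)) -> cont_on (fun x => \big[op/idx]_(i <- r | P i) F i x).
Proof.
move=> cop cF; elim: r => [|i r IH].
  by apply: (cont_on_eq (f := fun=> idx)) => [x _|]; [rewrite big_nil|exact: cont_on_cst].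
have [Pi|nPi] := boolP (P i); last first.
  by apply: cont_on_eq IH => x _; rewrite big_cons (negbTE nPi).
apply: (cont_on_eq (f := fun x => op (F i x) (\big[op/idx]_(i <- r | P i) F i x))).
  by move=> x _; rewrite big_cons Pi.
by apply: cop => //; exact: cF.
Qed.

Lemma cont_on_sum (I : Type) (r : seq I) (P : pred I) (F : I -> T -> RR) :
  (forall i, P i -> cont_on (F i)) -> cont_on (fun x => \sum_(i <- r | P i) F i x).
Proof. by apply: cont_on_big => f g; exact: cont_onD. Qed.

Lemma cont_on_bigmax (I : Type) (r : seq I) (P : pred I) idx (F : I -> T -> RR) :
  (forall i, P i -> cont_on (F i)) -> cont_on (fun x => \big[Num.max/idx]_(i <- r | P i) F i x).
Proof. by apply: cont_on_big => f g; exact: cont_on_max. Qed.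

Lemma cont_on_bigmin (I : Type) (r : seq I) (P : pred I) idx (F : I -> T -> RR) :
  (forall i, P i -> cont_on (F i)) -> cont_on (fun x => \big[Num.min/idx]_(i <- r | P i) F i x).
Proof. by apply: cont_on_big => f g; exact: cont_on_min. Qed.

Lemma cont_on_eps f : cont_on f <-> forall x, X x -> forall e : RR, 0 < e ->
  \forall y \near x, X y -> `|f x - f y| < e.
Proof.
split=> cf x Xx.
  move=> e e0; have /(@cvgrPdist_lt RR RR^o)/(_ e e0) := cf x Xx.
  by rewrite nearE /within.
by apply/(@cvgrPdist_lt RR RR^o) => e e0; rewrite nearE /within; exact: cf.
Qed.

Lemma cont_on_pos f x : cont_on f -> X x -> 0 < f x -> \forall y \near x, X y -> 0 < f y.
Proof.
move=> /cont_on_eps cf Xx fx; have := cf x Xx _ fx.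
apply: filterS => y h Xy; have := h Xy; rewrite ltr_norml; lra.
Qed.

End ContinuityOnASubset.

Lemma cont_on_sub (T : topologicalType) (X Y : set T) f : Y `<=` X -> cont_on X f -> cont_on Y f.
Proof.
move=> YX /cont_on_eps cf; apply/cont_on_eps => x Yx e e0.
by apply: filterS (cf x (YX _ Yx) e e0) => y h /YX.
Qed.

(* The two pieces need to be closed only relatively to their union. *)
Lemma cont_on_glue (T : topologicalType) (X : set T) (C D : set T) (f : T -> RR) :
  (forall x, X x -> ~ C x -> \forall y \near x, X y -> ~ C y) ->
  (forall x, X x -> ~ D x -> \forall y \near x, X y -> ~ D y) ->
  X `<=` C `|` D ->
  cont_on (X `&` C) f -> cont_on (X `&` D) f -> cont_on X f.
Proof.
move=> cC cD XCD /cont_on_eps fC /cont_on_eps fD; apply/cont_on_eps => x Xx e e0.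
have hC : \forall y \near x, X y -> C y -> `|f x - f y| < e.
  have [Cx|nCx] := pselect (C x).
    by apply: filterS (fC x (conj Xx Cx) e e0) => y h Xy Cy; exact: h.
  by apply: filterS (cC x Xx nCx) => y h Xy /(h Xy).
have hD : \forall y \near x, X y -> D y -> `|f x - f y| < e.
  have [Dx|nDx] := pselect (D x).
    by apply: filterS (fD x (conj Xx Dx) e e0) => y h Xy Dy; exact: h.
  by apply: filterS (cD x Xx nDx) => y h Xy /(h Xy).
apply: filterS2 hC hD => y h1 h2 Xy.
by have [/(h1 Xy)|/(h2 Xy)] := XCD _ Xy.
Qed.

Lemma cont_on_compose (T S : topologicalType) (X : set T) (Y : set S) (u : T -> S)
    (f : S -> RR) :
  (forall x, X x -> Y (u x)) ->
  (forall x, X x -> u @ within X (nbhs x) --> u x) ->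
  cont_on Y f -> cont_on X (fun x => f (u x)).
Proof.
move=> XY cu /cont_on_eps cf; apply/cont_on_eps => x Xx e e0.
have := cu x Xx _ (cf (u x) (XY _ Xx) e e0).
rewrite /= /nbhs /= /within /=; apply: filterS => y h Xy.
by apply: h => //; exact: XY.
Qed.

Lemma cvg_within_rV (T : topologicalType) (X : set T) n (u : T -> 'rV[RR]_n) :
  (forall i, cont_on X (fun x => u x ord0 i)) ->
  forall x, X x -> u @ within X (nbhs x) --> u x.
Proof.
move=> cu x Xx; apply/cvg_ballP => e e0.
rewrite nearE /within /=.
have : \forall y \near x, forall i, X y -> `|u x ord0 i - u y ord0 i| < e.
  apply: filter_forall => i; exact: (proj1 (cont_on_eps _ _) (cu i) x Xx e e0).
by apply: filterS => y h Xy; split=> // i j; rewrite ord1; exact: h.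
Qed.

Lemma cont_on_continuous (T : topologicalType) (X : set T) (f : T -> RR) :
  continuous f -> cont_on X f.
Proof.
move=> cf x _ A xA; have fA : nbhs x (f @^-1` A) := cf x A xA.
by apply: (filterS _ fA) => y fy _.
Qed.

Lemma cont_on_coord n (X : set 'rV[RR]_n) i : cont_on X (fun x => x ord0 i).
Proof. exact/cont_on_continuous/coord_continuous. Qed.

Lemma cont_on_fst (T S : topologicalType) (X : set T) (Y : set (T * S)) f :
  (forall p, Y p -> X p.1) -> cont_on X f -> cont_on Y (fun p => f p.1).
Proof.
move=> YX; apply: cont_on_compose => // x Yx A xA.
have fA : nbhs x (fst @^-1` A) by apply: cvg_fst.
by apply: (filterS _ fA) => y fy _.
Qed.

Lemma cont_on_snd (T : topologicalType) (Y : set (T * RR)) : cont_on Y (fun p => p.2).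
Proof. by apply: cont_on_continuous => x A; apply: cvg_snd. Qed.

(** * Continuous maps into realizations of complexes *)

Lemma InP (V : eqType) (v : V) s : List.In v s <-> v \in s.
Proof.
elim: s => [|a s IH] //=; rewrite inE; split.
  by move=> [->|/IH ->]; rewrite ?eqxx ?orbT.
by move=> /orP[/eqP->|/IH]; [left|right].
Qed.

Lemma NoDupP (V : eqType) (s : seq V) : List.NoDup s <-> uniq s.
Proof.
elim: s => [|a s IH] /=; first by split=> // _; constructor.
split=> [h|/andP[as_ us]].
  by inversion_clear h; apply/andP; split; [apply/negP => /InP|exact/IH].
by constructor; [move=> /InP; apply/negP|exact/IH].
Qed.

Section SimplicialComplexes.
Variable V : choiceType.
Implicit Types (K L : complex V) (a : V -> RR) (s t F : seq V).

(** Simplices are lists, so closure under nonempty sublists also makes [K] insensitive to the order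
    and repetition of entries; the type [complex] guarantees none of this. *)
Definition simplicial K := (forall s, K s -> s <> [::]) /\
  forall s t, K s -> t <> [::] -> {subset t <= s} -> K t.

Lemma realP K a : realization K a <-> exists s, [/\ K s, uniq s,
  forall v, v \notin s -> a v = 0, forall v, 0 <= a v & \sum_(v <- s) a v = 1].
Proof.
split=> [[s [Ks [/NoDupP us [sa [a0 a1]]]]]|[s [Ks us sa a0 a1]]].
  by exists s; split=> // v vs; apply: sa; apply/InP; exact/negP.
exists s; split=> //; split; first exact/NoDupP.
by split=> // v vs; apply: sa; apply/negP => /InP.
Qed.

Lemma sum_support s F a : uniq s -> uniq F ->
  (forall v, v \notin s -> a v = 0) -> (forall v, v \notin F -> a v = 0) ->
  \sum_(v <- s) a v = \sum_(v <- F) a v.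
Proof.
move=> us uF sa Fa.
rewrite (bigID (fun v => a v == 0)) /= big1 ?add0r; last by move=> v /eqP.
rewrite [RHS](bigID (fun v => a v == 0)) /= [X in _ = X + _]big1 ?add0r;
  last by move=> v /eqP.
rewrite -big_filter -[RHS]big_filter; apply: perm_big.
apply: uniq_perm; [exact: filter_uniq|exact: filter_uniq|] => v.
rewrite !mem_filter; have [//|av] := eqVneq (a v) 0; rewrite !andTb.
have vs : v \in s by apply/contraT => /sa /eqP; rewrite (negbTE av).
have vF : v \in F by apply/contraT => /Fa /eqP; rewrite (negbTE av).
by rewrite vs vF.
Qed.

Lemma real_sum K a F : realization K a -> uniq F ->
  (forall v, v \notin F -> a v = 0) -> \sum_(v <- F) a v = 1.
Proof. by move=> /realP[s [Ks us sa a0 <-]] uF Fa; exact: sum_support. Qed.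

Lemma real_ge0 K a v : realization K a -> 0 <= a v.
Proof. by move=> /realP[s []]. Qed.

Lemma real_le1 K a v : realization K a -> a v <= 1.
Proof.
move=> /realP[s [Ks us sa a0 <-]].
have [vs|/sa ->] := boolP (v \in s); last by rewrite sumr_ge0.
by rewrite (big_rem v) //= lerDl sumr_ge0.
Qed.

Lemma real_sub K L a : (forall s, K s -> L s) -> realization K a -> realization L a.
Proof. by move=> KL [s [/KL Ls h]]; exists s. Qed.

Lemma real_intro K a s F : simplicial K -> K s -> (forall v, v \notin s -> a v = 0) ->
  (forall v, 0 <= a v) -> uniq F -> (forall v, v \notin F -> a v = 0) ->
  \sum_(v <- F) a v = 1 -> realization K a.
Proof.
move=> [K0 Kc] Ks sa a0 uF Fa a1; apply/realP; exists (undup s); split => //.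
- apply: (Kc _ _ Ks); last by move=> v; rewrite mem_undup.
  by move=> /undup_nil; exact: K0 Ks.
- exact: undup_uniq.
- by move=> v; rewrite mem_undup; exact: sa.
- rewrite -a1; apply: sum_support => //; first exact: undup_uniq.
  by move=> v; rewrite mem_undup; exact: sa.
Qed.

Lemma real_support K a : simplicial K -> realization K a -> exists s, [/\ K s, uniq s,
  forall v, (v \in s) = (0 < a v), forall v, 0 <= a v & \sum_(v <- s) a v = 1].
Proof.
move=> [K0 Kc] /realP[s [Ks us sa a0 a1]].
have sE v : (v \in [seq v <- s | 0 < a v]) = (0 < a v).
  rewrite mem_filter; have [//|/sa ->] := boolP (v \in s); first by rewrite andbT.
  by rewrite ltxx.
have e1 : \sum_(v <- [seq v <- s | 0 < a v]) a v = 1.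
  rewrite -a1; apply: sum_support => //; first exact: filter_uniq.
  by move=> v; rewrite sE; have := a0 v; case: ltgtP => // ->.
exists [seq v <- s | 0 < a v]; split=> //; last exact: filter_uniq.
apply: (Kc _ _ Ks); last by move=> v; rewrite mem_filter => /andP[].
by move=> s0; move: e1; rewrite s0 big_nil => /eqP; rewrite eq_sym oner_eq0.
Qed.

Section Maps.
Variables (T : topologicalType) (X : set T).

(** A common finite list of vertices makes the weak topology coordinatewise, which trades the open
    sets of the realization for continuity of real functions. The next two lemmas compare this with
    [cont_into], one direction using compactness of the domain. *)
Definition cont_map K (f : T -> V -> RR) :=
  (exists F, forall x, X x -> forall v, v \notin F -> f x v = 0) /\
  (forall x, X x -> realization K (f x)) /\
  forall v, cont_on X (f^~ v).

End Maps.

(** Only finitely many faces are spanned by [F]. On a face containing [f x], openness of [U] is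
    tested in the coordinates of that face; any other face misses a vertex at which [f x] is
    positive, so [f y] stays off it for [y] near [x]. *)
Lemma cont_into_of_map K p (X : set 'rV[RR]_p) f : simplicial K -> cont_map X K f -> cont_into K X f.
Proof.
move=> sK [[F Ff] [fK fc]]; split=> // U [UK oU].
suff hU x : X x -> U (f x) -> \forall y \near x, X y -> U (f y).
  exists [set x | \forall y \near x, X y -> U (f y)]; split.
    rewrite openE => x /= hx.
    by apply: (@filterS _ (nbhs x)); last exact: nbhs_interior hx.
  move=> x Xx; split=> [/nbhs_singleton|]; [exact|exact: hU].
move=> Xx Ux.
pose S (M : {set seq_sub F}) := [seq val v | v <- enum M].
have uS M : uniq (S M) by rewrite map_inj_uniq ?enum_uniq //; exact: val_inj.
suff : \forall y \near x, forall M, X y -> K (S M) ->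
    in_closed_simplex (S M) (f y) -> U (f y).
  apply: filterS => y h Xy.
  have [s [Ks us sE a0 a1]] := real_support sK (fK _ Xy).
  have sF v : v \in s -> v \in F.
    by apply: contraLR => /(Ff _ Xy) e; rewrite sE e ltxx.
  have SE : S (finset (fun v : seq_sub F => val v \in s)) =i s.
    move=> v; apply/mapP/idP => [[w]|vs].
      by rewrite mem_enum inE => ws ->.
    by exists (SeqSub (sF _ vs)); rewrite // mem_enum inE.
  apply: (h (finset (fun v : seq_sub F => val v \in s))) => //.
    apply: (proj2 sK _ _ Ks); last by move=> v; rewrite SE.
    move=> e0; apply: (proj1 sK _ Ks); apply/eqP; rewrite -size_eq0 -leqn0.
    by rewrite (leq_trans (uniq_leq_size us (s2 := [::]) _)) // => v; rewrite -SE e0.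
  split; [|split=> //].
    move=> v vS; have : v \notin s by rewrite -SE; apply/negP => /InP.
    by rewrite sE; have := a0 v; case: ltgtP => // ->.
  by rewrite -a1; apply: perm_big; exact: uniq_perm.
apply: (@filter_forall _ {set seq_sub F} (fun M y => X y -> K (S M) ->
    in_closed_simplex (S M) (f y) -> U (f y)) (nbhs x) _) => M.
have [KS|nKS] := pselect (K (S M)); last by apply: filterE => y _ /nKS.
have [inx|ninx] := pselect (in_closed_simplex (S M) (f x)).
  have [Q0 [oO OU]] := oU _ KS (proj2 (NoDupP _) (uS M)).
  have Ofx : Q0 (coords (S M) (f x)) by apply/OU.
  have cvc : (fun y => coords (S M) (f y)) @ within X (nbhs x) -->
            coords (S M) (f x).
    apply: (cvg_within_rV (u := fun y => coords (S M) (f y))) => // i.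
    by apply: cont_on_eq (fc (tnth (in_tuple (S M)) i)) => y _; rewrite mxE.
  have := cvc Q0 (open_nbhs_nbhs (conj oO Ofx)).
  rewrite /= /nbhs /= /within /=; apply: filterS => y h Xy _ iny.
  by apply/(OU _ iny)/h.
have [v [vS fv]] : exists v, v \notin S M /\ 0 < f x v.
  apply: contrapT => h; apply: ninx; have fr := fK _ Xx.
  have f0 v : v \notin S M -> f x v = 0.
    move=> vS; apply/eqP; rewrite eq_le (real_ge0 _ fr) andbT leNgt.
    by apply/negP => fv; apply: h; exists v.
  split; first by move=> v vS; apply: f0; apply/negP => /InP.
  by split=> [v|]; [exact: real_ge0 fr|exact: real_sum fr _ _].
apply: filterS (cont_on_pos (fc v) Xx fv) => y fy Xy _ [s0 _].
by have := fy Xy; rewrite s0 ?ltxx // => /InP; apply/negP.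
Qed.

(** If coordinate [v] is positive somewhere on [X], let [W v] be a positive value that it attains
    there. The points whose coordinates outside a finite list [F] stay below [W] form a weakly open
    set, because each closed simplex sees only finitely many of these bounds. By compactness one [F]
    serves all of [X]; then no coordinate outside [F] attains its [W v], so all of them vanish. *)
Lemma cont_map_of_into K p (X : set 'rV[RR]_p) f :
  compact X -> cont_into K X f -> cont_map X K f.
Proof.
move=> cX [fK fU].
have pre (U : set (V -> RR)) x : real_open K U -> X x -> U (f x) ->
    \forall y \near x, X y -> U (f y).
  move=> /fU[Q0 [oO OU]] Xx Ux.
  have := open_nbhs_nbhs (conj oO (proj2 (OU _ Xx) Ux)).
  by apply: filterS => y Oy Xy; apply/OU.
have coord_open (s : seq V) (v : V) (N : set RR) : open N ->
    exists Q0 : set 'rV[RR]_(size s), open Q0 /\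
      forall a, in_closed_simplex s a -> (N (a v) <-> Q0 (coords s a)).
  move=> oN; have [vs|vs] := boolP (v \in s).
    have [i iv] : exists i, tnth (in_tuple s) i = v.
      by have /tnthP[i ->] : v \in in_tuple s by []; exists i.
    exists [set x | N (x ord0 i)]; split.
      by apply: (open_comp _ oN) => x _; exact: coord_continuous.
    by move=> a _; rewrite /= mxE iv.
  exists [set _ | N 0]; split.
    rewrite openE => x Nx; exact: filterE.
  by move=> a [-> //]; move=> /InP; exact/negP.
split; last split=> //.
  have [W HW] : exists W : V -> RR, forall v, 0 < W v /\
      ((exists x, X x /\ 0 < f x v) -> exists x, X x /\ f x v = W v).
    have h v : exists e, 0 < e /\
      ((exists x, X x /\ 0 < f x v) -> exists x, X x /\ f x v = e).
      have [[x [Xx fx]]|n] := pselect (exists x, X x /\ 0 < f x v).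
        by exists (f x v); split=> // _; exists x.
      by exists 1; split.
    by have [W HW] := choice h; exists W.
  pose Om : set V := [set v | exists x, X x /\ 0 < f x v].
  pose U F := [set a | realization K a /\ forall v, Om v -> v \notin F -> a v < W v].
  have oUF F : real_open K (U F).
    split; first by move=> a [].
    move=> s Ks us.
    have h v : exists Q0 : set 'rV[RR]_(size s), open Q0 /\
      forall a, in_closed_simplex s a ->
        ((Om v -> v \notin F -> a v < W v) <-> Q0 (coords s a)).
      have [Ov|nOv] := pselect (Om v /\ v \notin F); last first.
        exists setT; split; first exact: openT.
        by move=> a _; split=> // _ Ov vF; case: nOv.
      have [Q0 [oO aO]] := coord_open s v [set x | x < W v] (@open_lt _ (W v)).
      exists Q0; split=> // a /aO <- /=; split=> //; apply; tauto.
    have [Q0 HO] := choice h.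
    exists (\bigcap_(i in [set: 'I_(size s)]) Q0 (tnth (in_tuple s) i)); split.
      rewrite openE => z /= hz.
      have : \forall y \near z, forall i, Q0 (tnth (in_tuple s) i) y.
        apply: (@filter_forall _ _ (fun i => Q0 (tnth (in_tuple s) i)) (nbhs z) _) => i.
        by apply: open_nbhs_nbhs; split; [exact: (proj1 (HO _))|exact: hz].
      by apply: filterS => y hy i _; exact: hy.
    move=> a ina; split.
      move=> [_ ha] i _; apply/(proj2 (HO _) _ ina); exact: ha.
    move=> ha; split; first by exists s; split.
    move=> v Ov vF; have [vs|vs] := boolP (v \in s).
      have /tnthP[i vi] : v \in in_tuple s by [].
      by have := ha i I; rewrite vi in Ov vF *; move=> /(proj2 (HO _) _ ina); exact.
    rewrite (proj1 ina) ?(proj1 (HW v)) //.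
    by move=> /InP; exact/negP.
  have [F UFX] : exists F, forall x, X x -> U F (f x).
    (* Finite lists directed by inclusion: along this filter, compactness turns the local lists into
       a single one. *)
    pose FF := filter_from [set: seq V] (fun F : seq V => [set F' : seq V | {subset F <= F'}]).
    have fFF : Filter FF.
      apply: filter_from_filter; first by exists [::].
      move=> F1 F2 _ _; exists (F1 ++ F2) => // F' h.
      by split=> v vF; apply: h; rewrite mem_cat vF ?orbT.
    have : FF [set F | X `<=` (fun x => X x -> U F (f x))].
      apply: (proj1 (compact_near_coveringP X) cX _ FF (fun F x => X x -> U F (f x))).
      move=> x Xx.
      have [s [Ks us sa a0 _]] : exists s, [/\ K s, uniq s,
          forall v, v \notin s -> f x v = 0, forall v, 0 <= f x v &
          \sum_(v <- s) f x v = 1] by apply/realP; exact: fK.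
      have UFx : U s (f x).
        by split=> [|v _ vs]; [exact: fK|rewrite sa // (proj1 (HW v))].
      exists ([set y | X y -> U s (f y)], [set F : seq V | {subset s <= F}]).
        by split=> /=; [exact: pre|exists s].
      move=> [y F] /= [yU sF] Xy; have [fr h] := yU Xy; split=> // v Ov vF.
      by apply: h => //; apply: contra vF; exact: sF.
    by move=> [F _ h]; exists F => x Xx; exact: (h F).
  exists F => x Xx v vD.
  apply/eqP; rewrite eq_le (real_ge0 _ (fK _ Xx)) andbT leNgt; apply/negP => fx.
  have [y [Xy fy]] := proj2 (HW v) (ex_intro _ x (conj Xx fx)).
  have [_ UF] := UFX _ Xy.
  by have := UF v (ex_intro _ x (conj Xx fx)) vD; rewrite fy ltxx.
move=> v; apply/cont_on_eps => x Xx e e0.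
have : real_open K [set a | realization K a /\ `|f x v - a v| < e].
  split; first by move=> a [].
  move=> s Ks us.
  have [Q0 [oO aO]] := coord_open s v [set z | `|f x v - z| < e] (@ball_open RR RR^o _ _).
  exists Q0; split=> // a ina; rewrite -(aO _ ina) /=; split=> [[]//|h].
  by split=> //; exists s.
move=> /pre /(_ Xx) h.
have : [set a | realization K a /\ `|f x v - a v| < e] (f x).
  by split; [exact: fK|rewrite subrr normr0].
by move=> /h; apply: filterS => y hy Xy; have [] := hy Xy.
Qed.

End SimplicialComplexes.

(** * Homotopies and connectivity *)

Lemma cont_on_setT (T : topologicalType) (f : T -> RR) :
  cont_on setT f -> continuous f.
Proof.
move=> cf x A fA; have : within setT (nbhs x) (f @^-1` A) := cf x I A fA.
rewrite /within /=; apply: (@filterS _ (nbhs x)) => y; exact.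
Qed.

Lemma cont_on_nle (T : topologicalType) (X : set T) (f g : T -> RR) x :
  cont_on X f -> cont_on X g -> X x -> ~ (f x <= g x) ->
  \forall y \near x, X y -> ~ (f y <= g y).
Proof.
move=> cf cg Xx /negP; rewrite -ltNge -subr_gt0 => fg.
have := cont_on_pos (cont_onB cf cg) Xx fg.
by apply: filterS => y h Xy; have := h Xy; rewrite subr_gt0 ltNge => /negP.
Qed.

Lemma cont_on_sqrt (T : topologicalType) (X : set T) f :
  cont_on X f -> cont_on X (fun x => Num.sqrt (f x)).
Proof. by apply: cont_on_comp; exact: sqrt_continuous. Qed.

Definition sqn n (x : 'rV[RR]_n) : RR := \sum_i x ord0 i ^+ 2.

Lemma cont_on_sqn (T : topologicalType) (X : set T) n (u : T -> 'rV[RR]_n) :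
  (forall i, cont_on X (fun x => u x ord0 i)) -> cont_on X (fun x => sqn (u x)).
Proof.
move=> cu; apply: cont_on_sum => i _.
by apply: (cont_on_eq (f := fun x => u x ord0 i * u x ord0 i)) => //; exact: cont_onM.
Qed.

Lemma sqn_ge0 n (x : 'rV[RR]_n) : 0 <= sqn x.
Proof. by apply: sumr_ge0 => i _; exact: sqr_ge0. Qed.

Lemma sqnZ n c (x : 'rV[RR]_n) : sqn (c *: x) = c ^+ 2 * sqn x.
Proof. by rewrite mulr_sumr; apply: eq_bigr => i _; rewrite mxE exprMn. Qed.

Lemma sqn_coord n (x : 'rV[RR]_n) i : x ord0 i ^+ 2 <= sqn x.
Proof.
by rewrite /sqn (bigD1 i) //= lerDl sumr_ge0 // => k _; exact: sqr_ge0.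
Qed.

Lemma disk_coord j (x : 'rV[RR]_j.+1) i : disk x -> `|x ord0 i| <= 1.
Proof.
move=> dx; rewrite -(ler_pXn2r (n := 2)) ?nnegrE // expr1n real_normK ?num_real //.
exact: le_trans (sqn_coord x i) dx.
Qed.

Lemma sphere_disk j : @sphere j `<=` @disk j.
Proof. by move=> x; rewrite /sphere /disk /= => ->. Qed.

Lemma disk_compact j : compact (@disk j).
Proof.
apply: (@subclosed_compact _ _
  [set v : 'rV[RR]_j.+1 | forall i, `[-1, 1]%classic (v ord0 i)]).
- have -> : @disk j = (@sqn j.+1) @^-1` [set y | y <= 1] by [].
  apply: (@preimage_closed _ _ (@sqn j.+1) _ _ (@closed_le RR 1)).
  by move=> x _; apply: cont_on_setT; apply: cont_on_sqn => i; exact: cont_on_coord.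
- by apply: (@rV_compact RR j.+1 (fun=> `[-1, 1]%classic)) => i; exact: (@segment_compact RR).
- by move=> x dx i; rewrite /= in_itv /= -ler_norml; exact: disk_coord.
Qed.

Lemma sphere_compact j : compact (@sphere j).
Proof.
apply: (@subclosed_compact _ _ (@disk j)) (@disk_compact j) (@sphere_disk j).
have -> : @sphere j = (@sqn j.+1) @^-1` [set 1] by [].
apply: (@preimage_closed _ _ (@sqn j.+1) _ _ (@closed_eq RR 1)).
by move=> x _; apply: cont_on_setT; apply: cont_on_sqn => i; exact: cont_on_coord.
Qed.

Section ConnectivityOfComplexes.
Variable V : choiceType.
Implicit Types K L : complex V.

Lemma cont_map_sub (T : topologicalType) (X Y : set T) K f :
  Y `<=` X -> cont_map X K f -> cont_map Y K f.
Proof.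
move=> YX [[F Ff] [fK fc]]; split; [|split].
- by exists F => x /YX; exact: Ff.
- by move=> x /YX; exact: fK.
- by move=> v; exact: cont_on_sub (fc v).
Qed.

Lemma cont_map_into (T : topologicalType) (X : set T) K L f :
  (forall x, X x -> realization L (f x)) -> cont_map X K f -> cont_map X L f.
Proof. by move=> fL [Ff [_ fc]]. Qed.

Lemma cont_map_sub_complex (T : topologicalType) (X : set T) K L f :
  (forall s, K s -> L s) -> cont_map X K f -> cont_map X L f.
Proof.
by move=> KL cf; apply: cont_map_into (cf) => x Xx; apply: real_sub KL _; exact: cf.2.1.
Qed.

Lemma cont_map_eq (T : topologicalType) (X : set T) K f g :
  (forall x, X x -> f x = g x) -> cont_map X K f -> cont_map X K g.
Proof.
move=> fg [[F Ff] [fK fc]]; split; [|split].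
- by exists F => x Xx; rewrite -fg //; exact: Ff.
- by move=> x Xx; rewrite -fg //; exact: fK.
- by move=> v; apply: cont_on_eq (fc v) => x Xx; rewrite fg.
Qed.

Lemma cont_map_compose (T S : topologicalType) (X : set T) (Y : set S) K
    (u : T -> S) f :
  (forall x, X x -> Y (u x)) ->
  (forall x, X x -> u @ within X (nbhs x) --> u x) ->
  cont_map Y K f -> cont_map X K (fun x => f (u x)).
Proof.
move=> XY cu [[F Ff] [fK fc]]; split; [|split].
- by exists F => x /XY; exact: Ff.
- by move=> x /XY; exact: fK.
- by move=> v; apply: (cont_on_compose (f := f^~ v)) (fc v).
Qed.

Lemma cont_map_glue (T : topologicalType) (X C D : set T) K f :
  (forall x, X x -> ~ C x -> \forall y \near x, X y -> ~ C y) ->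
  (forall x, X x -> ~ D x -> \forall y \near x, X y -> ~ D y) ->
  X `<=` C `|` D ->
  cont_map (X `&` C) K f -> cont_map (X `&` D) K f -> cont_map X K f.
Proof.
move=> cC cD XCD [[F Ff] [fK fc]] [[F' Ff'] [fK' fc']]; split; [|split].
- exists (F ++ F') => x Xx v; rewrite mem_cat => /norP[vF vF'].
  by have [Cx|Dx] := XCD _ Xx; [exact: Ff|exact: Ff'].
- by move=> x Xx; have [Cx|Dx] := XCD _ Xx; [exact: fK|exact: fK'].
- by move=> v; apply: (@cont_on_glue _ X C D).
Qed.

(** The working form of connectivity; [kconnP] identifies it with the topological one, spheres and
    disks being compact. *)
Definition kconn K (k : int) :=
  ((-1 <= k) -> exists a, realization K a) /\
  forall j : nat, (j%:Z <= k) -> forall f, cont_map (@sphere j) K f ->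
    exists g, cont_map (@disk j) K g /\ forall x, @sphere j x -> g x = f x.

Lemma kconnP K k : simplicial K -> (k_connected K k <-> kconn K k).
Proof.
move=> sK; split=> -[ne h]; split=> // j jk f cf.
  have [g [cg gf]] := h j jk f (cont_into_of_map sK cf).
  by exists g; split=> //; apply: cont_map_of_into cg; exact: disk_compact.
have [g [cg gf]] := h j jk f (cont_map_of_into (@sphere_compact j) cf).
by exists g; split=> //; exact: cont_into_of_map.
Qed.

Lemma kconn_le K k l : k <= l -> kconn K l -> kconn K k.
Proof.
move=> kl [ne h]; split=> [k1|j jk]; first by apply: ne; exact: le_trans kl.
by apply: h; exact: le_trans kl.
Qed.

(* The homotopy [H] is run on the collar [1/2 <= |x| <= 1], and the extension of
   its end on the inner disk of radius 1/2. *)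
Lemma homotopy_extension K j (f : 'rV[RR]_j.+1 -> V -> RR)
    (H : 'rV[RR]_j.+1 -> RR -> V -> RR) (g : 'rV[RR]_j.+1 -> V -> RR) :
  cont_map [set p : 'rV[RR]_j.+1 * RR | sphere p.1 /\ 0 <= p.2 <= 1] K
    (fun p => H p.1 p.2) ->
  (forall x, sphere x -> H x 0 = f x) ->
  (forall x, sphere x -> H x 1 = g x) ->
  cont_map (@disk j) K g ->
  exists g', cont_map (@disk j) K g' /\ forall x, sphere x -> g' x = f x.
Proof.
move=> cH H0 H1 cg; pose nrm (x : 'rV[RR]_j.+1) := Num.sqrt (sqn x).
have cnrm X : cont_on X nrm.
  by apply: cont_on_sqrt; apply: cont_on_sqn => i; exact: cont_on_coord.
have nrm2 x : nrm x ^+ 2 = sqn x by rewrite sqr_sqrtr // sqn_ge0.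
have nrm0 x : 0 <= nrm x by exact: sqrtr_ge0.
have dnrm x : disk x <-> nrm x <= 1.
  rewrite -(ler_pXn2r (n := 2)) ?nnegrE ?ler01 // nrm2 expr1n; tauto.
have snrm x : nrm x != 0 -> sphere ((nrm x)^-1 *: x).
  move=> nx; rewrite /sphere /= -/(sqn _) sqnZ -nrm2 -exprMn mulVf //.
  by rewrite expr1n.
pose F x := if nrm x <= 2^-1 then g (2 *: x) else H ((nrm x)^-1 *: x) (2 - 2 * nrm x).
have FH x : 2^-1 <= nrm x -> F x = H ((nrm x)^-1 *: x) (2 - 2 * nrm x).
  move=> nx; rewrite /F; case: ifP => // nx'.
  have e : nrm x = 2^-1 by apply/eqP; rewrite eq_le nx' nx.
  have n0 : nrm x != 0 by rewrite e invr_eq0 pnatr_eq0.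
  rewrite e invrK (_ : 2 - 2 * 2^-1 = 1); last by lra.
  by rewrite H1 //; have := snrm x n0; rewrite e invrK.
exists F; split; last first.
  move=> x sx; have n1 : nrm x = 1 by rewrite /nrm /sqn; move: sx => /= ->; exact: sqrtr1.
  by rewrite FH n1 ?invr1 ?scale1r ?mulr1 ?subrr ?H0 //; lra.
apply: (@cont_map_glue _ _ [set x | nrm x <= 2^-1] [set x | 2^-1 <= nrm x]).
- by move=> x dx; apply: (@cont_on_nle _ _ nrm (fun=> 2^-1)) => //; exact: cont_on_cst.
- by move=> x dx; apply: (@cont_on_nle _ _ (fun=> 2^-1) nrm) => //; exact: cont_on_cst.
- by move=> x _ /=; have [|/ltW] := leP (nrm x) 2^-1; [left|right].
- apply: (@cont_map_eq _ _ K (fun x : 'rV[RR]_j.+1 => g (2 *: x)) F) => [x [_ /= nx]|].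
    by rewrite /F nx.
  apply: cont_map_compose cg => [x [_ /= nx]|].
    rewrite /disk /= -/(sqn _) sqnZ -nrm2 -exprMn expr_le1 //; last first.
      by rewrite mulr_ge0.
    lra.
  apply: cvg_within_rV => i.
  apply: (cont_on_eq (f := fun x : 'rV[RR]_j.+1 => 2 * x ord0 i)) => [x _|].
    by rewrite mxE.
  by apply: cont_onM; [exact: cont_on_cst|exact: cont_on_coord].
apply: (@cont_map_eq _ _ K (fun x : 'rV[RR]_j.+1 => H ((nrm x)^-1 *: x) (2 - 2 * nrm x)) F) => [x [_ /= nx]|].
  by rewrite FH.
apply: (cont_map_compose (u := fun x => ((nrm x)^-1 *: x, 2 - 2 * nrm x))) cH.
  move=> x [/dnrm dx /= nx]; split => /=; first by apply: snrm; apply: lt0r_neq0; lra.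
  by apply/andP; split; lra.
move=> x Xx.
have c1 : (fun y => (nrm y)^-1 *: y) @
    within ((@disk j) `&` [set x | 2^-1 <= nrm x]) (nbhs x) --> (nrm x)^-1 *: x.
  apply: (cvg_within_rV (u := fun y => (nrm y)^-1 *: y)) (Xx) => i.
  apply: (cont_on_eq (f := fun x : 'rV[RR]_j.+1 => (nrm x)^-1 * x ord0 i)) => [y _|].
    by rewrite mxE.
  apply: cont_onM; last exact: cont_on_coord.
  by apply: cont_onV => // y [_ /= ny]; apply: lt0r_neq0; lra.
have c2 : cont_on ((@disk j) `&` [set x | 2^-1 <= nrm x]) (fun x => 2 - 2 * nrm x).
  by apply: cont_onB; [exact: cont_on_cst|apply: cont_onM => //; exact: cont_on_cst].
exact: (cvg_pair c1 (c2 x Xx)).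
Qed.

(** The support of [g x] lies in that of [f x], so the whole segment stays in the carrier simplex of
    [f x]. *)
Lemma cont_map_segment (T : topologicalType) (X : set T) K f g : simplicial K ->
  cont_map X K f -> cont_map X K g ->
  (forall x v, X x -> 0 < g x v -> 0 < f x v) ->
  cont_map [set p : T * RR | X p.1 /\ 0 <= p.2 <= 1] K
    (fun p v => (1 - p.2) * f p.1 v + p.2 * g p.1 v).
Proof.
move=> sK [[F Ff] [fK fc]] [[G Gg] [gK gc]] sfg.
have hF x v : X x -> v \notin undup (F ++ G) -> f x v = 0 /\ g x v = 0.
  by move=> Xx; rewrite mem_undup mem_cat => /norP[/(Ff _ Xx) -> /(Gg _ Xx) ->].
split; [|split].
- exists (undup (F ++ G)) => -[x t] [/= Xx _] v vF.
  by have [-> ->] := hF _ _ Xx vF; rewrite !mulr0 addr0.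
- move=> [x t] [/= Xx /andP[t0 t1]].
  have [s [Ks us sE f0 _]] := real_support sK (fK _ Xx).
  apply: (@real_intro _ K _ s (undup (F ++ G))) => //.
  + move=> v; rewrite sE => fv.
    have fv0 : f x v = 0 by apply/eqP; rewrite eq_le f0 andbT leNgt.
    have gv0 : g x v = 0.
      apply/eqP; rewrite eq_le (real_ge0 _ (gK _ Xx)) andbT leNgt.
      by apply: contra fv; exact: sfg.
    by rewrite fv0 gv0 !mulr0 addr0.
  + move=> v; have := f0 v; have := real_ge0 v (gK _ Xx) => ? ?.
    by rewrite addr_ge0 // mulr_ge0 // subr_ge0.
  + exact: undup_uniq.
  + by move=> v vF; have [-> ->] := hF _ _ Xx vF; rewrite !mulr0 addr0.
  + rewrite big_split /= -!mulr_sumr.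
    rewrite (real_sum (fK _ Xx) (undup_uniq _)) => [|v /(hF _ _ Xx)[]//].
    rewrite (real_sum (gK _ Xx) (undup_uniq _)) => [|v /(hF _ _ Xx)[]//].
    by rewrite !mulr1 subrK.
- move=> v; apply: cont_onD; apply: cont_onM.
  + by apply: cont_onB; [exact: cont_on_cst|exact: cont_on_snd].
  + by apply: (@cont_on_fst _ _ X _ (f^~ v)) => // p [].
  + exact: cont_on_snd.
  + by apply: (@cont_on_fst _ _ X _ (g^~ v)) => // p [].
Qed.

End ConnectivityOfComplexes.

(** * Approximation on the nerve of a fine partition of unity *)

Lemma bigmin_attained (I : finType) (P : pred I) (F : I -> RR) (idx : RR) :
  \big[Num.min/idx]_(i | P i) F i = idx \/
  exists2 i, P i & \big[Num.min/idx]_(i | P i) F i = F i.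
Proof.
apply: (big_ind (fun z => z = idx \/ exists2 i, P i & z = F i)).
- by left.
- by move=> x y hx hy; rewrite minEle; case: ifP.
- by move=> i Pi; right; exists i.
Qed.

Section Approximation.
Variable V : choiceType.

(** A Lebesgue number for the cover of [X] by the preimages of open vertex stars. The factor 2
    bounds, in units of the mesh, the diameter of the support of a Kuhn coordinate. *)
Lemma lebesgue_mesh (K : complex V) p (X : set 'rV[RR]_p) f :
  compact X -> cont_map X K f ->
  exists M : nat, forall x, X x -> exists v, forall y, X y ->
    (forall i, `|x ord0 i - y ord0 i| <= 2 / M.+1%:R) -> 0 < f y v.
Proof.
move=> cX [_ [fK fc]].
have : \forall M \near \oo, X `<=` (fun x => X x -> exists v, forall y, X y ->
    (forall i, `|x ord0 i - y ord0 i| <= 2 / M.+1%:R) -> 0 < f y v).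
  apply: (proj1 (compact_near_coveringP X) cX nat _ (fun (M : nat) x => X x ->
    exists v, forall y, X y ->
    (forall i, `|x ord0 i - y ord0 i| <= 2 / M.+1%:R) -> 0 < f y v)).
  move=> x Xx.
  have [v fv] : exists v, 0 < f x v.
    apply: contrapT => h; have /realP[s [Ks us sa a0 a1]] := fK _ Xx.
    move: a1; rewrite big1 => [/eqP|v _]; first by rewrite eq_sym oner_eq0.
    apply/eqP; rewrite eq_le a0 andbT leNgt; apply/negP => fv.
    by apply: h; exists v.
  have /nbhs_ballP[e /= e0 he] := cont_on_pos (fc v) Xx fv.
  have e4 : 0 < e / 4 by rewrite divr_gt0.
  exists (ball x (e / 2), [set M | M.+1%:R^-1 < e / 4]).
    split; first by apply: nbhsx_ballx; rewrite divr_gt0.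
    exact: (near_infty_natSinv_lt (PosNum e4)).
  move=> [x' M] /= [[_ bx'] hM] Xx'; exists v => y Xy xy; apply: he => //.
  split=> // i k; rewrite ord1 => {i}; have := bx' ord0 k.
  rewrite /ball /= => b1; have := xy k => b2.
  have := ler_distD (x' ord0 k) (x ord0 k) (y ord0 k).
  move: hM b1 b2; set t := M.+1%:R^-1; set A := `|_|; set B := `|_|; set C := `|_|.
  lra.
by move=> [M _ /(_ M (leqnn M)) h]; exists M => x Xx; exact: h.
Qed.

(* [kuhn xi g] is the barycentric coordinate of [xi] at the lattice point [g] in
   the Freudenthal-Kuhn triangulation of R^p: it is the length of the set of the
   s in [0,1] such that [floor (xi_i + s) = g_i] for all i (up to [s -> 1 - s]). *)
Definition kuhn p (xi : 'I_p -> RR) (g : 'I_p -> nat) : RR :=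
  Num.max 0 (1 + \big[Num.min/0]_i (xi i - (g i)%:R)
               - \big[Num.max/0]_i (xi i - (g i)%:R)).

Lemma kuhn_gt0 p (xi : 'I_p -> RR) (g : 'I_p -> nat) : 0 < kuhn xi g ->
  (forall i, `|xi i - (g i)%:R| < 1) /\
  (forall i k, (xi i - (g i)%:R) - (xi k - (g k)%:R) < 1).
Proof.
rewrite /kuhn lt_max ltxx /=.
set lo := \big[_/_]_i _; set hi := \big[_/_]_i _ => h.
have hlo i : lo <= xi i - (g i)%:R by exact: bigmin_le_cond.
have hhi i : xi i - (g i)%:R <= hi by exact: le_bigmax_cond.
have lo0 : lo <= 0 by exact: bigmin_le_id.
have hi0 : 0 <= hi by exact: bigmax_ge_id.
split=> [i|i k]; last by have := hlo k; have := hhi i; lra.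
by rewrite ltr_norml; have := hlo i; have := hhi i; lra.
Qed.

(** The floor of a point carries positive weight, so the total weight in the partition of unity is
    positive. *)
Lemma kuhn_floor p (xi : 'I_p -> RR) (g : 'I_p -> nat) :
  (forall i, (g i)%:R <= xi i < (g i).+1%:R) -> 0 < kuhn xi g.
Proof.
move=> hg; rewrite /kuhn lt_max; apply/orP; right.
have -> : \big[Num.min/0]_i (xi i - (g i)%:R) = 0.
  apply/eqP; rewrite eq_le bigmin_le_id /=; apply/bigmin_geP; split=> // i _.
  by rewrite subr_ge0; case/andP: (hg i).
rewrite addr0 subr_gt0; apply: bigmax_lt => // i _.
by case/andP: (hg i) => _; rewrite -natr1; lra.
Qed.

(** For each lattice point of positive weight the offsets from [xi] spread over less than 1, which
    makes any two such points comparable coordinatewise. The coordinate sum is then injective on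
    them, and from the lowest one each coordinate grows by at most 1, so the sum takes at most
    [p + 1] values. *)
Lemma kuhn_mult p m (xi : 'I_p -> RR) :
  (#|[pred g : {ffun 'I_p -> 'I_m} | (0 < kuhn xi (fun i => g i))%R]| <= p.+1)%N.
Proof.
set N := [pred g | _].
case: (pickP N) => [g0 Ng0|N0]; last by rewrite eq_card0.
pose S (g : {ffun 'I_p -> 'I_m}) := (\sum_i (g i : nat))%N.
case: (arg_minnP S Ng0) => g1 Ng1 min1.
have mono (g g' : {ffun 'I_p -> 'I_m}) : N g -> N g' ->
    (forall i, g i <= g' i)%N \/ (forall i, g' i <= g i)%N.
  move=> /kuhn_gt0[_ h] /kuhn_gt0[_ h'].
  apply: contrapT => /not_orP[/existsNP[i /negP gi] /existsNP[k /negP gk]].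
  rewrite -ltnNge in gi; rewrite -ltnNge in gk.
  have := h k i; have := h' i k.
  have : (g' i).+1%:R <= (g i)%:R :> RR by rewrite ler_nat.
  have : (g k).+1%:R <= (g' k)%:R :> RR by rewrite ler_nat.
  rewrite -!natr1; lra.
have Sinj g g' : N g -> N g' -> (forall i, g i <= g' i)%N -> S g = S g' -> g = g'.
  move=> _ _ le eS; apply/ffunP => i; apply/val_inj/eqP; rewrite eqn_leq le /=.
  rewrite leqNgt; apply/negP => lt; have : (S g < S g')%N.
    rewrite /S (bigD1 i) //= [X in (_ < X)%N](bigD1 i) //= -addSn leq_add //.
    by apply: leq_sum => k _; exact: le.
  by rewrite eS ltnn.
have inj : {in enum N &, injective S}.
  move=> g g'; rewrite !mem_enum => Ng Ng' eS.
  have [le|le] := mono g g' Ng Ng'; first exact: Sinj.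
  by apply/esym; exact: Sinj.
rewrite cardE -(size_map S) -(size_iota (S g1) p.+1).
apply: uniq_leq_size; first by rewrite map_inj_in_uniq ?enum_uniq.
move=> z /mapP[g]; rewrite mem_enum => Ng ->; rewrite mem_iota (min1 _ Ng) /=.
have [le|le] := mono g g1 Ng Ng1.
  by rewrite addnS ltnS (leq_trans (leq_sum _ (fun i _ => le i))) // leq_addr.
rewrite addnS ltnS -[X in (_ + X)%N]card_ord -sum1_card /S -big_split /=.
apply: leq_sum => i _; rewrite addn1.
have [h _] := kuhn_gt0 Ng; have [h1 _] := kuhn_gt0 Ng1.
rewrite leqNgt; apply/negP => lt.
have := h i; have := h1 i; rewrite !ltr_norml.
have : (g1 i).+2%:R <= (g i)%:R :> RR by rewrite ler_nat.
rewrite -!natr1; lra.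
Qed.

(** The weights are normalised Kuhn coordinates on a grid finer than the Lebesgue number; [k g] is a
    vertex whose coordinate is positive on the support of the weight [g]. By the last clause the
    approximating simplicial map has its carriers inside those of [f], so segments join the two. *)
Lemma approximation (K : complex V) p (X : set 'rV[RR]_p) f :
  compact X -> (forall x i, X x -> `|x ord0 i| <= 1) -> X !=set0 -> cont_map X K f ->
  exists (G : finType) (w : G -> 'rV[RR]_p -> RR) (k : G -> V),
    [/\ forall g, cont_on X (w g), forall x g, X x -> 0 <= w g x,
        forall x, X x -> \sum_g w g x = 1,
        forall x, X x -> (#|[pred g | (0 < w g x)%R]| <= p.+1)%N &
        forall x g, X x -> 0 < w g x -> 0 < f x (k g)].
Proof.
move=> cX X1 [x0 Xx0] cf; have [M hM] := lebesgue_mesh cX cf.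
(* This maps [-1, 1] onto [0, 2(M+1)], whence [2 * M.+1 + 1] lattice values per coordinate. *)
pose xi (x : 'rV[RR]_p) (i : 'I_p) := M.+1%:R * (x ord0 i + 1).
pose G : finType := {ffun 'I_p -> 'I_(2 * M.+1).+1}.
pose om (g : G) x := kuhn (xi x) (fun i => g i).
have com g : cont_on X (om g).
  have cxi i : cont_on X (fun x => xi x i - (g i)%:R).
    apply: cont_onB; last exact: cont_on_cst.
    by apply: cont_onM; [exact: cont_on_cst|apply: cont_onD; [exact: cont_on_coord|exact: cont_on_cst]].
  apply: cont_on_max; first exact: cont_on_cst.
  apply: cont_onB; last exact: cont_on_bigmax.
  by apply: cont_onD; [exact: cont_on_cst|exact: cont_on_bigmin].
have om0 g x : 0 <= om g x by rewrite le_max lexx.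
have tot x : X x -> 0 < \sum_g om g x.
  move=> Xx.
  have xi0 i : 0 <= xi x i.
    by rewrite mulr_ge0 ?ler0n //; have := X1 x i Xx; rewrite ler_norml; lra.
  have ft i : (Num.truncn (xi x i) < (2 * M.+1).+1)%N.
    rewrite ltnS -(ler_nat RR) (le_trans (_ : _ <= xi x i)) //.
      by have /andP[] := truncn_itv (xi0 i).
    rewrite natrM mulrC /xi ler_pM2l ?ltr0n //.
    by have := X1 x i Xx; rewrite ler_norml; lra.
  pose g : G := [ffun i => Ordinal (ft i)].
  rewrite (bigD1 g) //= ltr_pwDl ?sumr_ge0 // /om; apply: kuhn_floor => i.
  by rewrite ffunE /=; exact: truncn_itv.
have [k hk] : exists k : G -> V, forall g x, X x -> 0 < om g x -> 0 < f x (k g).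
  suff h (g : G) : exists v, forall x, X x -> 0 < om g x -> 0 < f x v.
    by have [k hk] := choice h; exists k.
  (* A grid point whose weight vanishes on [X] may receive any vertex; one found at [x0] is
     taken. *)
  have [[x1 [Xx1 ox1]]|no] := pselect (exists x1, X x1 /\ 0 < om g x1); last first.
    have [v _] := hM _ Xx0; exists v => x Xx ox; case: no; by exists x.
  have [v hv] := hM _ Xx1; exists v => y Xy oy; apply: hv => // i.
  have [h1 _] := kuhn_gt0 ox1; have [h2 _] := kuhn_gt0 oy.
  have : `|xi x1 i - xi y i| <= 2.
    by have := h1 i; have := h2 i; rewrite !ltr_norml ler_norml; lra.
  rewrite /xi -mulrBr normrM normr_nat ler_pdivlMr ?ltr0n // mulrC.
  by rewrite (_ : x1 ord0 i + 1 - (y ord0 i + 1) = x1 ord0 i - y ord0 i) //; lra.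
exists G, (fun g x => om g x / \sum_g' om g' x), k; split.
- move=> g; apply: cont_onM => //; apply: cont_onV; last by apply: cont_on_sum.
  by move=> x Xx; apply/lt0r_neq0/tot.
- by move=> x g Xx; rewrite divr_ge0 // ltW // tot.
- by move=> x Xx; rewrite -mulr_suml divff // lt0r_neq0 // tot.
- move=> x Xx; apply: leq_trans (kuhn_mult (2 * M.+1).+1 (xi x)).
  apply: subset_leq_card; apply/fintype.subsetP => g; rewrite !inE.
  by rewrite pmulr_lgt0 // invr_gt0 tot.
- by move=> x g Xx; rewrite pmulr_lgt0 ?invr_gt0 ?tot //; exact: hk.
Qed.

End Approximation.

(** * Extension of maps over finite complexes *)

Section FiniteDomains.
Variables (G : finType) (V : choiceType).
Implicit Types (s t : {set G}) (y : G -> RR) (P Q : pred {set G}).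

Definition in_simplex s y :=
  [/\ forall g, 0 <= y g, forall g, g \notin s -> y g = 0 & \sum_g y g = 1].

Lemma in_simplex_sub s t y : s \subset t -> in_simplex s y -> in_simplex t y.
Proof.
move=> /fintype.subsetP st [y0 ys y1]; split=> // g gt; apply: ys.
by apply: contra gt; exact: st.
Qed.

Lemma in_simplex_setI s t y :
  in_simplex s y -> in_simplex t y -> in_simplex (s :&: t) y.
Proof.
move=> [y0 ys y1] [_ yt _]; split=> // g.
by rewrite inE negb_and => /orP[/ys|/yt].
Qed.

Lemma in_simplex_sum s y : in_simplex s y -> \sum_(g in s) y g = 1.
Proof.
move=> [_ ys <-]; rewrite [RHS](bigID (fun g => g \in s)) /=.
by rewrite [X in _ = _ + X]big1 ?addr0.
Qed.

Lemma in_simplex_neq0 s y : in_simplex s y -> s != finset.set0.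
Proof.
move=> /in_simplex_sum; apply: contra_eq_neq => ->.
by rewrite big_set0 eq_sym oner_eq0.
Qed.

(* Continuity on the realization of the finite complex [P] is tested along
   continuous families of points, so that this realization needs no topology. *)
Definition tcont P (h : (G -> RR) -> V -> RR) :=
  (exists F : seq V, forall s y, P s -> in_simplex s y -> forall v, v \notin F -> h y v = 0) /\
  forall (T : topologicalType) (X : set T) (u : T -> G -> RR),
    (forall g, cont_on X (u^~ g)) ->
    (forall x, X x -> exists s, P s /\ in_simplex s (u x)) ->
    forall v, cont_on X (fun x => h (u x) v).

(** Subcomplexes are closed: positive coordinates stay positive nearby, so a simplex containing
    [u y] for [y] near [x] already contains [u x]. *)
Lemma in_simplex_open (T : topologicalType) (X : set T) (u : T -> G -> RR) P x :
  (forall g, cont_on X (u^~ g)) -> (forall x, X x -> exists s, in_simplex s (u x)) ->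
  X x -> ~ (exists s, P s /\ in_simplex s (u x)) ->
  \forall y \near x, X y -> ~ (exists s, P s /\ in_simplex s (u y)).
Proof.
move=> cu uX Xx nx.
have [s [y0 ys y1]] := uX x Xx.
have : \forall y \near x, forall g, X y -> 0 < u x g -> 0 < u y g.
  apply: (@filter_forall T G (fun g (y : T) => X y -> 0 < u x g -> 0 < u y g) (nbhs x) _) => g.
  have [ug|ug] := ltP 0 (u x g); last first.
    exact: filterE.
  by apply: filterS (cont_on_pos (cu g) Xx ug) => y h Xy _; exact: h.
apply: filterS => y h Xy [t [Pt [_ yt _]]]; apply: nx; exists t; split=> //.
split=> // g gt; apply/eqP; rewrite eq_le y0 andbT leNgt; apply/negP => /(h _ Xy).
by rewrite yt ?ltxx.
Qed.

Lemma tcont_sub P Q h : (forall s y, Q s -> in_simplex s y -> P s) ->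
  tcont P h -> tcont Q h.
Proof.
move=> QP [[F hF] hc]; split.
  by exists F => s y Qs sy; apply: (hF s) => //; exact: QP sy.
move=> T X u cu uX; apply: hc => // x /uX[s [Qs iu]].
by exists s; split=> //; exact: QP iu.
Qed.

Lemma tcont_glue P Q h k :
  tcont P h -> tcont Q k -> (forall s t y, P s -> Q t -> in_simplex s y ->
    in_simplex t y -> h y = k y) ->
  exists l, [/\ tcont [predU P & Q] l,
    forall s y, P s -> in_simplex s y -> l y = h y &
    forall s y, Q s -> in_simplex s y -> l y = k y].
Proof.
move=> [[F hF] hc] [[F' kF] kc] hk.
pose l y := if `[< exists s, P s /\ in_simplex s y >] then h y else k y.
have lP s y : P s -> in_simplex s y -> l y = h y.
  by move=> Ps sy; rewrite /l asboolT //; exists s.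
have lQ s y : Q s -> in_simplex s y -> l y = k y.
  by move=> Qs sy; rewrite /l; case: asboolP => // -[t [Pt ty]]; exact: (hk t s).
exists l; split=> //; split.
  exists (F ++ F') => s y /orP[Ps|Qs] sy v; rewrite mem_cat => /norP[vF vF'].
    by rewrite (lP s) //; exact: (hF s).
  by rewrite (lQ s) //; exact: (kF s).
move=> T X u cu uX v.
have iu x : X x -> exists s, in_simplex s (u x) by move=> /uX[s []]; exists s.
apply: (@cont_on_glue _ X [set x | exists s, P s /\ in_simplex s (u x)]
                     [set x | exists s, Q s /\ in_simplex s (u x)]).
- by move=> x; exact: in_simplex_open.
- by move=> x; exact: in_simplex_open.
- move=> x /uX[s [/orP[Ps|Qs] sy]]; [left|right]; by exists s.
- apply: (cont_on_eq (f := fun x => h (u x) v)); first by move=> x [_ [s [Ps sy]]]; rewrite (lP s).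
  by apply: hc => [g|x []//]; apply: cont_on_sub (cu g) => x [].
- apply: (cont_on_eq (f := fun x => k (u x) v)); first by move=> x [_ [s [Ps sy]]]; rewrite (lQ s).
  by apply: kc => [g|x []//]; apply: cont_on_sub (cu g) => x [].
Qed.

Lemma simplex_extension (L : complex V) s f :
  s != finset.set0 -> kconn L (#|s|%:Z - 2) ->
  tcont [pred t : {set G} | t \proper s] f ->
  (forall t y, t \proper s -> in_simplex t y -> realization L (f y)) ->
  exists h, [/\ tcont (pred1 s) h,
    forall y, in_simplex s y -> realization L (h y) &
    forall t y, t \proper s -> in_simplex t y -> h y = f y].
Proof.
move=> s0 [ne kL] [[F fF] fc] fL.
have [g0 g0s] := set0Pn _ s0.
have cs : #|s| = #|s :\ g0|.+1 by rewrite (cardsD1 g0) g0s.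
(* A single vertex has empty boundary, and any point of [L] gives the extension. *)
case: (posnP #|s :\ g0|) => [c0|cgt0].
  have [|a La] := ne; first by rewrite cs c0.
  have no t y : t \proper s -> ~ in_simplex t y.
    move=> /proper_card; rewrite cs c0 ltnS leqn0 cards_eq0 => /eqP -> h.
    by have := in_simplex_neq0 h; rewrite eqxx.
  exists (fun=> a); split=> //; last by move=> t y ts /(no _ _ ts).
  split; last by move=> T X u _ _ v; exact: cont_on_cst.
  by have /realP[r [_ _ ra _ _]] := La; exists r => t y _ _ v; exact: ra.
have [j cj] : exists j, #|s :\ g0| = j.+1 by exists #|s :\ g0|.-1; rewrite prednK.
have {}kL := kL j; rewrite cs cj in kL.
have {}kL : forall f, cont_map (@sphere j) L f ->
    exists g, cont_map (@disk j) L g /\ forall x, @sphere j x -> g x = f x.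
  by apply: kL; lia.
have [r [r' [rs rK r'K]]] : exists (r : 'I_j.+1 -> G) (r' : G -> 'I_j.+1),
    [/\ forall i, r i \in s :\ g0, cancel r r' & {in s :\ g0, cancel r' r}].
  have [g1 g1s] : exists g1, g1 \in s :\ g0 by apply/set0Pn; rewrite -card_gt0.
  exists (fun i => enum_val (cast_ord (esym cj) i)),
         (fun g => cast_ord cj (enum_rank_in g1s g)); split.
  - by move=> i; exact: enum_valP.
  - by move=> i; rewrite enum_valK_in cast_ordKV.
  - by move=> g gs; rewrite cast_ordK enum_rankK_in.
pose zeta (z : 'rV[RR]_j.+1) g := if g == g0 then 0 else z ord0 (r' g).
pose mu z := \big[Num.min/0]_(g in s :\ g0) zeta z g.
pose D z := \sum_(g in s) (zeta z g - mu z).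
pose e z g := if g \in s then (zeta z g - mu z) / D z else 0.
have mule z g : g \in s -> mu z <= zeta z g.
  move=> gs; have [->|gg0] := eqVneq g g0.
    by rewrite /zeta eqxx; exact: bigmin_le_id.
  by apply: bigmin_le_cond; rewrite in_setD1 gg0.
have muat z : exists2 g, g \in s & zeta z g = mu z.
  have : mu z = 0 \/ exists2 g, g \in s :\ g0 & mu z = zeta z g.
    exact: bigmin_attained.
  move=> [->|[g gs ->]].
    by exists g0 => //; rewrite /zeta eqxx.
  by exists g => //; have := gs; rewrite in_setD1 => /andP[].
have D0 z : sphere z -> 0 < D z.
  move=> sz; rewrite lt_def sumr_ge0 ?andbT; last first.
    by move=> g gs; rewrite subr_ge0 mule.
  apply/negP => /eqP/psumr_eq0P h.
  have {}h g : g \in s -> zeta z g = mu z.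
    move=> gs; apply/eqP; rewrite -subr_eq0; apply/eqP/h => //.
    by move=> g' gs'; rewrite subr_ge0 mule.
  have m0 : mu z = 0 by rewrite -(h g0) // /zeta eqxx.
  have /eqP := sz; rewrite /sphere /= big1 ?(eq_sym 0) ?oner_eq0 // => i _.
  have := h (r i); have := rs i; rewrite in_setD1 => /andP[rg rsi] /(_ rsi).
  by rewrite /zeta (negbTE rg) rK m0 => ->; rewrite expr0n.
have ein z : sphere z -> exists t, t \proper s /\ in_simplex t (e z).
  move=> sz; have [g gs mg] := muat z; exists (s :\ g); split.
    by apply/properP; split; [exact: subsetDl|exists g; rewrite // in_setD1 eqxx].
  have Dz := D0 _ sz; split.
  - move=> g'; rewrite /e; case: ifP => // gs'.
    by rewrite divr_ge0 ?subr_ge0 ?mule // ltW.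
  - move=> g'; rewrite in_setD1 negb_and negbK /e => /orP[/eqP ->|/negbTE -> //].
    by rewrite gs mg subrr mul0r.
  - by rewrite /e -big_mkcond /= -mulr_suml divff // lt0r_neq0.
have ce g : cont_on (@sphere j) (fun z => e z g).
  have cz g' : cont_on (@sphere j) (fun z => zeta z g').
    by rewrite /zeta; case: (g' == g0); [exact: cont_on_cst|exact: cont_on_coord].
  have cmu : cont_on (@sphere j) mu by apply: cont_on_bigmin.
  rewrite /e; case: (g \in s); last exact: cont_on_cst.
  apply: cont_onM; first exact: cont_onB.
  apply: cont_onV; first by move=> z /D0 /lt0r_neq0.
  by apply: cont_on_sum => g' _; exact: cont_onB.
have cfe : cont_map (@sphere j) L (fun z => f (e z)).
  split; [|split].
  - by exists F => z /ein[t [ts et]]; exact: (fF t).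
  - by move=> z /ein[t [ts et]]; exact: (fL t).
  - by move=> v; apply: fc.
have [k [[[K kK] [kLr kc]] kf]] := kL _ cfe.
pose d y := \row_i (y (r i) - y g0) : 'rV[RR]_j.+1.
(* Lower bound for the norm of [d y] on the boundary: one coordinate is 0 and another is at least
   1/|s|, so one of them differs by at least 1/(2|s|) from the coordinate at [g0]. The cut-off thus
   changes nothing on the boundary, and it keeps [q] continuous inside, where [d y] may vanish. *)
pose eps : RR := (2 * #|s|%:R)^-1.
have eps0 : 0 < eps by rewrite invr_gt0 mulr_gt0 // ltr0n cs.
pose c y := (Num.max (Num.sqrt (sqn (d y))) eps)^-1.
have cgt y : 0 < c y by rewrite invr_gt0 lt_max eps0 orbT.
pose q y := c y *: d y.
have qdisk y : disk (q y).
  rewrite /disk /= -/(sqn _) sqnZ -[sqn _]sqr_sqrtr ?sqn_ge0 // -exprMn.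
  rewrite expr_le1 ?mulr_ge0 ?sqrtr_ge0 ?(ltW (cgt _)) //.
  by rewrite mulrC ler_pdivrMr ?mul1r ?le_max ?lexx // lt_max eps0 orbT.
have cq (T : topologicalType) (X : set T) (u : T -> G -> RR) :
    (forall g, cont_on X (u^~ g)) -> forall i, cont_on X (fun x => q (u x) ord0 i).
  move=> cu i; have cd i' : cont_on X (fun x => d (u x) ord0 i').
    apply: (cont_on_eq (f := fun x => u x (r i') - u x g0)) => [x _|].
      by rewrite mxE.
    exact: cont_onB.
  apply: (cont_on_eq (f := fun x => c (u x) * d (u x) ord0 i)) => [x _|].
    by rewrite [q _ _ _]mxE.
  apply: cont_onM => //; apply: cont_onV.
    by move=> x _; rewrite gt_eqF // lt_max eps0 orbT.
  by apply: cont_on_max; [exact/cont_on_sqrt/cont_on_sqn|exact: cont_on_cst].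
have qe t y : t \proper s -> in_simplex t y -> sphere (q y) /\ e (q y) = y.
  move=> /properP[ts [g1 g1s g1t]] ty; have [y0 yt ysum] := ty.
  have sy := in_simplex_sub ts ty.
  have yg1 : y g1 = 0 by exact: yt.
  have [g2 g2s yg2] : exists2 g2, g2 \in s & 2 * eps <= y g2.
    apply: contrapT => no; have := in_simplex_sum sy.
    have : \sum_(g in s) y g < \sum_(g in s) 2 * eps.
      apply: ltr_sum; first by apply/hasP; exists g0; rewrite // mem_index_enum.
      by move=> g gs; rewrite ltNge; apply/negP => h; apply: no; exists g.
    have -> : \sum_(g in s) 2 * eps = 1.
      rewrite sumr_const -mulr_natr /eps; field.
      by rewrite pnatr_eq0 cs.
    by move=> lt e1; move: lt; rewrite e1 ltxx.
  have nrm : eps <= Num.sqrt (sqn (d y)).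
    have dle g : g \in s -> `|y g - y g0| <= Num.sqrt (sqn (d y)).
      move=> gs; have [->|gg0] := eqVneq g g0; first by rewrite subrr normr0 sqrtr_ge0.
      have -> : y g - y g0 = d y ord0 (r' g).
        by rewrite mxE r'K // in_setD1 gg0.
      by rewrite -sqrtr_sqr ler_wsqrtr // sqn_coord.
    have := dle _ g1s; have := dle _ g2s; rewrite yg1 !ler_norml.
    by case: (lerP eps (y g0)); lra.
  have cE : c y = (Num.sqrt (sqn (d y)))^-1 by rewrite /c max_l.
  have sq : sphere (q y).
    rewrite /sphere /= -/(sqn _) sqnZ -[sqn _]sqr_sqrtr ?sqn_ge0 // -exprMn cE.
    by rewrite mulVf ?expr1n // gt_eqF // (lt_le_trans eps0).
  split=> //.
  have zE g : g \in s -> zeta (q y) g = c y * (y g - y g0).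
    move=> gs; rewrite /zeta; case: eqP => [->|/eqP gg0]; first by rewrite subrr mulr0.
    by rewrite !mxE r'K // in_setD1 gg0.
  have muE : mu (q y) = - (c y * y g0).
    apply/eqP; rewrite eq_le; apply/andP; split.
      by have := mule (q y) _ g1s; rewrite zE // yg1 sub0r mulrN.
    have [g gs <-] := muat (q y); rewrite zE // mulrBr lerDr.
    by rewrite mulr_ge0 // ltW.
  have zm g : g \in s -> zeta (q y) g - mu (q y) = c y * y g.
    by move=> gs; rewrite zE // muE; ring.
  have DE : D (q y) = c y.
    by rewrite /D (eq_bigr _ zm) -mulr_sumr (in_simplex_sum sy) mulr1.
  apply/funext => g; rewrite /e; case: ifPn => gs; last first.
    by have [_ ->] := sy.
  by rewrite zm // DE mulrC mulrA mulVf ?mul1r // gt_eqF.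
exists (fun y => k (q y)); split.
- split; first by exists K => _ y _ _ v; exact: kK.
  move=> T X u cu _ v; apply: (cont_on_compose (f := k^~ v) (u := fun x => q (u x)) _ _ (kc v)).
    by move=> x _; exact: qdisk.
  by apply: cvg_within_rV; exact: cq.
- by move=> y _; exact: kLr.
- by move=> t y ts ty; have [sq eq] := qe _ _ ts ty; rewrite kf // eq.
Qed.

(** Induction on the number of simplices in [P] but not in [Q]: one of least size has its whole
    boundary in [Q] and is filled inside its carrier. Monotonicity of [Phi] lets the new values
    serve as boundary data for larger simplices. *)
Lemma carrier_extension P (Phi : {set G} -> complex V) Q h0 :
  (forall s t, P s -> t \subset s -> t != finset.set0 -> P t) ->
  (forall s t, Q s -> t \subset s -> t != finset.set0 -> Q t) ->
  (forall s, Q s -> P s) -> (forall s, P s -> s != finset.set0) ->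
  (forall s, P s -> ~~ Q s -> kconn (Phi s) (#|s|%:Z - 2)) ->
  (forall s t, P s -> ~~ Q s -> ~~ Q t -> P t -> t \subset s ->
     forall l, Phi t l -> Phi s l) ->
  (forall s t y, P s -> ~~ Q s -> Q t -> t \subset s -> in_simplex t y ->
     realization (Phi s) (h0 y)) ->
  tcont Q h0 ->
  exists h, [/\ tcont P h, forall t y, Q t -> in_simplex t y -> h y = h0 y &
    forall s y, P s -> ~~ Q s -> in_simplex s y -> realization (Phi s) (h y)].
Proof.
move=> Pc + + P0 + + +.
have [n] := ubnP #|[pred s | P s && ~~ Q s]|.
elim: n Q h0 => // n IH Q h0; rewrite ltnS => Qn Qc QP kP mP QPhi ch0.
have [s0 /andP[Ps0 nQs0]|no] := pickP [pred s | P s && ~~ Q s]; last first.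
  have PQ s : P s -> Q s by move=> Ps; have := no s; rewrite /= Ps /= => /negbFE.
  exists h0; split=> //; first by apply: tcont_sub ch0 => s y /PQ.
  by move=> s y /PQ ->.
have [s /andP[Ps nQs] mins] : exists2 s, P s && ~~ Q s &
    forall t, P t && ~~ Q t -> (#|s| <= #|t|)%N.
  have hs0 : [pred s | P s && ~~ Q s] s0 by rewrite /= Ps0.
  by case: (arg_minnP (fun s => #|s|) hs0) => s; exists s.
have prop t : t \proper s -> t != finset.set0 -> Q t.
  move=> ts t0; apply: contraT => nQt.
  have := mins t; rewrite nQt (Pc s) ?(proper_sub ts) // => /(_ isT).
  by rewrite leqNgt proper_card.
have [||h1 [ch1 h1L h1f]] := @simplex_extension (Phi s) s h0 (P0 _ Ps) (kP _ Ps nQs).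
- by apply: tcont_sub ch0 => t y ts /in_simplex_neq0; exact: prop.
- move=> t y ts ty; apply: (QPhi s t) => //; last exact: proper_sub.
  by apply: prop => //; exact: in_simplex_neq0 ty.
have [|l [cl lQ ls]] := tcont_glue ch0 ch1.
  (* A point of [s] lying in a simplex of [Q] is in a proper face of [s], since [s] is not in
     [Q]. *)
  move=> t _ y Qt /eqP -> ty sy.
  have tsy := in_simplex_setI ty sy.
  rewrite (h1f (t :&: s)) // finset.properEneq finset.subsetIr andbT.
  apply/eqP => /finset.setIidPr st; case/negP: nQs; exact: Qc Qt st (P0 _ Ps).
have [||||||h [ch hl hP]] := IH [predU Q & pred1 s] l _ _ _ _ _ _ cl.
- apply: leq_trans Qn; apply: proper_card; apply/properP; split.
    by apply/fintype.subsetP => t; rewrite !inE negb_or => /and3P[-> ->].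
  by exists s; rewrite !inE ?Ps ?nQs // eqxx orbT andbF.
- move=> t t' /orP[Qt|/eqP ->] tt t0; first by apply/orP; left; exact: (Qc t).
  have [->|ne] := eqVneq t' s; first by apply/orP; right; exact: eqxx.
  by apply/orP; left; apply: prop => //; rewrite finset.properEneq ne.
- by move=> t /orP[/QP|/eqP ->].
- by move=> t Pt; rewrite negb_or => /andP[nQt _]; exact: kP.
- move=> t t' Pt; rewrite negb_or => /andP[nQt _].
  by rewrite negb_or => /andP[nQt' _]; exact: mP.
- move=> t t' y Pt; rewrite negb_or => /andP[nQt _] /orP[Qt'|/eqP ->] tt' ty.
    by rewrite (lQ t') //; exact: (QPhi t t').
  rewrite (ls s) //; last exact: eqxx.
  apply: real_sub (h1L _ ty) => r.
  exact: mP.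
exists h; split=> //.
  by move=> t y Qt ty; rewrite (hl t) ?(lQ t) //; apply/orP; left.
move=> t y Pt nQt ty; have [ts|nts] := eqVneq t s.
  rewrite ts in ty *; rewrite (hl s) ?(ls s) //; first exact: h1L.
  - exact: eqxx.
  - by apply/orP; right; exact: eqxx.
by apply: hP => //; rewrite negb_or nQt.
Qed.

End FiniteDomains.

(** * Simplicial maps and homogeneous extensions *)

Section SimplicialMaps.
Variables (G : finType) (V : choiceType).
Implicit Types (k : G -> V) (y : G -> RR) (s : {set G}).

Definition simpl_map k y (v : V) : RR := \sum_(g | k g == v) y g.

Definition img k s : seq V := [seq k g | g <- enum s].

Lemma imgP k s v : reflect (exists2 g, g \in s & v = k g) (v \in img k s).
Proof.
apply: (iffP mapP) => -[g gs ->]; exists g => //; last by rewrite mem_enum.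
by rewrite mem_enum in gs.
Qed.

Lemma simpl_map_ge0 k y v : (forall g, 0 <= y g) -> 0 <= simpl_map k y v.
Proof. by move=> y0; exact: sumr_ge0. Qed.

Lemma simpl_map_support k y s v : (forall g, g \notin s -> y g = 0) ->
  v \notin img k s -> simpl_map k y v = 0.
Proof.
move=> ys vs; apply: big1 => g /eqP gv; apply: ys; apply: contra vs => gs.
by apply/imgP; exists g.
Qed.

Lemma simpl_map_total k y F : uniq F -> (forall g, k g \in F) ->
  \sum_(v <- F) simpl_map k y v = \sum_g y g.
Proof.
move=> uF kF; rewrite /simpl_map (exchange_big_dep predT) //=.
apply: eq_bigr => g _; rewrite -big_filter.
rewrite (_ : [seq v <- F | k g == v] = [:: k g]) ?big_seq1 //.
by apply: perm_small_eq => //; apply: uniq_perm => [||v];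
  rewrite ?filter_uniq // mem_filter !inE eq_sym; case: eqP => // ->; rewrite kF.
Qed.

Lemma simpl_map_real (K : complex V) k s y : simplicial K -> K (img k s) ->
  in_simplex s y -> realization K (simpl_map k y).
Proof.
move=> sK Ks [y0 ys y1].
have mF g : k g \in undup (codom k) by rewrite mem_undup codom_f.
apply: (@real_intro _ K _ (img k s) (undup (codom k))) => //.
- by move=> v vs; exact: simpl_map_support vs.
- by move=> v; exact: simpl_map_ge0.
- exact: undup_uniq.
- move=> v; rewrite mem_undup => vk; apply: big1 => g /eqP gv.
  by move: vk; rewrite -gv codom_f.
- by rewrite simpl_map_total ?undup_uniq.
Qed.

Lemma simpl_map_tcont k P : tcont P (simpl_map k).
Proof.
split; last by move=> T X u cu _ v; exact: cont_on_sum.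
exists (codom k) => s y _ _ v vk; apply: big1 => g /eqP gv.
by move: vk; rewrite -gv codom_f.
Qed.

End SimplicialMaps.

(** The list may be empty because the support of a part of a join may be; positivity of the sum
    rules this out for the whole. *)
Lemma normalised_real (V : choiceType) (K : complex V) s a F : simplicial K ->
  (s = [::] \/ K s) -> (forall v, v \notin s -> a v = 0) ->
  (forall v, 0 <= a v) -> uniq F -> (forall v, v \notin F -> a v = 0) ->
  0 < \sum_(v <- F) a v -> realization K (fun v => a v / \sum_(v <- F) a v).
Proof.
move=> sK hs sa a0 uF Fa a1.
have Ks : K s.
  case: hs => // s0; move: a1; rewrite big1 ?ltxx // => v _.
  by apply: sa; rewrite s0.
apply: (real_intro (F := F) sK Ks) => //.
- by move=> v /sa ->; rewrite mul0r.
- by move=> v; rewrite divr_ge0 // ltW.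
- by move=> v /Fa ->; rewrite mul0r.
- by rewrite -mulr_suml divff // gt_eqF.
Qed.

Section Homogeneous.
Variables (G : finType) (V : choiceType) (P : pred {set G}).
Variable h : (G -> RR) -> V -> RR.
Hypothesis ch : tcont P h.
Hypothesis h01 : forall s y v, P s -> in_simplex s y -> 0 <= h y v <= 1.

Definition total (y : G -> RR) : RR := \sum_g y g.

(** Homogeneous extension of degree 1 to the cone of nonnegative vectors. The apex goes to 0, the
    meaningless quotient being multiplied by 0. *)
Definition hat (y : G -> RR) (v : V) : RR :=
  total y * h (fun g => y g / total y) v.

Lemma in_simplex_normalise (s : {set G}) (y : G -> RR) : (forall g, 0 <= y g) ->
  (forall g, g \notin s -> y g = 0) -> 0 < total y ->
  in_simplex s (fun g => y g / total y).
Proof.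
move=> y0 ys t0; split=> [g|g /ys ->|]; [by rewrite divr_ge0 // ltW|by rewrite mul0r|].
by rewrite -mulr_suml divff // gt_eqF.
Qed.

(** Where the total is positive this is continuity of [h] on normalised points; at total 0 it
    follows from the bound of each coordinate by the total, as [h] takes values in [0, 1]. *)
Lemma hat_cont_on (T : topologicalType) (X : set T) (u : T -> G -> RR) v :
  (forall g, cont_on X (u^~ g)) -> (forall x g, X x -> 0 <= u x g) ->
  (forall x, X x -> 0 < total (u x) ->
     exists s, P s /\ forall g, g \notin s -> u x g = 0) ->
  cont_on X (fun x => hat (u x) v).
Proof.
move=> cu u0 us.
have ct : cont_on X (fun x => total (u x)) by exact: cont_on_sum.
have t0 x : X x -> 0 <= total (u x) by move=> Xx; apply: sumr_ge0 => g _; exact: u0.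
pose X' := X `&` [set x | 0 < total (u x)].
have X'X : X' `<=` X by move=> x [].
have cX' : cont_on X' (fun x => hat (u x) v).
  apply: cont_onM; first exact: cont_on_sub ct.
  apply: (ch.2 T X' (fun x g => u x g / total (u x))) => [g|x [Xx /= tx]].
    apply: cont_onM; first exact: cont_on_sub (cu g).
    by apply: cont_onV; [move=> x [_ /lt0r_neq0]|exact: cont_on_sub ct].
  have [s [Ps sx]] := us x Xx tx; exists s; split=> //.
  by apply: in_simplex_normalise => // g; exact: u0.
apply/cont_on_eps => x Xx e e0.
have [tx|] := ltP 0 (total (u x)).
  have := proj1 (cont_on_eps _ _) cX' x (conj Xx tx) e e0.
  have := cont_on_pos ct Xx tx; apply: filterS2 => y ty h' Xy.
  by apply: h'; split=> //; exact: ty.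
move=> tx; have {}tx : total (u x) = 0 by apply/eqP; rewrite eq_le tx t0.
have := proj1 (cont_on_eps _ _) ct x Xx e e0.
apply: filterS => y hy Xy; have := hy Xy.
rewrite tx sub0r normrN ger0_norm ?t0 // => ty.
rewrite {1}/hat tx mul0r sub0r normrN /hat.
have := t0 y Xy; rewrite le_eqVlt => /orP[/eqP <-|ty0]; first by rewrite mul0r normr0.
have [s [Ps sy]] := us y Xy ty0.
have /andP[h0 h1] := h01 v Ps (in_simplex_normalise (fun g => u0 y g Xy) sy ty0).
by rewrite ger0_norm ?mulr_ge0 // ?t0 // (le_lt_trans _ ty) // ler_piMr // t0.
Qed.

Lemma hat_eq0 y v : total y = 0 -> hat y v = 0.
Proof. by rewrite /hat => ->; rewrite mul0r. Qed.

End Homogeneous.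

Lemma total_gt0 (G : finType) (y : G -> RR) g :
  (forall g, 0 <= y g) -> 0 < y g -> 0 < total y.
Proof. by move=> y0 yg; rewrite /total (bigD1 g) //= ltr_pwDl ?sumr_ge0. Qed.

Lemma total_eq0 (G : finType) (y : G -> RR) g :
  (forall g, 0 <= y g) -> total y = 0 -> y g = 0.
Proof.
move=> y0 t0; apply/eqP; rewrite eq_le y0 andbT leNgt; apply/negP => yg.
by have := total_gt0 y0 yg; rewrite t0 ltxx.
Qed.

Lemma hat_simpl_map (G : finType) (V : choiceType) (k : G -> V) y v :
  (forall g, 0 <= y g) -> hat (simpl_map k) y v = simpl_map k y v.
Proof.
move=> y0; rewrite /hat /simpl_map mulr_sumr; apply: eq_bigr => g _.
have [t0|t0] := eqVneq (total y) 0; last by rewrite mulrCA divff ?mulr1.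
by rewrite t0 mul0r (total_eq0 _ y0).
Qed.

(** * Attaching cones over joins *)

Lemma min_lel (a b : RR) : Num.min a b <= a. Proof. by rewrite ge_min lexx. Qed.

Lemma min_ler (a b : RR) : Num.min a b <= b.
Proof. by rewrite ge_min lexx orbT. Qed.

Section ConeStep.
Variables (V : choiceType) (K : complex V) (pC pA : pred V) (m r : nat).
Hypothesis sK : simplicial K.
Hypothesis AC : forall v, pA v -> ~~ pC v.
Hypothesis C1 : forall s v w, K s -> v \in s -> w \in s -> pC v -> pC w -> v = w.

(** By [C1] a simplex has at most one vertex in [pC], and by [join] the link of such a vertex [v] is
    the join of [linkA v] and [linkB v]. So [K] is [old] with one cone attached for each [v]. *)
Definition old : complex V := fun s => K s /\ forall v, v \in s -> ~~ pC v.

Definition linkA (v : V) : complex V :=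
  fun s => [/\ s <> [::], forall w, w \in s -> pA w & K (v :: s)].

Definition linkB (v : V) : complex V :=
  fun s => [/\ s <> [::], forall w, w \in s -> ~~ pA w && ~~ pC w & K (v :: s)].

Hypothesis join : forall v s t, pC v -> s = [::] \/ linkA v s ->
  t = [::] \/ linkB v t -> K (v :: s ++ t).
Hypothesis rm : (r <= m)%N.
Hypothesis kA : forall v, pC v -> kconn (linkA v) (r%:Z - 2).
Hypothesis kB : forall v, pC v -> kconn (linkB v) ((m - r)%:Z - 2).

Lemma simplicial_old : simplicial old.
Proof.
split=> [s [Ks _]|s t [Ks nC] t0 ts]; first exact: sK.1 Ks.
by split=> [|v /ts]; [exact: (sK.2 s)|exact: nC].
Qed.

Lemma simplicial_linkA v : simplicial (linkA v).
Proof.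
split=> [s []//|s t [_ sA Ks] t0 ts]; split=> // [w /ts|]; first exact: sA.
apply: (sK.2 _ _ Ks) => // w; rewrite !inE => /orP[->//|/ts ->]; exact: orbT.
Qed.

Lemma simplicial_linkB v : simplicial (linkB v).
Proof.
split=> [s []//|s t [_ sA Ks] t0 ts]; split=> // [w /ts|]; first exact: sA.
apply: (sK.2 _ _ Ks) => // w; rewrite !inE => /orP[->//|/ts ->]; exact: orbT.
Qed.

(** * Nerve simplices and carriers for the two factors of the join *)

Section Nerve.
Variables (G : finType) (k : G -> V).
Implicit Types (s t rho : {set G}) (x y : G -> RR) (g : G).

Definition nerve s := [&& s != finset.set0, (#|s| <= m)%N & `[< K (img k s) >]].

Lemma nerve_sub s t : nerve s -> t \subset s -> t != finset.set0 -> nerve t.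
Proof.
move=> /and3P[s0 sm /asboolP Ks] ts t0; apply/and3P; split=> //.
  exact: leq_trans (subset_leq_card ts) sm.
apply/asboolP; apply: (sK.2 _ _ Ks).
  case/set0Pn: t0 => g gt e; have : k g \in img k t by apply/imgP; exists g.
  by rewrite e.
move=> v /imgP[g gt ->]; apply/imgP; exists g => //.
by have /fintype.subsetP := ts; exact.
Qed.

Lemma nerveK s : nerve s -> K (img k s).
Proof. by move=> /and3P[_ _ /asboolP]. Qed.

Definition gC : {set G} := finset (fun g => pC (k g)).
Definition gA : {set G} := finset (fun g => pA (k g)).
Definition gE : {set G} := gC :|: gA.

Lemma nerve_pC s g g' : nerve s -> g \in s -> g' \in s -> g \in gC -> g' \in gC ->
  k g = k g'.
Proof.
move=> /nerveK Ks gs gs'; rewrite !inE => gc gc'.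
by apply: (C1 Ks) => //; apply/imgP; [exists g|exists g'].
Qed.

Lemma gA_gC g : g \in gA -> g \notin gC.
Proof. by rewrite !inE; exact: AC. Qed.

Lemma gE_gC g : g \in gE -> g \notin gA -> g \in gC.
Proof. by rewrite finset.in_setU => /orP[//|->]. Qed.

Lemma nerve_linkA s t g : nerve s -> g \in s -> g \in gC -> t \subset s ->
  t \subset gA -> t != finset.set0 -> linkA (k g) (img k t).
Proof.
move=> Ns gs gc ts tA t0; split.
- exact: sK.1 (nerveK (nerve_sub Ns ts t0)).
- by move=> w /imgP[g' /(fintype.subsetP tA)]; rewrite inE => ? ->.
- apply: (sK.2 _ _ (nerveK Ns)) => // w; rewrite inE => /orP[/eqP ->|/imgP[g' gt ->]].
    by apply/imgP; exists g.
  by apply/imgP; exists g' => //; exact: (fintype.subsetP ts).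
Qed.

Lemma nerve_linkB s t g : nerve s -> g \in s -> g \in gC -> t \subset s ->
  (forall g', g' \in t -> g' \notin gE) -> t != finset.set0 ->
  linkB (k g) (img k t).
Proof.
move=> Ns gs gc ts tB t0; split.
- exact: sK.1 (nerveK (nerve_sub Ns ts t0)).
- by move=> w /imgP[g' /tB]; rewrite !inE negb_or andbC => ? ->.
- apply: (sK.2 _ _ (nerveK Ns)) => // w; rewrite inE => /orP[/eqP ->|/imgP[g' gt ->]].
    by apply/imgP; exists g.
  by apply/imgP; exists g' => //; exact: (fintype.subsetP ts).
Qed.

Definition QA t := nerve t && (t \subset gA).
(** Faces on which the A-side map is defined. Those inside [gA] keep their simplicial map; the
    others contain an index of [gC] and have at most [r] vertices, so they can be filled in an
    (r-2)-connected link. *)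
Definition PA t := [&& nerve t, t \subset gE & (t \subset gA) || (#|t| <= r)%N].
(** The indices of [gC] in a nerve simplex all have the same image, so any choice by [pick] gives
    the same link. The default [K] is not reached on faces in [PA] outside [QA]. *)
Definition carA t : complex V :=
  if [pick g in t :&: gC] is Some g then linkA (k g) else K.

Lemma carAE s t g : nerve s -> g \in s -> g \in t -> t \subset s -> g \in gC ->
  carA t = linkA (k g).
Proof.
move=> Ns gs gt ts gc; rewrite /carA; case: pickP => [g' /setIP[gt' gc']|/(_ g)].
  by congr linkA; apply: (nerve_pC Ns) => //; exact: (fintype.subsetP ts).
by rewrite inE gt gc.
Qed.

Lemma PA_pickC t : PA t -> ~~ QA t -> exists2 g, g \in t & g \in gC.
Proof.
move=> /and3P[Nt tE _]; rewrite /QA Nt /= => /fintype.subsetPn[g gt gA'].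
by exists g => //; apply: gE_gC => //; exact: (fintype.subsetP tE).
Qed.

Lemma exists_hA : exists h, [/\ tcont PA h,
    forall t y, QA t -> in_simplex t y -> h y = simpl_map k y &
    forall s y, PA s -> ~~ QA s -> in_simplex s y -> realization (carA s) (h y)].
Proof.
apply: (@carrier_extension _ _ PA carA QA (simpl_map k)).
- move=> s t /and3P[Ns sE sr] ts t0; apply/and3P; split.
  + exact: nerve_sub ts t0.
  + exact: fintype.subset_trans ts sE.
  + case/orP: sr => [sA|sr]; apply/orP; [left|right].
      exact: fintype.subset_trans ts sA.
    exact: leq_trans (subset_leq_card ts) sr.
- move=> s t /andP[Ns sA] ts t0; apply/andP; split; first exact: nerve_sub ts t0.
  exact: fintype.subset_trans ts sA.
- move=> s /andP[Ns sA]; rewrite /PA Ns sA /= andbT.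
  by apply: fintype.subset_trans sA (finset.subsetUr _ _).
- by move=> s /and3P[/and3P[]].
- move=> s Ps nQ; have [g gs gc] := PA_pickC Ps nQ.
  have /and3P[Ns sE sr] := Ps; rewrite (carAE Ns gs gs) //.
  have {}sr : (#|s| <= r)%N by case/orP: sr nQ => //; rewrite /QA Ns /= => ->.
  by apply: kconn_le (kA _); [lia|rewrite inE in gc].
- move=> s t Ps nQs nQt Pt ts; have [g gt gc] := PA_pickC Pt nQt.
  have /and3P[Ns _ _] := Ps; have gs := fintype.subsetP ts _ gt.
  by rewrite (carAE Ns gs gt) // (carAE Ns gs gs).
- move=> s t y Ps nQs /andP[Nt tA] ts ty; have [g gs gc] := PA_pickC Ps nQs.
  have /and3P[Ns _ _] := Ps; rewrite (carAE Ns gs gs) //.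
  apply: (simpl_map_real (s := t)) => //; first exact: simplicial_linkA.
  by apply: (nerve_linkA Ns) => //; case/and3P: Nt.
- exact: simpl_map_tcont.
Qed.

Notation GB := (G + {set G})%type.
Implicit Types (tau : {set GB}).
Definition beta tau : {set G} := finset (fun g => inl g \in tau).

(** A simplex of the B-side: vertices outside [gE] together with a chain of faces having more than
    [r] vertices, which stand for barycentres in the dual skeleton. Each face meets [gC] and spans a
    nerve simplex with [beta tau]; the common cone vertex determines the target link. *)
Definition PB' tau := [/\ tau != finset.set0,
  forall g, inl g \in tau -> g \notin gE,
  beta tau != finset.set0 -> nerve (beta tau),
  forall rho, inr rho \in tau -> [/\ rho \subset gE, (r < #|rho|)%N,
     rho :&: gC != finset.set0 & nerve (rho :|: beta tau)] &
  forall rho rho', inr rho \in tau -> inr rho' \in tau ->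
     (rho \subset rho') || (rho' \subset rho)].
Definition PB tau := `[< PB' tau >].
Definition QB tau := PB tau && [forall rho : {set G}, inr rho \notin tau].

Definition carB tau : complex V :=
  if [pick g in gC | [exists rho : {set G}, (inr rho \in tau) && (g \in rho)]] is Some g
  then linkB (k g) else K.

Lemma beta_sub tau tau' : tau \subset tau' -> beta tau \subset beta tau'.
Proof.
by move=> /fintype.subsetP tt; apply/fintype.subsetP => g; rewrite !inE; exact: tt.
Qed.

Lemma PB_sub tau tau' : PB tau -> tau' \subset tau -> tau' != finset.set0 -> PB tau'.
Proof.
move=> /asboolP[t0 tB tN tR tC] /[dup] sub' /fintype.subsetP sub t0'.
have bs := beta_sub sub'.
apply/asboolP; split=> //.
- by move=> g /sub; exact: tB.
- move=> b0; apply: (nerve_sub _ bs b0); apply: tN.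
  by apply: contra b0 => /eqP e; rewrite -finset.subset0 -e.
- move=> rho /sub /tR[rE rr rC Nr]; split=> //.
  apply: nerve_sub Nr _ _; first exact: finset.setUS.
  case/set0Pn: rC => g /setIP[gr _]; apply/set0Pn; exists g.
  by rewrite inE gr.
- by move=> rho rho' /sub ? /sub ?; exact: tC.
Qed.

Lemma PB_pickC tau : PB tau -> ~~ QB tau ->
  exists rho g, [/\ inr rho \in tau, g \in rho & g \in gC].
Proof.
move=> Pt; rewrite /QB Pt /= => /forallPn[rho]; rewrite negbK => rt.
have /asboolP[_ _ _ /(_ _ rt)[_ _ /set0Pn[g /setIP[gr gc]] _] _] := Pt.
by exists rho, g.
Qed.

Lemma carBE tau tau' rho g : PB tau -> tau' \subset tau -> inr rho \in tau' ->
  g \in rho -> g \in gC -> carB tau' = linkB (k g).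
Proof.
move=> /asboolP[_ _ _ tR tC] /fintype.subsetP sub rt gr gc.
rewrite /carB; case: pickP => [g' /andP[gc' /existsP[rho' /andP[rt' gr']]]|/(_ g)].
  congr linkB.
  have [_ _ _ N1] := tR _ (sub _ rt); have [_ _ _ N2] := tR _ (sub _ rt').
  case/orP: (tC _ _ (sub _ rt) (sub _ rt')) => /fintype.subsetP rr.
    by apply: (nerve_pC N2) => //; rewrite inE ?gr' // rr.
  by apply: (nerve_pC N1) => //; rewrite inE ?gr // rr.
rewrite gc /= => /existsP; case; exists rho; by rewrite rt gr.
Qed.

(* A chain of sets of cardinals in ]r, m - #|beta|] is this short. *)
Lemma PB_card tau : PB tau -> ~~ QB tau -> (#|tau| <= m - r)%N.
Proof.
move=> Pt nQ; have [rho0 [_ [rt0 _ _]]] := PB_pickC Pt nQ.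
have /asboolP[_ tB _ tR tC] := Pt.
pose R : {set {set G}} := finset (fun rho : {set G} => inr rho \in tau).
have R0 : rho0 \in R by rewrite inE.
have [rho Rr maxr] : exists2 rho, rho \in R & forall rho', rho' \in R -> (#|rho'| <= #|rho|)%N.
  by case: (arg_maxnP (P := fun rho => rho \in R) (fun rho => #|rho|) R0) => rho; exists rho.
have {}Rr : inr rho \in tau by rewrite inE in Rr.
have [rE rr _ Nr] := tR _ Rr.
have cbr : (#|beta tau| + #|rho| <= m)%N.
  have /and3P[_ le _] := Nr; apply: leq_trans le.
  rewrite cardsU (_ : rho :&: beta tau = finset.set0) ?cards0 ?subn0 1?addnC //.
  apply/setP => g; rewrite !inE; apply/negbTE/negP => /andP[gr /tB].
  by rewrite (fintype.subsetP rE).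
have cR : (#|R| <= #|rho| - r)%N.
  pose f (s : {set G}) := #|s|.
  rewrite cardE -(size_map f) -(size_iota r.+1 (#|rho| - r)).
  apply: uniq_leq_size; last first.
    move=> z /mapP[s]; rewrite mem_enum => sR ->; rewrite mem_iota.
    have {}sR' : inr s \in tau by rewrite inE in sR.
    have [_ sr _ _] := tR _ sR'; rewrite /f sr /= addSn subnKC ?(ltnW rr) //.
    exact: maxr.
  rewrite map_inj_in_uniq ?enum_uniq // => s s'; rewrite !mem_enum !inE => sR sR' e.
  have {}e : #|s| = #|s'| by [].
  apply/eqP; case/orP: (tC _ _ sR sR') => ss; first by rewrite finset.eqEcard ss e leqnn.
  by rewrite eq_sym finset.eqEcard ss e leqnn.
have -> : #|tau| = (#|beta tau| + #|R|)%N.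
  rewrite -(card_imset _ (@inl_inj G {set G})) -(card_imset _ (@inr_inj G {set G})).
  rewrite -cardsUI (_ : _ :&: _ = finset.set0) ?cards0 ?addn0; last first.
    apply/setP => z; rewrite !inE; apply/negbTE/negP => /andP[/imsetP[g _ ->] /imsetP[s _]//].
  congr #|pred_of_set _|; apply/setP => -[g|s]; rewrite !inE.
    rewrite (mem_imset _ _ (@inl_inj G {set G})) inE; case: (inl g \in tau) => //=.
    by apply/esym/negbTE/negP => /imsetP[].
  rewrite (mem_imset _ _ (@inr_inj G {set G})) inE orbC; case: (inr s \in tau) => //=.
  by apply/esym/negbTE/negP => /imsetP[].
lia.
Qed.

Definition simplB (z : GB -> RR) : V -> RR := simpl_map k (fun g => z (inl g)).

Lemma exists_hB : exists h, [/\ tcont PB h,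
    forall (t : {set GB}) z, QB t -> in_simplex t z -> h z = simplB z &
    forall (t : {set GB}) z, PB t -> ~~ QB t -> in_simplex t z ->
      realization (carB t) (h z)].
Proof.
apply: (@carrier_extension _ _ PB carB QB simplB).
- exact: PB_sub.
- move=> s t /andP[Ps /forallP sr] ts t0; apply/andP; split; first exact: PB_sub ts t0.
  by apply/forallP => rho; apply: contra (sr rho); exact: (fintype.subsetP ts).
- by move=> s /andP[].
- by move=> s /asboolP[].
- move=> s Ps nQ; have [rho [g [rs gr gc]]] := PB_pickC Ps nQ.
  rewrite (carBE Ps _ rs gr gc) //; apply: kconn_le (kB _); last by rewrite inE in gc.
  by have := PB_card Ps nQ; lia.
- move=> s t Ps nQs nQt Pt ts; have [rho [g [rt gr gc]]] := PB_pickC Pt nQt.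
  by rewrite (carBE Ps ts rt gr gc) (carBE Ps _ (fintype.subsetP ts _ rt) gr gc).
- move=> s t z Ps nQs /andP[Pt /forallP tR] ts tz.
  have [rho [g [rs gr gc]]] := PB_pickC Ps nQs.
  rewrite (carBE Ps _ rs gr gc) //.
  have bz : in_simplex (beta t) (fun g => z (inl g)).
    case: tz => z0 zt z1; split=> // [g'|]; first by rewrite inE; exact: zt.
    rewrite -z1 big_sumType /= [X in _ = _ + X]big1 ?addr0 // => rho' _.
    exact: zt.
  apply: (simpl_map_real (s := beta t)) => //; first exact: simplicial_linkB.
  have /asboolP[_ sB _ sR _] := Ps; have [_ _ _ Nr] := sR _ rs.
  apply: (nerve_linkB Nr) => //.
  + by rewrite inE gr.
  + by apply: fintype.subset_trans (beta_sub ts) (finset.subsetUr _ _).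
  + by move=> g'; rewrite inE => /(fintype.subsetP ts); exact: sB.
  + exact: in_simplex_neq0 bz.
- split; last by move=> T X u cu _ v; apply: cont_on_sum => g _; exact: cu.
  exists (codom k) => s z _ _ v vk; apply: big1 => g /eqP gv.
  by move: vk; rewrite -gv codom_f.
Qed.

(** * The homotopy that empties the cone vertices *)

Section Homotopy.
Variables (hA : (G -> RR) -> V -> RR) (hB : (GB -> RR) -> V -> RR).
Hypothesis chA : tcont PA hA.
Hypothesis hA_QA : forall t y, QA t -> in_simplex t y -> hA y = simpl_map k y.
Hypothesis hA_car : forall t y, PA t -> ~~ QA t -> in_simplex t y ->
  realization (carA t) (hA y).
Hypothesis chB : tcont PB hB.
Hypothesis hB_QB : forall (t : {set GB}) z, QB t -> in_simplex t z -> hB z = simplB z.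
Hypothesis hB_car : forall (t : {set GB}) z, PB t -> ~~ QB t -> in_simplex t z ->
  realization (carB t) (hB z).

Lemma hA_real s y : PA s -> in_simplex s y -> exists L, realization L (hA y).
Proof.
move=> Ps sy; have [Qs|nQs] := boolP (QA s); last by exists (carA s); exact: hA_car.
exists K; rewrite (hA_QA Qs) //; apply: (simpl_map_real (s := s)) => //.
by apply: nerveK; case/andP: Qs.
Qed.

Lemma hB_real (s : {set GB}) z : PB s -> in_simplex s z -> exists L, realization L (hB z).
Proof.
move=> Ps sz; have [Qs|nQs] := boolP (QB s); last by exists (carB s); exact: hB_car.
have [_ /forallP sR] := andP Qs.
have bz : in_simplex (beta s) (fun g => z (inl g)).
  case: sz => z0 zt z1; split=> // [g'|]; first by rewrite inE; exact: zt.
  rewrite -z1 big_sumType /= [X in _ = _ + X]big1 ?addr0 // => rho' _.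
  exact: zt.
exists K; rewrite (hB_QB Qs) //; apply: (simpl_map_real (s := beta s)) => //.
have /asboolP[_ _ bN _ _] := Ps.
by apply/nerveK/bN; exact: in_simplex_neq0 bz.
Qed.

(** The threshold is 0 at time 0; at time 1 it is the largest coordinate over [gC], above which no
    cone vertex keeps any mass. *)
Definition theta x (t : RR) : RR := t * \big[Num.max/0]_(g in gC) x g.
(** For 0 < s <= 1, a subset [rho] of [gE] is the superlevel set at height s exactly when
    [out rho x < s <= lev rho x]. *)
Definition lev rho x : RR := \big[Num.min/1]_(g in rho) x g.
Definition out rho x : RR := \big[Num.max/0]_(g in gE :\: rho) x g.
(** Height up to which the superlevel sets in [gE] have more than [r] elements: for coordinates in
    [0, 1], the (r+1)-st largest one, or 0 if there is none. *)
Definition cut x : RR :=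
  \big[Num.max/0]_(rho : {set G} | (rho \subset gE) && (r < #|rho|)%N) lev rho x.

(* Slice [0 < s] of the superlevel sets [x >= s] in [gE]: above [theta] they are
   kept as they are, below [theta] they become vertices of the barycentric
   subdivision; those of size at most [r] (the [s > cut]) are sent to the A-side,
   the larger ones to the B-side. *)
Definition wC x (t : RR) g : RR := if g \in gC then Num.max 0 (x g - theta x t) else 0.
Definition yA x (t : RR) g : RR :=
  (if g \in gA then Num.max 0 (x g - theta x t) else 0) +
  (if g \in gE then Num.max 0 (Num.min (x g) (theta x t) - cut x) else 0).
Definition zB x (t : RR) (z : GB) : RR :=
  match z with
  | inl g => if g \in gE then 0 else x g
  | inr rho => if (rho \subset gE) && (r < #|rho|)%N
               then Num.max 0 (Num.min (theta x t) (lev rho x) - out rho x) else 0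
  end.
(** Unnormalised join coordinates. The B-slices are not weighted by the sizes of their superlevel
    sets, so the total varies with [t]; it is divided out in [cone_homotopy]. *)
Definition U x (t : RR) v : RR :=
  simpl_map k (wC x t) v + hat hA (yA x t) v + hat hB (zB x t) v.

Lemma lev_le rho x g : g \in rho -> lev rho x <= x g.
Proof. by move=> gr; exact: bigmin_le_cond. Qed.

Lemma out_ge rho x g : g \in gE -> g \notin rho -> x g <= out rho x.
Proof. by move=> gE' gr; apply: le_bigmax_cond; rewrite finset.in_setD gr. Qed.

Lemma out_ge0 rho x : 0 <= out rho x.
Proof. exact: bigmax_ge_id. Qed.

Lemma cut_ge0 x : 0 <= cut x.
Proof. exact: bigmax_ge_id. Qed.

Lemma lev_cut rho x : rho \subset gE -> (r < #|rho|)%N -> lev rho x <= cut x.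
Proof. by move=> rE rr; apply: le_bigmax_cond; rewrite rE. Qed.

Lemma wC_ge0 x (t : RR) g : 0 <= wC x t g.
Proof. by rewrite /wC; case: ifP => // _; rewrite le_max lexx. Qed.

Lemma yA_ge0 x (t : RR) g : 0 <= yA x t g.
Proof. by apply: addr_ge0; case: ifP => // _; rewrite le_max lexx. Qed.

(** * Supports, carriers and positivity at a single point *)

Section Point.
Variables (x : G -> RR) (t : RR) (S : {set G}).
Hypothesis NS : nerve S.
Hypothesis xS : in_simplex S x.
Hypothesis Sx : forall g, (g \in S) = (0 < x g).
Hypothesis t01 : 0 <= t <= 1.

Let x0 g : 0 <= x g. Proof. by case: xS. Qed.

Lemma zB_ge0 z : 0 <= zB x t z.
Proof. by case: z => [g|rho] /=; case: ifP => // _; rewrite le_max lexx. Qed.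

Lemma theta_ge0 : 0 <= theta x t.
Proof.
by case/andP: t01 => t0 _; apply: mulr_ge0 => //; exact: bigmax_ge_id.
Qed.

Lemma theta_le : theta x t <= \big[Num.max/0]_(g in gC) x g.
Proof.
by case/andP: t01 => t0 t1; rewrite /theta ler_piMl //; exact: bigmax_ge_id.
Qed.

Definition suppA : {set G} := finset (fun g => 0 < yA x t g).
Definition suppB : {set GB} := finset (fun z => 0 < zB x t z).

Lemma suppA0 g : g \notin suppA -> yA x t g = 0.
Proof. by rewrite inE => h; apply/eqP; rewrite eq_le yA_ge0 leNgt h. Qed.

Lemma suppB0 z : z \notin suppB -> zB x t z = 0.
Proof. by rewrite inE => h; apply/eqP; rewrite eq_le zB_ge0 leNgt h. Qed.

Lemma suppA_E g : g \in suppA -> g \in gE /\ 0 < x g.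
Proof.
rewrite inE /yA => h; have := theta_ge0; have := cut_ge0 x => c0 th0.
move: h; case: (boolP (g \in gA)) => gA'.
  have gE' : g \in gE by rewrite finset.in_setU gA' orbT.
  rewrite gE' => h; split=> //; rewrite ltNge; apply/negP => xg.
  move: h; rewrite !max_l ?addr0 ?ltxx //; last by lra.
  by have : Num.min (x g) (theta x t) <= x g := min_lel _ _; lra.
rewrite add0r; case: ifP => gE'; last by rewrite ltxx.
rewrite lt_max ltxx /= subr_gt0 => h; split=> //.
by have : Num.min (x g) (theta x t) <= x g := min_lel _ _; lra.
Qed.

Lemma suppA_S : suppA \subset S.
Proof. by apply/fintype.subsetP => g /suppA_E[_]; rewrite Sx. Qed.

(** If an index outside [gA] survives, then [cut < theta] and every index of the support lies above
    [cut]; more than [r] of them would form a set of level above [cut], which is impossible. *)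
Lemma suppA_PA : 0 < total (yA x t) -> PA suppA.
Proof.
move=> ty; apply/and3P; split.
- apply: nerve_sub NS suppA_S _; apply/negP => /eqP e.
  move: ty; rewrite /total big1 ?ltxx // => g _.
  by apply: suppA0; rewrite e finset.in_set0.
- by apply/fintype.subsetP => g /suppA_E[].
have [//|/fintype.subsetPn[g gs gA']] := boolP (suppA \subset gA).
rewrite orFb leqNgt; apply/negP => big.
have /negP[] : ~~ (lev suppA x <= cut x); last first.
  by apply: lev_cut => //; apply/fintype.subsetP => g' /suppA_E[].
rewrite -ltNge.
have cth : cut x < theta x t.
  move: gs; rewrite inE /yA (negbTE gA') add0r; case: ifP => _; last by rewrite ltxx.
  rewrite lt_max ltxx /= subr_gt0 => h.
  by have : Num.min (x g) (theta x t) <= theta x t := min_ler _ _; lra.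
have xc g' : g' \in suppA -> cut x < x g'.
  rewrite inE /yA; have c0 := cut_ge0 x; case: (boolP (g' \in gA)) => gA''.
    rewrite finset.in_setU gA'' orbT => h; rewrite ltNge; apply/negP => xg.
    move: h; rewrite !max_l ?addr0 ?ltxx //; last by lra.
    by have : Num.min (x g') (theta x t) <= x g' := min_lel _ _; lra.
  rewrite add0r; case: ifP => gE'; last by rewrite ltxx.
  rewrite lt_max ltxx /= subr_gt0 => h.
  by have : Num.min (x g') (theta x t) <= x g' := min_lel _ _; lra.
have := bigmin_attained (fun g => g \in suppA) x 1; rewrite -/(lev suppA x).
case=> [->|[g' gs' ->]]; last exact: xc.
apply: lt_le_trans (xc g gs) _; case: xS => _ _ <-.
by rewrite (bigD1 g) //= lerDl sumr_ge0.
Qed.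

Lemma suppB_inr rho : inr rho \in suppB -> [/\ rho \subset gE, (r < #|rho|)%N,
  out rho x < theta x t & out rho x < lev rho x].
Proof.
rewrite inE /=; case: ifP => [/andP[-> ->]|]; last by rewrite ltxx.
by rewrite lt_max ltxx /= subr_gt0 lt_min => /andP[-> ->].
Qed.

Lemma beta_S : beta suppB \subset S.
Proof.
apply/fintype.subsetP => g; rewrite !inE /= Sx; case: ifP => // _.
by rewrite ltxx.
Qed.

(** A surviving [rho] meets [gC]: otherwise every coordinate over [gC] is at most [out rho x], which
    is less than [theta], while [theta] does not exceed their maximum. Comparability is the nesting
    of superlevel sets. *)
Lemma suppB_PB : 0 < total (zB x t) -> PB suppB.
Proof.
move=> tz; apply/asboolP; split.
- apply/negP => /eqP e; move: tz; rewrite /total big1 ?ltxx // => z _.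
  by apply: suppB0; rewrite e finset.in_set0.
- move=> g; rewrite finset.in_set /= => h; apply/negP => gE'.
  by move: h; rewrite gE' ltxx.
- by move=> b0; exact: nerve_sub beta_S b0.
- move=> rho /suppB_inr[rE rr oth olev].
  have rC : rho :&: gC != finset.set0.
    apply/negP => /eqP e.
    have h : \big[Num.max/0]_(g in gC) x g <= out rho x.
      apply/bigmax_leP; split=> [|g gc]; first exact: out_ge0.
      apply: out_ge; first by rewrite finset.in_setU gc.
      apply/negP => gr; have : g \in rho :&: gC by rewrite finset.in_setI gr.
      by rewrite e finset.in_set0.
    by have := lt_le_trans oth (le_trans theta_le h); rewrite ltxx.
  split=> //; apply: nerve_sub NS _ _.
    rewrite finset.subUset beta_S andbT; apply/fintype.subsetP => g gr.
    by rewrite Sx (lt_le_trans _ (lev_le x gr)) // (le_lt_trans (out_ge0 _ _) olev).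
  case/set0Pn: rC => g /setIP[gr _]; apply/set0Pn; exists g.
  by rewrite finset.in_setU gr.
- move=> rho rho' /suppB_inr[rE _ _ olev] /suppB_inr[rE' _ _ olev'].
  apply: contraT; rewrite negb_or => /andP[/fintype.subsetPn[g gr gr'] /fintype.subsetPn[g' g'r' g'r]].
  have := lev_le x gr; have := lev_le x g'r'.
  have := out_ge x (fintype.subsetP rE _ gr) gr'.
  have := out_ge x (fintype.subsetP rE' _ g'r') g'r.
  lra.
Qed.

Lemma suppA_norm : 0 < total (yA x t) ->
  in_simplex suppA (fun g => yA x t g / total (yA x t)).
Proof.
by move=> ty; apply: in_simplex_normalise => // g; [exact: yA_ge0|exact: suppA0].
Qed.

Lemma suppB_norm : 0 < total (zB x t) ->
  in_simplex suppB (fun z => zB x t z / total (zB x t)).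
Proof.
by move=> ty; apply: in_simplex_normalise => // g; [exact: zB_ge0|exact: suppB0].
Qed.

Lemma totalA_ge0 : 0 <= total (yA x t).
Proof. by apply: sumr_ge0 => g _; exact: yA_ge0. Qed.

Lemma totalB_ge0 : 0 <= total (zB x t).
Proof. by apply: sumr_ge0 => g _; exact: zB_ge0. Qed.

(** The A-part is supported in the link of the one cone vertex of the simplex carrying [x]; the
    empty list stands for a join factor without mass. *)
Lemma hatA_carrier g : g \in S -> g \in gC ->
  exists s : seq V, (s = [::] \/ linkA (k g) s) /\ forall v, v \notin s -> hat hA (yA x t) v = 0.
Proof.
move=> gS gc; have := totalA_ge0; rewrite le_eqVlt => /orP[/eqP e|ty].
  by exists [::]; split; [left|move=> v _; rewrite hat_eq0].
have Ps := suppA_PA ty; have sy := suppA_norm ty.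
have [Qs|nQs] := boolP (QA suppA).
  have /andP[Ns sA] := Qs; exists (img k suppA); split.
    right; apply: (nerve_linkA NS) => //; first exact: suppA_S.
    by case/and3P: Ns.
  move=> v vs; rewrite /hat (hA_QA Qs sy).
  by case: sy => _ sy _; rewrite (simpl_map_support sy vs) mulr0.
have := hA_car Ps nQs sy; have [g' gs' gc'] := PA_pickC Ps nQs.
have gS' := fintype.subsetP suppA_S _ gs'.
rewrite (carAE NS gS' gs' suppA_S gc') (nerve_pC NS gS' gS gc' gc).
move=> /realP[s [Ls _ s0 _ _]]; exists s; split; first by right.
by move=> v vs; rewrite /hat s0 // mulr0.
Qed.

Lemma hatB_carrier g : g \in S -> g \in gC ->
  exists s : seq V, (s = [::] \/ linkB (k g) s) /\ forall v, v \notin s -> hat hB (zB x t) v = 0.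
Proof.
move=> gS gc; have := totalB_ge0; rewrite le_eqVlt => /orP[/eqP e|tz].
  by exists [::]; split; [left|move=> v _; rewrite hat_eq0].
have Ps := suppB_PB tz; have sz := suppB_norm tz.
have [Qs|nQs] := boolP (QB suppB).
  have /asboolP[s0 sB bN _ _] := Ps; have /andP[_ /forallP sR] := Qs.
  have b0 : beta suppB != finset.set0.
    case/set0Pn: s0 => -[g'|rho] zs; last by have := sR rho; rewrite zs.
    by apply/set0Pn; exists g'; rewrite inE.
  exists (img k (beta suppB)); split.
    right; apply: (nerve_linkB NS) => //; first exact: beta_S.
    by move=> g'; rewrite inE; exact: sB.
  move=> v vs; rewrite /hat (hB_QB Qs sz) /simplB.
  rewrite (simpl_map_support (s := beta suppB)) ?mulr0 // => g'.
  by rewrite inE; case: sz => _ sz _; exact: sz.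
have := hB_car Ps nQs sz; have [rho [g' [rs gr' gc']]] := PB_pickC Ps nQs.
rewrite (carBE Ps _ rs gr' gc') //.
have gS' : g' \in S.
  have [_ _ _ olev] := suppB_inr rs.
  by rewrite Sx (lt_le_trans _ (lev_le x gr')) // (le_lt_trans (out_ge0 _ _) olev).
rewrite (nerve_pC NS gS' gS gc' gc).
move=> /realP[s [Ls _ s0' _ _]]; exists s; split; first by right.
by move=> v vs; rewrite /hat s0' // mulr0.
Qed.

Lemma U_ge0 v : 0 <= U x t v.
Proof.
apply: addr_ge0; first apply: addr_ge0.
- by apply: simpl_map_ge0; exact: wC_ge0.
- have := totalA_ge0; rewrite le_eqVlt => /orP[/eqP e|ty]; first by rewrite hat_eq0.
  have [L rL] := hA_real (suppA_PA ty) (suppA_norm ty).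
  by rewrite mulr_ge0 // ?(real_ge0 _ rL) // ltW.
- have := totalB_ge0; rewrite le_eqVlt => /orP[/eqP e|ty]; first by rewrite hat_eq0.
  have [L rL] := hB_real (suppB_PB ty) (suppB_norm ty).
  by rewrite mulr_ge0 // ?(real_ge0 _ rL) // ltW.
Qed.

Section Total.
Variables (F : seq V).
Hypothesis uF : uniq F.
Hypothesis kF : forall g, k g \in F.
Hypothesis AF : forall s y, PA s -> in_simplex s y -> forall v, v \notin F -> hA y v = 0.
Hypothesis BF : forall (s : {set GB}) z, PB s -> in_simplex s z ->
  forall v, v \notin F -> hB z v = 0.

Lemma U_support v : v \notin F -> U x t v = 0.
Proof.
move=> vF; rewrite /U.
have -> : simpl_map k (wC x t) v = 0.
  by apply: big1 => g /eqP e; move: vF; rewrite -e kF.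
rewrite add0r.
have -> : hat hA (yA x t) v = 0.
  have := totalA_ge0; rewrite le_eqVlt => /orP[/eqP e|ty]; first by rewrite hat_eq0.
  by rewrite /hat (AF (suppA_PA ty) (suppA_norm ty)) ?mulr0.
rewrite add0r.
have := totalB_ge0; rewrite le_eqVlt => /orP[/eqP e|ty]; first by rewrite hat_eq0.
by rewrite /hat (BF (suppB_PB ty) (suppB_norm ty)) ?mulr0.
Qed.

Lemma sum_U : \sum_(v <- F) U x t v = total (wC x t) + total (yA x t) + total (zB x t).
Proof.
rewrite !big_split /= simpl_map_total //; congr (_ + _ + _).
  have := totalA_ge0; rewrite le_eqVlt => /orP[/eqP e|ty].
    by rewrite -e big1 // => v _; rewrite hat_eq0.
  have [L rL] := hA_real (suppA_PA ty) (suppA_norm ty).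
  rewrite -mulr_sumr (real_sum rL uF) ?mulr1 //.
  exact: AF (suppA_PA ty) (suppA_norm ty).
have := totalB_ge0; rewrite le_eqVlt => /orP[/eqP e|ty].
  by rewrite -e big1 // => v _; rewrite hat_eq0.
have [L rL] := hB_real (suppB_PB ty) (suppB_norm ty).
rewrite -mulr_sumr (real_sum rL uF) ?mulr1 //.
exact: BF (suppB_PB ty) (suppB_norm ty).
Qed.

(** An index with positive coordinate always leaves mass: outside [gE] on the B-side, above [theta]
    in its own place, between [cut] and [theta] on the A-side. If it exceeds neither, the superlevel
    set at height [min(theta, cut)] has more than [r] elements and a slice of positive length. *)
Lemma sum_U_gt0 : 0 < \sum_(v <- F) U x t v.
Proof.
rewrite sum_U.
have w0 : 0 <= total (wC x t) by apply: sumr_ge0 => g _; exact: wC_ge0.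
have y0 := totalA_ge0; have z0 := totalB_ge0.
suff : (exists g, 0 < wC x t g) \/ (exists g, 0 < yA x t g) \/ exists z, 0 < zB x t z.
  case=> [[g /(total_gt0 (wC_ge0 x t))]|[[g /(total_gt0 (yA_ge0 x t))]|[z /(total_gt0 zB_ge0)]]];
  lra.
have /and3P[/set0Pn[g gS] _ _] := NS; have xg : 0 < x g by rewrite -Sx.
have [gE'|nE] := boolP (g \in gE); last first.
  by right; right; exists (inl g); rewrite /= (negbTE nE).
have [xth|thx] := leP (x g) (theta x t); last first.
  have [gA'|nA] := boolP (g \in gA).
    right; left; exists g; rewrite /yA gA' ltr_pwDl //.
      by rewrite lt_max subr_gt0 thx orbT.
    by case: ifP => // _; rewrite le_max lexx.
  left; exists g; rewrite /wC gE_gC //.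
  by rewrite lt_max subr_gt0 thx orbT.
have [cx|xc] := ltP (cut x) (x g).
  right; left; exists g; rewrite /yA gE' ltr_wpDl //.
    by case: ifP => // _; rewrite le_max lexx.
  by rewrite lt_max subr_gt0 (min_l xth) cx orbT.
right; right; pose e := Num.min (theta x t) (cut x).
have e0 : 0 < e by rewrite lt_min (lt_le_trans xg) // (lt_le_trans xg).
have [rho0 [rE0 rr0 lc]] : exists rho0 : {set G}, [/\ rho0 \subset gE, (r < #|rho0|)%N & lev rho0 x = cut x].
  have : cut x = 0 \/ exists2 rho0 : {set G}, (rho0 \subset gE) && (r < #|rho0|)%N & cut x = lev rho0 x.
    apply: (big_ind (fun z => z = 0 \/ exists2 rho0 : {set G},
       (rho0 \subset gE) && (r < #|rho0|)%N & z = lev rho0 x)).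
    - by left.
    - by move=> a b ha hb; rewrite maxEle; case: ifP.
    - by move=> rho hr; right; exists rho.
  case=> [c0|[rho0 /andP[? ?] ?]]; last by exists rho0.
  by move: (lt_le_trans xg xc); rewrite c0 ltxx.
pose rho : {set G} := finset (fun g => (g \in gE) && (e <= x g)).
have rE : rho \subset gE by apply/fintype.subsetP => g'; rewrite inE => /andP[].
have r0r : rho0 \subset rho.
  apply/fintype.subsetP => g' gr'; rewrite inE (fintype.subsetP rE0) //=.
  by rewrite (le_trans _ (lev_le x gr')) // lc ge_min lexx orbT.
exists (inr rho) => /=; rewrite rE (leq_trans rr0 (subset_leq_card r0r)) /=.
rewrite lt_max; apply/orP; right; rewrite subr_gt0.
have oe : out rho x < e.
  apply: bigmax_lt => // g'; rewrite finset.in_setD finset.in_set => /andP[+ gE''].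
  by rewrite gE'' /= -ltNge.
apply: (lt_le_trans oe); rewrite le_min ge_min lexx /=.
apply/bigmin_geP; split; last by move=> g'; rewrite inE => /andP[].
rewrite ge_min; apply/orP; right; rewrite -lc.
have [g' gr'] : exists g', g' \in rho0 by apply/set0Pn; rewrite -card_gt0 (leq_ltn_trans _ rr0).
apply: le_trans (lev_le x gr') _; case: xS => _ _ <-.
by rewrite (bigD1 g') //= lerDl sumr_ge0.
Qed.

End Total.

(** At threshold 0 all slices are empty, and [hA] and [hB] are evaluated only where they agree with
    the simplicial map, so the three parts add up to it. *)
Lemma U_theta0 : theta x t = 0 -> U x t = simpl_map k x.
Proof.
move=> th0; apply/funext => v.
have yE g : yA x t g = if g \in gA then x g else 0.
  rewrite /yA th0 subr0 (max_r (x0 g)) (min_r (x0 g)) sub0r.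
  by rewrite (max_l (_ : - cut x <= 0)) ?oppr_le0 ?cut_ge0 // if_same addr0.
have zE rho : zB x t (inr rho) = 0.
  rewrite /= th0 max_l ?if_same // subr_le0 (le_trans _ (out_ge0 _ _)) //.
  by rewrite ge_min lexx.
have -> : U x t v = simpl_map k (wC x t) v + simpl_map k (yA x t) v + simplB (zB x t) v.
  congr (_ + _ + _).
    rewrite -(hat_simpl_map _ _ (yA_ge0 x t)).
    have := totalA_ge0; rewrite le_eqVlt => /orP[/eqP e|ty]; first by rewrite !hat_eq0.
    rewrite /hat (hA_QA _ (suppA_norm ty)) // /QA.
    have /and3P[-> _ _] := suppA_PA ty; apply/fintype.subsetP => g.
    by rewrite inE yE; case: ifP => //; rewrite ltxx.
  have := totalB_ge0; rewrite le_eqVlt => /orP[/eqP e|ty].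
    rewrite hat_eq0 // /simplB /simpl_map big1 // => g _.
    exact: (total_eq0 _ zB_ge0).
  rewrite /hat (hB_QB _ (suppB_norm ty)) /simplB.
    by rewrite /simpl_map mulr_sumr; apply: eq_bigr => g _; rewrite mulrCA divff ?mulr1 ?gt_eqF.
  rewrite /QB (suppB_PB ty) /=; apply/forallP => rho; rewrite finset.in_set.
  by rewrite zE ltxx.
rewrite /simplB /simpl_map -!big_split /=; apply: eq_bigr => g _.
rewrite yE /wC th0 subr0 (max_r (x0 g)).
have [gA'|nA] := boolP (g \in gA).
  by rewrite finset.in_setU gA' orbT (negbTE (gA_gC gA')) add0r addr0.
rewrite addr0; have [gE'|nE] := boolP (g \in gE); first by rewrite gE_gC // addr0.
by move: nE; rewrite finset.in_setU negb_or => /andP[/negbTE -> _]; rewrite add0r.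
Qed.

Lemma theta_noC : (forall g, g \in S -> g \notin gC) -> theta x t = 0.
Proof.
move=> nC; rewrite /theta (_ : \big[_/_]_(g in gC) x g = 0) ?mulr0 //.
apply/eqP; rewrite eq_le bigmax_ge_id andbT; apply/bigmax_leP; split=> // g gc.
by rewrite leNgt; apply/negP; rewrite -Sx => /nC; rewrite gc.
Qed.

(** The supports of the three parts lie over the same cone vertex and form a simplex by [join].
    Without a cone vertex the threshold is 0 and nothing has moved. *)
Lemma U_carrier : exists s : seq V, (s = [::] \/ K s) /\ forall v, v \notin s -> U x t v = 0.
Proof.
have [[g [gS gc]]|no] := pselect (exists g, g \in S /\ g \in gC); last first.
  exists (img k S); split; first by right; exact: nerveK.
  rewrite U_theta0; first by case: xS => _ xS' _ v; exact: simpl_map_support.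
  by apply: theta_noC => g gS; apply/negP => gc; apply: no; exists g.
have [sA [LA sA0]] := hatA_carrier gS gc; have [sB [LB sB0]] := hatB_carrier gS gc.
exists (k g :: sA ++ sB); split; first by right; apply: join => //; rewrite inE in gc.
move=> v; rewrite inE mem_cat !negb_or => /and3P[vg /sA0 e1 /sB0 e2].
rewrite /U e1 e2 !addr0; apply: big1 => g' /eqP e; rewrite /wC; case: ifP => // gc'.
apply: max_l; have := theta_ge0; rewrite subr_le0; apply: le_trans.
rewrite leNgt; apply/negP; rewrite -Sx => gS'.
by move: vg; rewrite -e (nerve_pC NS gS' gS) // eqxx.
Qed.

(** The threshold has reached every coordinate over [gC], so the cone vertex drops out and a simplex
    of the base of the cone remains. *)
Lemma U_carrier1 : t = 1 ->
  exists s : seq V, (s = [::] \/ old s) /\ forall v, v \notin s -> U x t v = 0.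
Proof.
move=> t1; have [[g [gS gc]]|no] := pselect (exists g, g \in S /\ g \in gC); last first.
  exists (img k S); split.
    right; split; first exact: nerveK.
    by move=> v /imgP[g gS ->]; apply/negP => gc; apply: no; exists g; rewrite !inE.
  rewrite U_theta0; first by case: xS => _ xS' _ v; exact: simpl_map_support.
  by apply: theta_noC => g gS; apply/negP => gc; apply: no; exists g.
have [sA [LA sA0]] := hatA_carrier gS gc; have [sB [LB sB0]] := hatB_carrier gS gc.
have pg : pC (k g) by rewrite inE in gc.
exists (sA ++ sB); split.
  case E : (sA ++ sB) => [|v0 l]; [by left|right; rewrite -E]; split.
    apply: (sK.2 _ _ (join pg LA LB)); first by rewrite E.
    by move=> v; rewrite inE orbC => ->.
  move=> v; rewrite mem_cat => /orP[vA|vB].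
    by case: LA vA => [->//|[_ sA' _]] /sA'; exact: AC.
  by case: LB vB => [->//|[_ sB' _]] /sB' /andP[].
move=> v; rewrite mem_cat negb_or => /andP[/sA0 e1 /sB0 e2].
rewrite /U e1 e2 !addr0; apply: big1 => g' _; rewrite /wC; case: ifP => // gc'.
by apply: max_l; rewrite subr_le0 /theta t1 mul1r; exact: le_bigmax_cond.
Qed.

End Point.
Lemma nerve_support s x : nerve s -> in_simplex s x -> exists S,
  [/\ nerve S, in_simplex S x & forall g, (g \in S) = (0 < x g)].
Proof.
move=> Ns [x0 xs x1]; exists (finset (fun g => 0 < x g)).
have iS : in_simplex (finset (fun g => 0 < x g)) x.
  by split=> // g; rewrite inE => h; apply/eqP; rewrite eq_le x0 leNgt h.
split=> // [|g]; last by rewrite inE.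
apply: nerve_sub Ns _ (in_simplex_neq0 iS).
apply/fintype.subsetP => g; rewrite inE; apply: contraLR => /xs ->.
by rewrite ltxx.
Qed.

Section Family.
Variables (T : topologicalType) (X : set T) (u : T -> G -> RR) (tau : T -> RR).
Hypothesis cu : forall g, cont_on X (u^~ g).
Hypothesis ctau : cont_on X tau.
Hypothesis uN : forall p, X p -> exists s, nerve s /\ in_simplex s (u p).
Hypothesis tau01 : forall p, X p -> 0 <= tau p <= 1.

Lemma U_cont_on v : cont_on X (fun p => U (u p) (tau p) v).
Proof.
have cth : cont_on X (fun p => theta (u p) (tau p)).
  by apply: cont_onM => //; exact: cont_on_bigmax.
have clev rho : cont_on X (fun p => lev rho (u p)) by exact: cont_on_bigmin.
have cout rho : cont_on X (fun p => out rho (u p)) by exact: cont_on_bigmax.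
have ccut : cont_on X (fun p => cut (u p)) by exact: cont_on_bigmax.
have c0 : cont_on X (fun=> 0) by exact: cont_on_cst.
have spt p : X p -> exists S,
    [/\ nerve S, in_simplex S (u p) & forall g, (g \in S) = (0 < u p g)].
  by move=> /uN[s [Ns su]]; exact: nerve_support su.
apply: cont_onD; first apply: cont_onD.
- apply: cont_on_sum => g _; rewrite /wC; case: (g \in gC) => //.
  by apply: cont_on_max => //; exact: cont_onB.
- apply: (hat_cont_on (P := PA) chA).
  + move=> s y w Ps sy; have [L rL] := hA_real Ps sy.
    by rewrite (real_ge0 w rL) (real_le1 w rL).
  + move=> g; apply: cont_onD; first (case: (g \in gA) => //).
      by apply: cont_on_max => //; exact: cont_onB.
    case: (g \in gE) => //; apply: cont_on_max => //; apply: cont_onB => //.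
    exact: cont_on_min.
  + by move=> p g _; exact: yA_ge0.
  + move=> p Xp ty; have [S [NS uS Su]] := spt p Xp.
    exists (suppA (u p) (tau p)); split; last by move=> g; exact: suppA0.
    exact: (suppA_PA NS uS Su (tau01 Xp)).
- apply: (hat_cont_on (P := PB) chB).
  + move=> s y w Ps sy; have [L rL] := hB_real Ps sy.
    by rewrite (real_ge0 w rL) (real_le1 w rL).
  + case=> [g|rho] /=; first by case: (g \in gE).
    case: (_ && _) => //; apply: cont_on_max => //; apply: cont_onB => //.
    exact: cont_on_min.
  + by move=> p g Xp; have [S [NS uS Su]] := spt p Xp; exact: (zB_ge0 _ uS).
  + move=> p Xp ty; have [S [NS uS Su]] := spt p Xp.
    exists (suppB (u p) (tau p)); split; last by move=> z; exact: (suppB0 uS).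
    exact: (suppB_PB NS uS Su (tau01 Xp)).
Qed.

End Family.

Lemma cone_homotopy : exists H : (G -> RR) -> RR -> V -> RR,
  [/\ forall s x, nerve s -> in_simplex s x -> H x 0 = simpl_map k x,
   forall s x, nerve s -> in_simplex s x -> realization old (H x 1) &
   forall (T : topologicalType) (X : set T) (u : T -> G -> RR) (tau : T -> RR),
     (forall g, cont_on X (u^~ g)) -> cont_on X tau ->
     (forall p, X p -> exists s, nerve s /\ in_simplex s (u p)) ->
     (forall p, X p -> 0 <= tau p <= 1) ->
     cont_map X K (fun p => H (u p) (tau p))].
Proof.
have [FA hFA] := chA.1; have [FB hFB] := chB.1.
pose F := undup (codom k ++ FA ++ FB).
have uF : uniq F by exact: undup_uniq.
have kF g : k g \in F by rewrite mem_undup mem_cat codom_f.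
have AF s y : PA s -> in_simplex s y -> forall v, v \notin F -> hA y v = 0.
  move=> Ps sy v; rewrite mem_undup !mem_cat !negb_or => /and3P[_ vA _].
  exact: (hFA s).
have BF (s : {set GB}) z : PB s -> in_simplex s z -> forall v, v \notin F -> hB z v = 0.
  move=> Ps sy v; rewrite mem_undup !mem_cat !negb_or => /and3P[_ _ vB].
  exact: (hFB s).
have z01 : 0 <= (0 : RR) <= 1 by rewrite lexx ler01.
have o01 : 0 <= (1 : RR) <= 1 by rewrite lexx ler01.
exists (fun x c v => U x c v / \sum_(v <- F) U x c v); split.
- move=> s x Ns sx; have [S [NS xS Sx]] := nerve_support Ns sx.
  rewrite (U_theta0 NS xS Sx z01) ?/theta ?mul0r // simpl_map_total //.
  by apply/funext => v; case: xS => _ _ ->; rewrite divr1.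
- move=> s x Ns sx; have [S [NS xS Sx]] := nerve_support Ns sx.
  have [l [Kl l0]] := U_carrier1 NS xS Sx o01 erefl.
  apply: (normalised_real simplicial_old Kl l0) => //.
  + by move=> v; exact: (U_ge0 NS xS Sx o01).
  + by move=> v; exact: (U_support NS xS Sx o01).
  + exact: (sum_U_gt0 NS xS Sx o01).
- move=> T X u tau cu ctau uN tau01.
  have spt p : X p -> exists S,
      [/\ nerve S, in_simplex S (u p) & forall g, (g \in S) = (0 < u p g)].
    by move=> /uN[s [Ns su]]; exact: nerve_support su.
  split; [|split].
  + exists F => p Xp v vF; have [S [NS uS Su]] := spt p Xp.
    by rewrite (U_support NS uS Su (tau01 p Xp) kF AF BF vF) mul0r.
  + move=> p Xp; have [S [NS uS Su]] := spt p Xp; have t01 := tau01 p Xp.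
    have [l [Kl l0]] := U_carrier NS uS Su t01.
    apply: (normalised_real sK Kl l0) => //.
    * by move=> v; exact: (U_ge0 NS uS Su t01).
    * by move=> v; exact: (U_support NS uS Su t01).
    * exact: (sum_U_gt0 NS uS Su t01).
  + move=> v; apply: cont_onM; first exact: U_cont_on.
    apply: cont_onV; last by apply: cont_on_sum => w _; exact: U_cont_on.
    move=> p Xp; have [S [NS uS Su]] := spt p Xp.
    exact/lt0r_neq0/(sum_U_gt0 NS uS Su (tau01 p Xp)).
Qed.

End Homotopy.
End Nerve.

(** [homotopy_extension] is applied twice, in reverse order: the filling in [old] is carried back
    along the cone homotopy, then along the segments to [f]. *)
Lemma kconn_cone : kconn old (m%:Z - 2) -> kconn K (m%:Z - 2).
Proof.
move=> [ne ext]; split=> [/ne[a oa]|j jm f cf].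
  by exists a; apply: real_sub oa => s [].
have S0 : (@sphere j) !=set0.
  exists (delta_mx ord0 ord0); rewrite /sphere /= (bigD1 ord0) //= big1 ?addr0.
    by rewrite mxE !eqxx expr1n.
  by move=> i i0; rewrite mxE (negbTE i0) andbF expr0n.
have [G [w [k [cwg w0 w1 wc wf]]]] := approximation (@sphere_compact j)
  (fun x i sx => disk_coord i (sphere_disk sx)) S0 cf.
have wN x : sphere x -> exists s, nerve k s /\ in_simplex s (fun g => w g x).
  move=> sx; pose s : {set G} := finset (fun g => 0 < w g x).
  have iw : in_simplex s (fun g => w g x).
    split=> [g|g|]; [exact: w0| |exact: w1].
    by rewrite inE => h; apply/eqP; rewrite eq_le w0 // leNgt h.
  exists s; split=> //; apply/and3P; split.
  - exact: in_simplex_neq0 iw.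
  (* At most [j + 2] weights are positive at a point, and [j <= m - 2]. *)
  - rewrite cardsE; apply: leq_trans (wc x sx) _.
    by move: jm; lia.
  - have [l [Kl _ lE _ _]] := real_support sK (cf.2.1 x sx).
    apply/asboolP; apply: (sK.2 _ _ Kl).
      have /set0Pn[g gs] := in_simplex_neq0 iw.
      by move=> e; have : k g \in img k s by [apply/imgP; exists g]; rewrite e.
    by move=> v /imgP[g gs ->]; rewrite lE; apply: wf => //; rewrite inE in gs.
have [hA [chA hA1 hA2]] := exists_hA k; have [hB [chB hB1 hB2]] := exists_hB k.
have [H [H0 H1 cH]] := cone_homotopy chA hA1 hA2 chB hB1 hB2.
pose u0 (x : 'rV[RR]_j.+1) := fun g => w g x.
have cu0 g : cont_on (@sphere j) (u0^~ g) by exact: cwg.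
have c1 : cont_map (@sphere j) old (fun x => H (u0 x) 1).
  apply: (@cont_map_into _ _ (@sphere j) K) => [x sx|].
    by have [s [Ns sw]] := wN x sx; exact: H1 Ns sw.
  apply: (cH _ _ u0 (fun=> 1)) => // [|x _]; first exact: cont_on_cst.
  by rewrite lexx ler01.
have [g1 [cg1 g1E]] := ext j jm _ c1.
have [g2 [cg2 g2E]] : exists g2, cont_map (@disk j) K g2 /\
    forall x, sphere x -> g2 x = simpl_map k (u0 x).
  apply: (@homotopy_extension _ K j _ (fun x t => H (u0 x) t) g1).
  - apply: (cH _ _ (fun p => u0 p.1) (fun p => p.2)).
    + by move=> g; apply: (@cont_on_fst _ _ (@sphere j) _ (u0^~ g)) => // p [].
    + exact: cont_on_snd.
    + by move=> p [sp _]; exact: wN.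
    + by move=> p [].
  - by move=> x sx; have [s [Ns sw]] := wN x sx; exact: H0 Ns sw.
  - by move=> x sx; rewrite g1E.
  - by apply: cont_map_sub_complex cg1 => s [].
apply: (@homotopy_extension _ K j f
  (fun x t v => (1 - t) * f x v + t * simpl_map k (u0 x) v) g2) => //.
- apply: (@cont_map_segment _ _ (@sphere j) K f (fun x => simpl_map k (u0 x))) => //.
    apply: (@cont_map_eq _ _ (@sphere j) K (fun x => H (u0 x) 0)) => [x sx|].
      by have [s [Ns sw]] := wN x sx; exact: H0 Ns sw.
    apply: (cH _ _ u0 (fun=> 0)) => // [|x _]; first exact: cont_on_cst.
    by rewrite lexx ler01.
  move=> x v sx h; have [g [/eqP <- wg]] : exists g, k g == v /\ 0 < w g x.
    apply: contrapT => no; move: h; rewrite /simpl_map big1 ?ltxx // => g kg.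
    apply/eqP; rewrite eq_le w0 // andbT leNgt; apply/negP => wg.
    by apply: no; exists g.
  exact: wf.
- by move=> x sx; apply/funext => v; rewrite subr0 mul1r mul0r addr0.
- by move=> x sx; apply/funext => v; rewrite subrr mul0r add0r mul1r g2E.
Qed.

End ConeStep.

(** * Skeleta, retracts and superlevel sets *)

Section Skeleton.
Variables (V : choiceType) (K : complex V) (m : nat).
Hypothesis sK : simplicial K.

Definition skel : complex V := fun s => K s /\ (size (undup s) <= m)%N.

Lemma simplicial_skel : simplicial skel.
Proof.
split=> [s [Ks _]|s t [Ks sm] t0 ts]; first exact: sK.1 Ks.
split; first exact: (sK.2 s).
apply: leq_trans sm; apply: uniq_leq_size; first exact: undup_uniq.
by move=> v; rewrite !mem_undup; exact: ts.
Qed.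

(** The filling found in [K] is replaced by its nerve approximation, whose simplices have at most
    [j + 2 <= m] vertices. On the sphere the carriers of [f] lie in the skeleton, hence so do the
    segments from [f] to the approximation. *)
Lemma kconn_skel : kconn K (m%:Z - 2) -> kconn skel (m%:Z - 2).
Proof.
move=> [ne ext]; split=> [m1|j jm f cf].
  have [a /(real_support sK)[s [Ks us sE a0 a1]]] := ne m1.
  case: s Ks us sE a1 => [/sK.1//|v s] Ks _ _ _.
  have Kv : skel [:: v].
    split; last by rewrite /=; lia.
    by apply: (sK.2 _ _ Ks) => // w; rewrite !inE => ->.
  exists (fun w => if w == v then 1 else 0); apply: (real_intro (F := [:: v]) simplicial_skel Kv) => //.
  - by move=> w; rewrite inE => /negbTE ->.
  - by move=> w; case: ifP; rewrite ?ler01 ?lexx.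
  - by move=> w; rewrite inE => /negbTE ->.
  - by rewrite big_seq1 eqxx.
have [g [cg gE]] : exists g, cont_map (@disk j) K g /\ forall x, sphere x -> g x = f x.
  by apply: ext => //; apply: cont_map_sub_complex cf => s [].
have D0 : (@disk j) !=set0.
  by exists 0; rewrite /disk /= big1 ?ler01 // => i _; rewrite mxE expr0n.
have [G [w [k [cwg w0 w1 wc wf]]]] := approximation (@disk_compact j)
  (fun x i dx => disk_coord i dx) D0 cg.
pose h x v := simpl_map k (fun g => w g x) v.
have hS x : disk x -> exists s, skel (img k s) /\ in_simplex s (fun g => w g x).
  move=> dx; pose s : {set G} := finset (fun g => 0 < w g x).
  have iw : in_simplex s (fun g => w g x).
    split=> [g'|g'|]; [exact: w0| |exact: w1].
    by rewrite inE => h'; apply/eqP; rewrite eq_le w0 // leNgt h'.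
  exists s; split=> //; split.
    have [l [Kl _ lE _ _]] := real_support sK (cg.2.1 x dx).
    apply: (sK.2 _ _ Kl).
      have /set0Pn[g' gs] := in_simplex_neq0 iw.
      by move=> e; have : k g' \in img k s by [apply/imgP; exists g']; rewrite e.
    by move=> v /imgP[g' gs ->]; rewrite lE; apply: wf => //; rewrite inE in gs.
  apply: leq_trans (size_undup _) _; rewrite size_map -cardE cardsE.
  by apply: leq_trans (wc x dx) _; move: jm; lia.
have ch : cont_map (@disk j) skel h.
  split; [|split].
  - exists (codom k) => x _ v vk; apply: big1 => g' /eqP gv.
    by move: vk; rewrite -gv codom_f.
  - move=> x dx; have [s [Ks sw]] := hS x dx.
    exact: simpl_map_real simplicial_skel Ks sw.
  - by move=> v; apply: cont_on_sum => g' _; exact: cwg.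
apply: (@homotopy_extension _ skel j f
  (fun x t v => (1 - t) * f x v + t * h x v) h) => //.
- apply: (@cont_map_segment _ _ (@sphere j) skel f h) => //; first exact: simplicial_skel.
    exact: cont_map_sub (@sphere_disk j) ch.
  move=> x v sx h0; have dx := sphere_disk sx.
  have [g' [/eqP <- wg]] : exists g, k g == v /\ 0 < w g x.
    apply: contrapT => no; move: h0; rewrite /h /simpl_map big1 ?ltxx // => g' kg.
    apply/eqP; rewrite eq_le w0 // andbT leNgt; apply/negP => wg.
    by apply: no; exists g'.
  by rewrite -gE //; exact: wf.
- by move=> x sx; apply/funext => v; rewrite subr0 mul1r mul0r addr0.
- by move=> x sx; apply/funext => v; rewrite subrr mul0r add0r mul1r.
Qed.

End Skeleton.

Section PushForward.
Variables (V W : choiceType).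

Definition push (p : V -> W) (F : seq V) (a : V -> RR) (w : W) : RR :=
  \sum_(v <- F | p v == w) a v.

Lemma push_support p F a w : w \notin map p F -> push p F a w = 0.
Proof.
move=> wF; rewrite /push big_seq_cond big1 // => v /andP[vF /eqP e].
by move: wF; rewrite -e map_f.
Qed.

Lemma cont_map_push (K : complex V) (L : complex W) p (F : seq V)
    (T : topologicalType) (X : set T) f : simplicial K -> simplicial L ->
  (forall s, K s -> L (map p s)) -> uniq F ->
  (forall x v, X x -> v \notin F -> f x v = 0) ->
  cont_map X K f -> cont_map X L (fun x => push p F (f x)).
Proof.
move=> sK sL pKL uF fF [_ [fK fc]]; split; [|split].
- by exists (map p F) => x _ w; exact: push_support.
- move=> x Xx; have [s [Ks us sE a0 a1]] := real_support sK (fK x Xx).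
  apply: (real_intro (F := undup (map p F)) sL (pKL _ Ks)).
  + move=> w ws; rewrite /push big1 // => v /eqP e; apply/eqP.
    rewrite eq_le a0 andbT leNgt -sE; apply: contra ws => vs.
    by rewrite -e map_f.
  + by move=> w; apply: sumr_ge0 => v _; exact: a0.
  + exact: undup_uniq.
  + by move=> w; rewrite mem_undup; exact: push_support.
  + rewrite /push (exchange_big_dep predT) //= -(real_sum (fK x Xx) uF); last first.
      by move=> v; exact: fF.
    apply: eq_big_seq => v vF; rewrite -big_filter.
    rewrite (_ : [seq _ <- _ | _] = [:: p v]) ?big_seq1 //.
    apply: perm_small_eq => //; apply: uniq_perm => [||w];
      rewrite ?filter_uniq ?undup_uniq // mem_filter mem_undup mem_seq1.
    apply/andP/eqP => [[/eqP <-]//|->]; split; first exact/eqP.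
    exact: map_f.
- by move=> w; apply: cont_on_sum => v _; exact: fc.
Qed.

End PushForward.

(** A sphere in [L] is sent to [K], filled there and brought back; the composite on [L] being the
    identity, the boundary is unchanged. The isomorphisms of links below are used in this form. *)
Lemma kconn_retract (V W : choiceType) (K : complex V) (L : complex W)
    (i : V -> W) (p : W -> V) n : simplicial K -> simplicial L ->
  (forall s, K s -> L (map i s)) -> (forall s, L s -> K (map p s)) ->
  (forall s w, L s -> w \in s -> i (p w) = w) ->
  kconn K n -> kconn L n.
Proof.
move=> sK sL iKL pLK ipK [ne ext]; split=> [n1|j jn f cf].
  have [a /realP[s [Ks us sa a0 a1]]] := ne n1.
  pose c := fun _ : 'rV[RR]_1 => a.
  have cc : cont_map setT K c.
    split; first by exists s.
    by split=> [x _|v]; [apply/realP; exists s|exact: cont_on_cst].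
  have := cont_map_push (F := s) sK sL iKL us (fun _ v _ => sa v) cc.
  by move=> [_ [h _]]; exists (push i s a); exact: (h 0).
have [F0 hF0] := cf.1; pose F := undup F0.
have fF x v : sphere x -> v \notin F -> f x v = 0.
  by rewrite mem_undup => sx; exact: hF0.
have uF : uniq F by exact: undup_uniq.
have [g [cg gE]] := ext j jn _ (cont_map_push sL sK pLK uF fF cf).
have [E0 hE0] := cg.1; pose E := undup (E0 ++ map p F).
have gEE x v : disk x -> v \notin E -> g x v = 0.
  by rewrite mem_undup mem_cat negb_or => dx /andP[+ _]; exact: hE0.
have uE : uniq E by exact: undup_uniq.
exists (fun x => push i E (g x)); split; first exact: cont_map_push cg.
move=> x sx; apply/funext => w; rewrite gE // /push.
rewrite (exchange_big_dep predT) //=.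
have [s [Ls us sE a0 a1]] := real_support sL (cf.2.1 x sx).
transitivity (\sum_(w' <- F | w' == w) f x w').
  rewrite [RHS]big_mkcond /=; apply: eq_big_seq => w' w'F.
  have [fw|fw] := eqVneq (f x w') 0.
    by rewrite fw big1 ?if_same.
  have ipw : i (p w') = w'.
    by apply: ipK Ls _; rewrite sE lt_def fw a0.
  rewrite -big_filter (_ : [seq _ <- _ | _] = if w' == w then [:: p w'] else [::]).
    by case: ifP; rewrite ?big_seq1 ?big_nil.
  apply: perm_small_eq; first by case: ifP.
  apply: uniq_perm; rewrite ?filter_uniq //; first by case: ifP.
  move=> v; rewrite mem_filter; have [<-|nv] := eqVneq (p w') v.
    rewrite ipw andbT; have [e|//] := eqVneq w' w; rewrite inE eqxx.
    by rewrite mem_undup mem_cat map_f ?orbT.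
  case: ifP => // _; rewrite ?andbF //; apply/esym/negbTE; rewrite mem_seq1.
  by apply: contra nv => /eqP ->.
have [wF|wF] := boolP (w \in F).
  rewrite (big_rem w) //= eqxx big_seq_cond big1 ?addr0 // => w' /andP[].
  by rewrite (mem_rem_uniq _ uF) inE => /andP[/negbTE ->].
rewrite fF // big_seq_cond big1 // => w' /andP[w'F /eqP e].
by move: wF; rewrite -e w'F.
Qed.

Section LayerCake.
Variables (U W : choiceType) (K : complex (U + W)%type) (L : complex W).
Variable sp : seq U -> W.
Hypotheses (sK : simplicial K) (sL : simplicial L).
Hypothesis KL : forall s (R : seq (seq U)) (ws : seq W), K s ->
  (forall rho, rho \in R -> rho <> [::] /\ forall u, u \in rho -> inl u \in s) ->
  (forall rho rho', rho \in R -> rho' \in R ->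
     {subset rho <= rho'} \/ {subset rho' <= rho}) ->
  (forall w, w \in ws -> inr w \in s) -> map sp R ++ ws <> [::] ->
  L (map sp R ++ ws).

(* The part of a point lying on the U-side is spread over its superlevel sets,
   each of which is then sent to a single vertex by [sp]. *)
Lemma layer_cake (T : topologicalType) (X : set T) f : cont_map X K f ->
  exists g, cont_map X L g /\
    forall x, X x -> (forall u, f x (inl u) = 0) -> g x = fun w => f x (inr w).
Proof.
move=> [[F fF] [fK fc]].
pose isl (z : (U + W)%type) := if z is inl u then Some u else None.
pose isr (z : (U + W)%type) := if z is inr u then Some u else None.
pose FU := pmap isl F; pose FW := pmap isr F.
have inFU u : inl u \in F -> u \in FU by rewrite mem_pmap => h; apply/mapP; exists (inl u).
have inFW w : inr w \in F -> w \in FW by rewrite mem_pmap => h; apply/mapP; exists (inr w).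
pose G : finType := seq_sub FU.
pose lo (rho : {set G}) (a : U + W -> RR) := \big[Num.min/1]_(g in rho) a (inl (val g)).
pose ou (rho : {set G}) (a : U + W -> RR) := \big[Num.max/0]_(g in ~: rho) a (inl (val g)).
(* Length of the range of heights at which [rho] is the superlevel set. *)
pose la (rho : {set G}) (a : U + W -> RR) := Num.max 0 (lo rho a - ou rho a).
pose sq (rho : {set G}) : seq U := [seq val g | g <- enum rho].
pose r (a : U + W -> RR) (w : W) := a (inr w) +
  \sum_(rho : {set G} | (rho != finset.set0) && (sp (sq rho) == w)) la rho a.
pose H := undup (FW ++ [seq sp (sq rho) | rho <- enum {: {set G}}]).
have uH : uniq H by exact: undup_uniq.
have lo_le (rho : {set G}) a (g : G) : g \in rho -> lo rho a <= a (inl (val g)).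
  by move=> gr; exact: bigmin_le_cond.
have ou_ge (rho : {set G}) a (g : G) : g \notin rho -> a (inl (val g)) <= ou rho a.
  move=> gr; apply: le_bigmax_cond.
  by rewrite finset.in_setC.
have ou0 rho a : 0 <= ou rho a by exact: bigmax_ge_id.
have la0 rho a : 0 <= la rho a by rewrite le_max lexx.
have laP rho a : 0 < la rho a -> ou rho a < lo rho a.
  by rewrite lt_max ltxx /= subr_gt0.
have r0 x w : X x -> 0 <= r (f x) w.
  by move=> Xx; rewrite addr_ge0 ?(real_ge0 _ (fK _ Xx)) ?sumr_ge0.
have rH x w : X x -> w \notin H -> r (f x) w = 0.
  move=> Xx; rewrite mem_undup mem_cat negb_or => /andP[wF wS].
  rewrite /r fF ?add0r //; last by apply: contra wF; exact: inFW.
  apply: big1 => rho /andP[_ /eqP e]; case/negP: wS; apply/mapP.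
  by exists rho; rewrite ?mem_enum.
have xU x u : X x -> 0 < f x (inl u) -> exists g : G, val g = u.
  move=> Xx fu; have uF : u \in FU.
    by apply: inFU; apply: contraTT fu => h; rewrite fF // ltxx.
  by exists (SeqSub uF).
have rpos x : X x -> 0 < \sum_(w <- H) r (f x) w.
  move=> Xx; have [s [Ks us sE a0 a1]] := real_support sK (fK x Xx).
  suff [w rw] : exists w, 0 < r (f x) w.
    have wH : w \in H by apply: contraTT rw => h; rewrite rH // ltxx.
    by rewrite (big_rem w) //= ltr_pwDl // sumr_ge0 // => w' _; exact: r0.
  have [[w fw]|no] := pselect (exists w, 0 < f x (inr w)).
    by exists w; rewrite /r ltr_pwDl // sumr_ge0.
  have [u fu] : exists u, 0 < f x (inl u).
    case: s us sE Ks {a1} => [_ _ /sK.1//|[u|w] s _ sE _].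
      by exists u; rewrite -sE mem_head.
    by case: no; exists w; rewrite -sE mem_head.
  (* The indices of maximal coordinate form the topmost superlevel set, whose slice has positive
     length. *)
  pose M := \big[Num.max/0]_(g : G) f x (inl (val g)).
  have Mge (g : G) : f x (inl (val g)) <= M.
    exact: le_bigmax_cond.
  have [g0 g0u] := xU x u Xx fu.
  have M0 : 0 < M by apply: lt_le_trans (Mge g0); rewrite g0u.
  pose rho : {set G} := finset (fun g : G => M <= f x (inl (val g))).
  have ll : M <= lo rho (f x).
    apply/bigmin_geP; split; last by move=> g; rewrite finset.in_set.
    by apply/bigmax_leP; split=> [|g _]; [exact: ler01|exact: real_le1 (fK _ Xx)].
  have lo' : ou rho (f x) < M.
    by apply: bigmax_lt => // g; rewrite finset.in_setC finset.in_set -ltNge.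
  have rn : rho != finset.set0.
    apply/negP => /eqP e; have : M <= 0; last by rewrite leNgt M0.
    have := ou_ge rho (f x); rewrite e => h.
    suff : M < M by rewrite ltxx.
    apply: bigmax_lt => // g _; rewrite ltNge; apply/negP => hg.
    have : g \in rho by rewrite finset.in_set.
    by rewrite e finset.in_set0.
  exists (sp (sq rho)); rewrite /r ltr_wpDl ?a0 // (bigD1 rho) /=; last first.
    by rewrite rn eqxx.
  rewrite ltr_pwDl ?sumr_ge0 // lt_max subr_gt0; apply/orP; right.
  exact: lt_le_trans lo' ll.
exists (fun x w => r (f x) w / \sum_(w <- H) r (f x) w); split; last first.
  move=> x Xx f0; apply/funext => w.
  have la_0 (rho : {set G}) : rho != finset.set0 -> la rho (f x) = 0.
    case/set0Pn => g gr; apply: max_l; rewrite subr_le0 (le_trans (lo_le _ _ _ gr)) //.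
    by rewrite f0.
  have rE w' : r (f x) w' = f x (inr w').
    by rewrite /r big1 ?addr0 // => rho /andP[/la_0].
  rewrite rE (eq_bigr _ (fun w' _ => rE w')).
  have <- : \sum_(z <- map inr H) f x z = \sum_(w' <- H) f x (inr w') by rewrite big_map.
  rewrite (real_sum (fK x Xx)) ?divr1 //.
    by rewrite map_inj_uniq //; exact: inr_inj.
  case=> [u _|w' h]; first exact: f0.
  rewrite -rE rH //; apply: contra h => h; exact: map_f.
split; [|split].
- by exists H => x Xx w wH; rewrite rH // mul0r.
- move=> x Xx; have [s [Ks us sE a0 a1]] := real_support sK (fK x Xx).
  pose R := [seq sq rho | rho <- enum {: {set G}} &
               (rho != finset.set0) && (0 < la rho (f x))].
  pose ws := pmap isr s.
  have wsP w : w \in ws -> inr w \in s.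
    by rewrite mem_pmap => /mapP[[|w'] // ws' [->]].
  have RP rho : rho \in R -> exists2 rho' : {set G}, rho = sq rho' &
      rho' != finset.set0 /\ ou rho' (f x) < lo rho' (f x).
    move=> /mapP[rho']; rewrite mem_filter => /andP[/andP[r0' lr] _] ->.
    by exists rho' => //; split=> //; exact: laP.
  apply: (@normalised_real _ L (map sp R ++ ws)) => //.
  + case E : (map sp R ++ ws) => [|w0 l]; [by left|right; rewrite -E].
    apply: (KL Ks) => //; last by rewrite E.
      move=> _ /RP[rho -> [r0' lr]]; split.
        case/set0Pn: r0' => g gr e.
        have : val g \in sq rho by apply: map_f; rewrite mem_enum.
        by rewrite e.
      move=> u /mapP[g]; rewrite mem_enum => gr ->; rewrite sE.
      by apply: lt_le_trans (lo_le _ _ _ gr); exact: le_lt_trans lr.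
    move=> _ _ /RP[rho -> [_ lr]] /RP[rho' -> [_ lr']].
    have sqS (p q : {set G}) : p \subset q -> {subset sq p <= sq q}.
      move=> /fintype.subsetP pq u /mapP[g]; rewrite mem_enum => gp ->.
      by apply: map_f; rewrite mem_enum; exact: pq.
    have : (rho \subset rho') || (rho' \subset rho).
      apply: contraT; rewrite negb_or => /andP[/fintype.subsetPn[g gr gr'] /fintype.subsetPn[g' g'r' g'r]].
      have := lo_le _ (f x) _ gr; have := lo_le _ (f x) _ g'r'.
      have := ou_ge _ (f x) _ gr'; have := ou_ge _ (f x) _ g'r.
      lra.
    by case/orP => /sqS; [left|right].
  + move=> w; rewrite mem_cat negb_or => /andP[wR wws].
    have fw : f x (inr w) = 0.
      apply/eqP; rewrite eq_le a0 andbT leNgt -sE; apply: contra wws => ws'.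
      by rewrite mem_pmap; apply/mapP; exists (inr w).
    rewrite /r fw add0r big1 // => rho /andP[rn /eqP e].
    apply/eqP; rewrite eq_le la0 andbT leNgt; apply: contra wR => lr.
    rewrite -e; apply: map_f; apply/mapP; exists rho => //.
    by rewrite mem_filter rn lr mem_enum.
  + by move=> w; exact: r0.
  + by move=> w; exact: rH.
  + exact: rpos.
- have cr w : cont_on X (fun x => r (f x) w).
    apply: cont_onD => //; apply: cont_on_sum => rho _; apply: cont_on_max; first exact: cont_on_cst.
    by apply: cont_onB; [apply: cont_on_bigmin|apply: cont_on_bigmax].
  move=> w; apply: cont_onM => //; apply: cont_onV; last exact: cont_on_sum.
  by move=> x /rpos/lt0r_neq0.
Qed.

End LayerCake.

(** * Bases and unimodular rows *)

Section UnimodularRows.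
Variable A : comNzRingType.

Definition invertible n (B : 'M[A]_n) :=
  exists C, B *m C = 1%:M /\ C *m B = 1%:M.

Lemma invertible_right n (B C : 'M[A]_n) : B *m C = 1%:M -> invertible B.
Proof. by move=> BC; exists C; split=> //; exact: mulmx1C. Qed.

Lemma invertible_mul n (B C : 'M[A]_n) :
  invertible B -> invertible C -> invertible (B *m C).
Proof.
move=> [B' [BB _]] [C' [CC _]]; apply: (@invertible_right _ _ (C' *m B')).
by rewrite mulmxA -(mulmxA B) CC mulmx1.
Qed.

(** Expansion along the last row: its cofactors do not involve that row, which may be set to 0 in
    them. *)
Lemma det_col_mx d (M : 'M[A]_(d, d + 1)) (u : 'rV[A]_(d + 1)) :
  \det (col_mx M u) =
  \sum_j u ord0 j * cofactor (col_mx M 0) (rshift d ord0) j.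
Proof.
rewrite (expand_det_row _ (rshift d ord0)); apply: eq_bigr => j _.
rewrite col_mxEd; congr (_ * _); rewrite /cofactor; congr (_ * \det _).
apply/matrixP => a b; rewrite !mxE; case: splitP => //= k.
by move=> /eqP; rewrite ord1 /bump /= addn0 leqNgt; have := ltn_ord a; lia.
Qed.

Lemma det_row_mx d (N : 'M[A]_(d + 1, d)) (q : 'cV[A]_(d + 1)) :
  \det (row_mx N q) =
  \sum_j cofactor (col_mx N^T 0) (rshift d ord0) j * q j ord0.
Proof.
rewrite -det_tr tr_row_mx det_col_mx; apply: eq_bigr => j _.
by rewrite mulrC mxE.
Qed.

(* With the cofactor vectors [p] of M and [u] of N, the determinants of the two
   bordered matrices multiply to [v (1 - N M) q] for all borders [v] and [q], so
   [p u = 1 - N M]; taking traces gives [u p = 1]. *)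
Lemma unimodular_completion d (M : 'M[A]_(d, d + 1)) (N : 'M[A]_(d + 1, d)) :
  M *m N = 1%:M -> exists u, invertible (col_mx M u).
Proof.
move=> MN.
pose p : 'cV[A]_(d + 1) := \col_j cofactor (col_mx M 0) (rshift d ord0) j.
pose u : 'rV[A]_(d + 1) := \row_j cofactor (col_mx N^T 0) (rshift d ord0) j.
have detM v : \det (col_mx M v) = (v *m p) ord0 ord0.
  by rewrite det_col_mx mxE; apply: eq_bigr => j _; rewrite !mxE.
have detN q : \det (row_mx N q) = (u *m q) ord0 ord0.
  by rewrite det_row_mx mxE; apply: eq_bigr => j _; rewrite !mxE.
have prod (v : 'rV_(d + 1)) (q : 'cV_(d + 1)) :
    (v *m p) ord0 ord0 * (u *m q) ord0 ord0 = (v *m (1%:M - N *m M) *m q) ord0 ord0.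
  (* The product of the bordered matrices has upper left block 1; clearing below it leaves a Schur
     complement of size 1. *)
  rewrite -detM -detN -det_mulmx mul_col_row MN.
  have -> : block_mx 1%:M (M *m q) (v *m N) (v *m q) =
            block_mx 1%:M 0 (v *m N) 1%:M *m
            block_mx 1%:M (M *m q) 0 (v *m q - v *m N *m (M *m q)).
    by rewrite mulmx_block !mul1mx !mul0mx !mulmx1 !addr0 addrC subrK.
  rewrite det_mulmx det_lblock det_ublock !det1 !mul1r det_mx11.
  by rewrite mulmxBr mulmx1 mulmxBl !mulmxA.
have pu : p *m u = 1%:M - N *m M.
  apply/matrixP => i j.
  have := prod (delta_mx 0 i) (delta_mx j 0).
  have e (Q : 'M[A]_(d + 1)) : ((delta_mx 0 i : 'rV_(d + 1)) *m Q *m (delta_mx j 0 : 'cV_(d + 1))) ord0 ord0 = Q i j.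
    by rewrite -rowE -colE !mxE.
  rewrite e => <-; rewrite -rowE -colE mxE big_ord1; congr (_ * _); by rewrite !mxE.
have up : (u *m p) ord0 ord0 = 1.
  have <- : \tr (u *m p) = (u *m p) ord0 ord0 by rewrite /mxtrace big_ord1.
  rewrite mxtrace_mulC pu raddfB /= mxtrace_mulC MN !mxtrace1 natrD.
  by rewrite addrC addKr.
exists u; apply: (@invertible_right _ _ (\adj (col_mx M u))).
by rewrite mul_mx_adj detM up.
Qed.

End UnimodularRows.

Section Bases.
Variable A : comNzRingType.

Lemma sum_rows n r (b : 'I_r -> 'rV[A]_n) (c : 'rV[A]_r) :
  c *m \matrix_i b i = \sum_i c ord0 i *: b i.
Proof. by rewrite mulmx_sum_row; apply: eq_bigr => i _; rewrite rowK. Qed.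

Lemma basis_ofP n r (V : set 'rV[A]_n) (b : 'I_r -> 'rV[A]_n) :
  basis_of V b <-> (forall c : 'rV[A]_r, c *m \matrix_i b i = 0 -> c = 0) /\
    (forall x, V x <-> exists c : 'rV[A]_r, x = c *m \matrix_i b i).
Proof.
split=> [[li ->]|[li Vb]].
  split=> [c|x]; first by rewrite sum_rows => /li h; apply/rowP => i; rewrite h mxE.
  split=> -[c ->]; last by exists (fun i => c ord0 i); rewrite sum_rows.
  by exists (\row_i c i); rewrite sum_rows; apply: eq_bigr => i _; rewrite mxE.
split=> [c|].
  move=> h i; have := li (\row_i c i); rewrite sum_rows.
  under eq_bigr do rewrite mxE.
  by move=> /(_ h)/rowP/(_ i); rewrite !mxE.
apply/seteqP; split=> x.
  by move=> /Vb[c ->]; exists (fun i => c ord0 i); rewrite sum_rows.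
move=> [c ->]; apply/Vb; exists (\row_i c i); rewrite sum_rows.
by apply: eq_bigr => i _; rewrite mxE.
Qed.

Lemma coords_in_basis n r e (V : set 'rV[A]_n) (b : 'I_r -> 'rV[A]_n) (M : 'M[A]_(e, n)) :
  basis_of V b -> (forall i, V (row i M)) -> exists N, M = N *m \matrix_i b i.
Proof.
move=> /basis_ofP[_ Vb] VM.
have h i : exists c : 'rV[A]_r, row i M = c *m \matrix_i b i by apply/Vb.
have [c hc] := choice h; exists (\matrix_i c i).
by apply/row_matrixP => i; rewrite row_mul rowK.
Qed.

Lemma basis_of_row n r (V : set 'rV[A]_n) (b : 'I_r -> 'rV[A]_n) i :
  basis_of V b -> V (b i).
Proof.
by move=> /basis_ofP[_ Vb]; apply/Vb; exists (delta_mx 0 i); rewrite -rowE rowK.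
Qed.

(** [M] expresses [v] in the basis [w], and [N] holds the coordinates in [v] of the projections of
    the [w j] to [V] along a complement [Z]. The rows of [M N - 1] give combinations of [v] lying in
    both [V] and [Z]. *)
Lemma summand_factor n d e (V W : set 'rV[A]_n) (v : 'I_d -> 'rV[A]_n)
    (w : 'I_e -> 'rV[A]_n) :
  V `<=` W -> direct_summand V -> basis_of V v -> basis_of W w ->
  exists M N, \matrix_i v i = M *m (\matrix_i w i : 'M[A]_(e, n)) /\ M *m N = 1%:M.
Proof.
move=> VW [sV [Z [sZ [VZ VZT]]]] bv bw.
have [M vM] : exists M, \matrix_i v i = M *m \matrix_i w i.
  apply: (coords_in_basis bw) => i; rewrite rowK; apply: VW.
  exact: (basis_of_row _ bv).
have h j : exists y, V y /\ Z (w j - y).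
  have [y [z [Vy [Zz e']]]] := VZT (w j); exists y; split=> //.
  by rewrite e' addrC addKr.
have [y hy] := choice h.
have [N yN] : exists N, \matrix_j y j = N *m \matrix_i v i.
  by apply: (coords_in_basis bv) => j; rewrite rowK; case: (hy j).
exists M, N; split=> //; apply/eqP; rewrite -subr_eq0; apply/eqP/row_matrixP => i.
rewrite row0; have /basis_ofP[li Vv] := bv; apply: li.
have sumZ (c : 'rV[A]_e) : Z (c *m \matrix_j (w j - y j)).
  case: sZ => Z0 [Zp Zs]; rewrite sum_rows.
  by elim/big_ind: _ => // j _; apply: Zs; case: (hy j).
have Vx : V (row i (M *m N - 1%:M) *m \matrix_i v i) by apply/Vv; exists (row i (M *m N - 1%:M)).
have Zx : Z (row i (M *m N - 1%:M) *m \matrix_i v i).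
  rewrite -row_mul mulmxBl mul1mx -mulmxA -yN vM -mulmxBr row_mul.
  have -> : \matrix_i y i - \matrix_i w i = -1 *: \matrix_j (w j - y j).
    by apply/matrixP => a b; rewrite !mxE mulN1r opprB.
  by rewrite -scalemxAr scaleN1r; case: sZ => _ [_ Zs]; rewrite -scaleN1r; exact: Zs.
have : (V `&` Z) (row i (M *m N - 1%:M) *m \matrix_i v i) by split.
by rewrite VZ.
Qed.

(** [M N = 1] forces [d <= e] over a commutative ring; for [d = e] also [N M = 1], so the spans
    agree. *)
Lemma summand_rank_le n d e (V W : set 'rV[A]_n) (v : 'I_d -> 'rV[A]_n)
    (w : 'I_e -> 'rV[A]_n) :
  V `<=` W -> direct_summand V -> basis_of V v -> basis_of W w ->
  (d <= e)%N /\ (d = e -> V = W).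
Proof.
move=> VW sV bv bw; have [M [N [vM MN]]] := summand_factor VW sV bv bw.
split; first exact: mulmx1_min MN.
move=> de; subst e; apply/seteqP; split=> // x.
move=> /(proj2 (proj1 (basis_ofP _ _) bw))[c ->].
apply/(proj2 (proj1 (basis_ofP _ _) bv)); exists (c *m N).
by rewrite vM mulmxA -(mulmxA c) (mulmx1C MN) mulmx1.
Qed.

Lemma free_rank_uniq n (V : set 'rV[A]_n) r r' :
  free_of_rank V r -> free_of_rank V r' -> r = r'.
Proof.
suff le r1 r2 : free_of_rank V r1 -> free_of_rank V r2 -> (r1 <= r2)%N.
  by move=> h h'; apply/eqP; rewrite eqn_leq !le.
move=> [b bb] [c bc].
have [P bP] : exists P, \matrix_i b i = P *m \matrix_i c i.
  by apply: (coords_in_basis bc) => i; rewrite rowK; exact: (basis_of_row _ bb).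
have [Q cQ] : exists P, \matrix_i c i = P *m \matrix_i b i.
  by apply: (coords_in_basis bb) => i; rewrite rowK; exact: (basis_of_row _ bc).
apply: (@mulmx1_min _ _ _ P Q); apply/eqP; rewrite -subr_eq0; apply/eqP/row_matrixP => i.
rewrite row0; have /basis_ofP[li _] := bb; apply: li.
by rewrite -row_mul mulmxBl mul1mx -mulmxA -cQ -bP subrr row0.
Qed.

Lemma is_basisP n (b : 'I_n -> 'rV[A]_n) : is_basis b <-> invertible (\matrix_i b i).
Proof.
split=> [bb|[C [BC CB]]].
  have [N e] : exists N, 1%:M = N *m \matrix_i b i by exact: (coords_in_basis bb).
  by apply: (@invertible_right _ _ _ N); apply: mulmx1C.
apply/basis_ofP; split=> [c h|x].
  by rewrite -[c]mulmx1 -BC mulmxA h mul0mx.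
by split=> // _; exists (x *m C); rewrite -mulmxA CB mulmx1.
Qed.

(** The missing vector is the row supplied by [unimodular_completion]. The family is indexed by
    [nat] so that the step can be iterated without casts. *)
Lemma extend_basis n d (V W : set 'rV[A]_n) (v : 'I_d -> 'rV[A]_n) :
  V `<=` W -> direct_summand V -> basis_of V v -> free_of_rank W d.+1 ->
  exists x, forall b : nat -> 'rV[A]_n, (forall k : 'I_d, b k = v k) -> b d = x ->
    basis_of W (fun k : 'I_d.+1 => b k).
Proof.
move=> VW sV bv; rewrite -(addn1 d) => -[w bw].
have [M [N [vM MN]]] := summand_factor VW sV bv bw.
have [u [C [uC Cu]]] := unimodular_completion MN.
exists (u *m \matrix_i w i) => b bk bd.
have be : \matrix_(k < d + 1) b k = col_mx M u *m \matrix_i w i.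
  rewrite mul_col_mx -vM; apply/row_matrixP => k; rewrite rowK.
  case: (split_ordP k) => k' ->; first by rewrite rowKu rowK /= bk.
  by rewrite rowKd ord1 row_id /= addn0.
have /basis_ofP[li Ww] := bw; apply/basis_ofP; rewrite be; split=> [c|x].
  by rewrite mulmxA => /li h; rewrite -[c]mulmx1 -uC mulmxA h mul0mx.
split=> [/Ww[c ->]|[c ->]].
  by exists (c *m C); rewrite mulmxA -(mulmxA c) Cu mulmx1.
by apply/Ww; exists (c *m col_mx M u); rewrite mulmxA.
Qed.

Lemma adapted_basis n (Fs : nat -> set 'rV[A]_n) N :
  (forall d, (d <= N)%N -> free_of_rank (Fs d) d) ->
  (forall d, (d < N)%N -> Fs d `<=` Fs d.+1 /\ direct_summand (Fs d)) ->
  exists b : nat -> 'rV[A]_n, forall d, (d <= N)%N ->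
    basis_of (Fs d) (fun k : 'I_d => b k).
Proof.
elim: N => [|N IH] fr inc.
  have [b bb] := fr 0%N (leqnn _); exists (fun=> 0) => d; rewrite leqn0 => /eqP ->.
  by rewrite (_ : (fun k : 'I_0 => 0) = b) //; apply/funext => -[].
have [d dN|d dN|b hb] := IH; [by apply: fr; lia|by apply: inc; lia|].
have [FN sN] := inc N (leqnn _).
have [x hx] := extend_basis FN sN (hb N (leqnn _)) (fr N.+1 (leqnn _)).
exists (fun k => if k == N then x else b k) => d; rewrite leq_eqVlt => /orP[/eqP ->|dN].
  apply: (hx (fun k => if k == N then x else b k)); last by rewrite eqxx.
  by move=> k; rewrite ltn_eqF.
have := hb d dN; congr basis_of; apply/funext => k.
by rewrite ltn_eqF // (leq_trans (ltn_ord k)).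
Qed.

End Bases.

(** * Flags adapted to a basis *)

Section CoordinateSubmodules.
Variables (A : comNzRingType) (n : nat).
Implicit Types (B : 'M[A]_n) (I J : pred 'I_n) (d : nat).

Definition coord_sub B I : set 'rV[A]_n :=
  [set x | exists c : 'rV[A]_n, (forall i, ~~ I i -> c ord0 i = 0) /\ x = c *m B].

Definition initial_sub B d := coord_sub B (fun i => (i < d)%N).

Lemma card_initial d : (d <= n)%N -> #|[pred i : 'I_n | (i < d)%N]| = d.
Proof.
move=> dn; rewrite -sum1_card; under eq_bigl do rewrite inE.
by rewrite (big_ord_narrow dn) sum1_card card_ord.
Qed.

Lemma coord_sub_basis B I : invertible B ->
  basis_of (coord_sub B I) (fun k : 'I_#|I| => row (enum_val k) B).
Proof.
move=> [C [BC _]]; pose e : 'M[A]_(#|I|, n) := \matrix_k delta_mx 0 (enum_val k).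
have eE (c : 'rV[A]_#|I|) i : (c *m e) ord0 i = \sum_k c ord0 k * (i == enum_val k)%:R.
  by rewrite mxE; apply: eq_bigr => k _; rewrite !mxE eqxx.
apply/basis_ofP.
have -> : \matrix_k row (enum_val k) B = e *m B.
  by apply/row_matrixP => k; rewrite row_mul !rowK -rowE.
split=> [c|x].
  move=> h; have {}h : c *m e = 0 by rewrite -[c *m e]mulmx1 -BC mulmxA -(mulmxA c) h mul0mx.
  apply/rowP => k; have := eE c (enum_val k); rewrite h !mxE (bigD1 k) //= eqxx mulr1.
  rewrite big1 ?addr0 // => k' kk; rewrite (inj_eq enum_val_inj) eq_sym.
  by rewrite (negbTE kk) mulr0.
split=> [[c [cI ->]]|[c ->]].
  exists (\row_k c ord0 (enum_val k)); rewrite mulmxA; congr (_ *m _).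
  apply/rowP => i; rewrite eE.
  under eq_bigr do rewrite mxE.
  rewrite -(big_enum_val (A := I) (fun i' => c ord0 i' * (i == i')%:R)) /=.
  have [iI|iI] := boolP (I i).
    rewrite (bigD1 i) //= eqxx mulr1 big1 ?addr0 // => i' /andP[_ ii].
    by rewrite eq_sym (negbTE ii) mulr0.
  rewrite big1 ?cI // => i' Ii; have [e'|] := eqVneq i i'; last by rewrite mulr0.
  by move: iI; rewrite e' -[I i']/(i' \in I) Ii.
exists (c *m e); rewrite mulmxA; split=> // i iI.
rewrite eE big1 // => k _; have [e'|] := eqVneq i (enum_val k); last by rewrite mulr0.
by move: iI; rewrite e' -[I _]/(_ \in I) enum_valP.
Qed.

Lemma coord_sub_rank B I : invertible B -> free_of_rank (coord_sub B I) #|I|.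
Proof. by move=> iB; eexists; exact: coord_sub_basis. Qed.

Lemma initial_sub_rank B d : invertible B -> (d <= n)%N ->
  free_of_rank (initial_sub B d) d.
Proof.
move=> iB dn; have := coord_sub_rank (fun i => (i < d)%N) iB.
by rewrite -[X in free_of_rank _ X -> _]/(#|[pred i : 'I_n | (i < d)%N]|) card_initial.
Qed.

Lemma coord_sub_submodule B I : submodule (coord_sub B I).
Proof.
split; first by exists 0; rewrite mul0mx; split=> // i _; rewrite mxE.
split=> [x y [c [cI ->]] [c' [cI' ->]]|a x [c [cI ->]]].
  exists (c + c'); rewrite mulmxDl; split=> // i Ii.
  by rewrite mxE cI // cI' // addr0.
by exists (a *: c); rewrite scalemxAl; split=> // i Ii; rewrite mxE cI // mulr0.
Qed.

Lemma coord_sub_complement B I : invertible B ->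
  complement (coord_sub B I) (coord_sub B (predC I)).
Proof.
move=> [C [BC CB]]; split; first exact: coord_sub_submodule.
split.
  apply/seteqP; split=> x.
    move=> [[c [cI e]] [c' [cI' e']]]; suff c0 : c = 0 by rewrite e c0 mul0mx.
    have cc : c = c' by rewrite -[c]mulmx1 -BC mulmxA -e e' -mulmxA BC mulmx1.
    apply/rowP => i; rewrite mxE; have [Ii|/cI//] := boolP (I i).
    by rewrite cc cI' //= negbK.
  by move=> ->; split; apply: (proj1 (coord_sub_submodule _ _)).
move=> x; pose c := x *m C.
exists ((\row_i if I i then c ord0 i else 0) *m B),
       ((\row_i if I i then 0 else c ord0 i) *m B); split; [|split].
- by eexists; split; last reflexivity; move=> i /negbTE Ii; rewrite mxE Ii.
- by eexists; split; last reflexivity; move=> i; rewrite /= negbK mxE => ->.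
- rewrite -mulmxDl -[x]mulmx1 -CB mulmxA -/c; congr (_ *m _).
  by apply/rowP => i; rewrite !mxE; case: ifP; rewrite ?addr0 ?add0r.
Qed.

Lemma row_in_coord_sub B I i : invertible B -> coord_sub B I (row i B) <-> I i.
Proof.
move=> [C [BC CB]]; split=> [[c [cI e]]|Ii].
  apply: contraT => /cI; have -> : c = delta_mx 0 i.
    by rewrite -[c]mulmx1 -BC mulmxA -e rowE -mulmxA BC mulmx1.
  by rewrite mxE !eqxx => /eqP; rewrite oner_eq0.
exists (delta_mx 0 i); rewrite -rowE; split=> // k; rewrite mxE eqxx /=.
by have [->|//] := eqVneq k i; rewrite Ii.
Qed.

Lemma row_inj B : invertible B -> injective (fun i => row i B).
Proof.
move=> iB i j e; apply/eqP.
have := proj1 (row_in_coord_sub (pred1 j) i iB); apply; rewrite e.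
by apply/row_in_coord_sub => //=; rewrite eqxx.
Qed.

Lemma coord_sub_neq0 B I i : invertible B -> I i -> coord_sub B I <> [set 0].
Proof.
move=> iB Ii e; have : coord_sub B I (row i B) by apply/row_in_coord_sub.
rewrite e /= => r0; have [C [BC _]] := iB.
have : row i (B *m C) = 0 by rewrite row_mul r0 mul0mx.
by rewrite BC => /rowP/(_ i)/eqP; rewrite !mxE eqxx oner_eq0.
Qed.

Lemma coord_sub_neqT B I i : invertible B -> ~~ I i -> coord_sub B I <> setT.
Proof.
move=> iB Ii e; have : coord_sub B I (row i B) by rewrite e.
by move=> /row_in_coord_sub; rewrite (negbTE Ii) => /(_ iB).
Qed.

Lemma coord_sub_vertex B I i j : invertible B -> I i -> ~~ I j ->
  tits_vertex (coord_sub B I).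
Proof.
move=> iB Ii Ij; split; first exact: coord_sub_neq0 Ii.
split; first exact: coord_sub_neqT Ij.
split; first by eexists; exact: coord_sub_rank.
split; first exact: coord_sub_submodule.
by eexists; split; [exact: coord_sub_complement|eexists; exact: coord_sub_rank].
Qed.

Lemma initial_sub_complete_flag B : invertible B ->
  complete_flag (fun i : 'I_n.-1 => initial_sub B i.+1).
Proof.
move=> iB.
have n0 (i : 'I_n.-1) : (0 < n)%N by have := ltn_ord i; lia.
have ni (i : 'I_n.-1) : (i.+1 < n)%N by have := ltn_ord i; lia.
split=> [i|i j ij].
  split; first by eexists; exact: coord_sub_rank.
  split; first by split; [exact: coord_sub_submodule|eexists; exact: coord_sub_complement].
  split; first exact: (@coord_sub_neq0 _ _ (Ordinal (n0 i))).
  by apply: (@coord_sub_neqT _ _ (Ordinal (ni i))) => //=; rewrite ltnn.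
split.
  move=> x [c [cI ->]]; exists c; split=> // k; rewrite -leqNgt => jk.
  by apply: cI; rewrite -leqNgt; lia.
move=> h.
have : initial_sub B i.+1 (row (Ordinal (ni i)) B).
  by apply/h/row_in_coord_sub => //=; lia.
by move=> /row_in_coord_sub => /(_ iB) /=; rewrite ltnn.
Qed.

End CoordinateSubmodules.

(** This forces the ranks in a complete flag: [n - 1] strictly increasing values between 1 and
    [n - 1]. *)
Lemma homo_ord_id N (f : 'I_N -> nat) :
  (forall i j : 'I_N, (i < j)%N -> (f i < f j)%N) ->
  (forall i, (0 < f i <= N)%N) -> forall i, f i = i.+1.
Proof.
move=> mono fb i.
have lo : forall k (kN : (k < N)%N), (k < f (Ordinal kN))%N.
  elim=> [|k IH] kN; first by case/andP: (fb (Ordinal kN)).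
  have kN' : (k < N)%N by lia.
  by have := IH kN'; have := mono (Ordinal kN') (Ordinal kN) (leqnn _); lia.
have hi : forall k, (k < N)%N -> forall (kN : (N - k.+1 < N)%N),
    (f (Ordinal kN) <= N - k)%N.
  elim=> [|k IH] kk kN; first by case/andP: (fb (Ordinal kN)); lia.
  have kN' : (N - k.+1 < N)%N by lia.
  have lt : (N - k.+2 < N - k.+1)%N by lia.
  have := IH _ kN'; have := mono (Ordinal kN) (Ordinal kN') lt; lia.
have iN := ltn_ord i; have := lo i iN.
have iN' : (N - (N - i.+1).+1 < N)%N by lia.
have := hi (N - i.+1)%N _ iN'.
have -> : Ordinal iN' = i by apply: val_inj => /=; lia.
have -> : Ordinal iN = i by apply: val_inj.
lia.
Qed.

Section Flags.
Variable A : comNzRingType.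

(** Padded by 0 and the whole module, a complete flag has rank [d] at place [d], and a basis grows
    along it one vector at a time. *)
Lemma complete_flag_basis n (F : 'I_n.-1 -> set 'rV[A]_n) : (0 < n)%N ->
  complete_flag F -> exists B, invertible B /\ forall i, F i = initial_sub B i.+1.
Proof.
case: n F => // n F _ [Fi mono].
have [f hf] : exists f : 'I_n -> nat, forall i, free_of_rank (F i) (f i).
  have h (i : 'I_n) : exists r, free_of_rank (F i) r by case: (Fi i).
  by have [f hf] := choice h; exists f.
have idT : basis_of [set: 'rV[A]_n.+1] (fun i => row i (1%:M : 'M[A]_n.+1)).
  apply/is_basisP; rewrite (_ : \matrix_i row i 1%:M = 1%:M).
    by exists 1%:M; rewrite mulmx1.
  by apply/row_matrixP => i; rewrite rowK.
have fE : forall i, f i = i.+1.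
  apply: homo_ord_id => [i j ij|i].
    have [bi hi] := hf i; have [bj hj] := hf j.
    have [sub nsub] := mono i j ij.
    have [_ [sF _]] := Fi i.
    have [le eq] := summand_rank_le sub sF hi hj.
    rewrite ltn_neqAle le andbT; apply/eqP => /eq e.
    by apply: nsub; rewrite e.
  have [_ [sF [F0 FT]]] := Fi i; have [bi hi] := hf i.
  have [le eq] := summand_rank_le (@subsetT _ _) sF hi idT.
  apply/andP; split.
    rewrite lt0n; apply/eqP => f0; apply: F0; move: (f i) f0 bi hi {le eq} => r -> b /basis_ofP[_ Fb].
    apply/seteqP; split=> x; first by move=> /Fb[c ->]; rewrite /= thinmx0 mul0mx.
    by move=> ->; apply/Fb; exists 0; rewrite mul0mx.
  by rewrite -ltnS ltn_neqAle le andbT; apply/eqP => /eq.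
pose Fs (d : nat) : set 'rV[A]_n.+1 :=
  if d == 0%N then [set 0] else if insub d.-1 is Some i then F i else setT.
have FsE (i : 'I_n) : Fs i.+1 = F i by rewrite /Fs /= valK.
have FsT : Fs n.+1 = setT by rewrite /Fs /= insubF // ltnn.
have Fs0 : Fs 0%N = [set 0] by [].
have sub0 : submodule ([set 0] : set 'rV[A]_n.+1).
  split=> //; split=> [x y -> ->|a x ->]; [exact: addr0|exact: scaler0].
have subT : submodule ([set: 'rV[A]_n.+1]) by [].
have [b hb] : exists b : nat -> 'rV[A]_n.+1, forall d, (d <= n.+1)%N ->
    basis_of (Fs d) (fun k : 'I_d => b k).
  apply: adapted_basis => [[|d] dn|[|d] dn].
  - exists (fun=> 0); apply/basis_ofP; split=> [c _|x]; first by rewrite thinmx0.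
    rewrite Fs0; split=> [->|[c ->]]; first by exists 0; rewrite mul0mx.
    by rewrite [c]thinmx0 mul0mx.
  - move: dn; rewrite ltnS leq_eqVlt => /orP[/eqP ->|dn].
      by rewrite FsT; exists (fun i => row i (1%:M : 'M[A]_n.+1)).
    by rewrite (FsE (Ordinal dn)) -(fE (Ordinal dn)).
  - rewrite Fs0; split.
      move=> x ->; rewrite /Fs /=; case: insubP => [i _ _|//].
      by have [_ [[[F0 _] _] _]] := Fi i.
    split=> //; exists setT; split=> //; split; first by rewrite setIT.
    by move=> x; exists 0, x; rewrite add0r.
  - rewrite ltnS in dn; rewrite (FsE (Ordinal dn)); split; last first.
      by have [_ [sF _]] := Fi (Ordinal dn).
    case: (ltnP d.+1 n) => [dn'|nd]; last first.
      by rewrite (_ : d.+2 = n.+1) ?FsT //; lia.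
    rewrite (FsE (Ordinal dn')); exact: (proj1 (mono (Ordinal dn) (Ordinal dn') (leqnn _))).
pose B : 'M[A]_n.+1 := \matrix_i b i.
have iB : invertible B by apply/is_basisP; have := hb n.+1 (leqnn _); rewrite FsT.
exists B; split=> // i; rewrite -FsE.
have le : (i.+1 <= n.+1)%N by have := ltn_ord i; lia.
have /basis_ofP[_ Fb] := hb i.+1 le.
apply/seteqP; split=> x.
  move=> /Fb[c ->].
  exists (\row_k if insub (k : nat) is Some k' then c ord0 k' else 0); split.
    move=> k; rewrite -leqNgt => ik; rewrite mxE insubF //; apply/negbTE.
    by rewrite -leqNgt.
  rewrite !mulmx_sum_row (bigID (fun k : 'I_n.+1 => (k < i.+1)%N)) /=.
  rewrite [X in _ = _ + X]big1 ?addr0; last first.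
    by move=> k nk; rewrite mxE insubF ?scale0r //; apply/negbTE.
  rewrite (big_ord_narrow le); apply: eq_bigr => k _.
  by rewrite !rowK mxE /= insubT //= => kk; congr (c _ _ *: _); exact: val_inj.
move=> [c [cI ->]]; apply/Fb; exists (\row_k c ord0 (widen_ord le k)).
rewrite !mulmx_sum_row (bigID (fun k : 'I_n.+1 => (k < i.+1)%N)) /=.
rewrite [X in _ + X]big1 ?addr0; last by move=> k nk; rewrite cI ?scale0r.
by rewrite (big_ord_narrow le); apply: eq_bigr => k _; rewrite !rowK mxE.
Qed.

Lemma tits_truncP n m (s : seq (set 'rV[A]_n)) : (m < n)%N ->
  tits_trunc A n m s <-> s <> [::] /\ exists B, invertible B /\
    forall V, V \in s -> exists d, (0 < d <= m)%N /\ V = initial_sub B d.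
Proof.
move=> mn; have n0 : (0 < n)%N by lia.
split=> [[[s0 [sV [F [cF sF]]]] sm]|[s0 [B [iB sB]]]].
  have [B [iB FB]] := complete_flag_basis n0 cF.
  split=> //; exists B; split=> // V /InP Vs.
  have [i Vi] := sF V Vs; have [r [rm rV]] := sm V Vs.
  have iN := ltn_ord i.
  exists i.+1; rewrite Vi FB; split=> //=.
  have e : free_of_rank V i.+1 by rewrite Vi FB; apply: initial_sub_rank => //; lia.
  by rewrite (free_rank_uniq e rV).
have dP V : List.In V s -> exists i : 'I_n.-1, (i < m)%N /\ V = initial_sub B i.+1.
  move=> /InP/sB[d [/andP[d0 dm] ->]].
  have dn : (d.-1 < n.-1)%N by lia.
  by exists (Ordinal dn) => /=; rewrite prednK //; split=> //; lia.
split.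
  split=> //; split.
    move=> V /dP[i [im ->]]; have iN := ltn_ord i.
    have ni : (i.+1 < n)%N by lia.
    by apply: (@coord_sub_vertex _ _ _ _ (Ordinal n0) (Ordinal ni)) => //=; rewrite ltnn.
  exists (fun i => initial_sub B i.+1); split; first exact: initial_sub_complete_flag.
  by move=> V /dP[i [_ ->]]; exists i.
move=> V /dP[i [im ->]]; exists i.+1; split=> //.
by apply: initial_sub_rank => //; have := ltn_ord i; lia.
Qed.

Lemma BcomplexP n (s : seq 'rV[A]_n) :
  Bcomplex A n s <-> s <> [::] /\ exists B : 'M[A]_n, invertible B /\
    forall v, v \in s -> exists i, v = row i B.
Proof.
split=> [[s0 [b [/is_basisP ib sb]]]|[s0 [B [iB sB]]]].
  split=> //; exists (\matrix_i b i); split=> // v /InP/sb[i ->].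
  by exists i; rewrite rowK.
split=> //; exists (fun i => row i B); split; last by move=> v /InP/sB.
apply/is_basisP; rewrite (_ : \matrix_i row i B = B) //.
by apply/row_matrixP => i; rewrite rowK.
Qed.

End Flags.

(** * Partial bases joined with flags *)

Section Blocks.
Variables (A : comNzRingType) (r k : nat).
Implicit Types (B : 'M[A]_(r + k)) (P : 'M[A]_r) (Q : 'M[A]_k) (S : 'M[A]_(k, r)).

(** From rank [r] upward the initial submodules depend on [Q] alone: the right-hand side mentions
    neither [P] nor [S]. *)
Lemma initial_sub_block B P S Q d : invertible P ->
  initial_sub (block_mx P 0 S Q *m B) (r + d) = [set x | exists (c1 : 'rV[A]_r) (c2 : 'rV[A]_k),
    (forall j : 'I_k, (d <= j)%N -> c2 ord0 j = 0) /\
    x = row_mx c1 (c2 *m Q) *m B].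
Proof.
move=> [P' [_ P'P]]; apply/seteqP; split=> x.
  move=> [c [cI ->]]; exists (lsubmx c *m P + rsubmx c *m S), (rsubmx c); split.
    by move=> j dj; rewrite mxE cI //= -leqNgt leq_add2l.
  by rewrite mulmxA -{1}[c]hsubmxK mul_row_block mulmx0 add0r.
move=> [c1 [c2 [c2I ->]]].
exists (row_mx ((c1 - c2 *m S) *m P') c2); split.
  move=> i; rewrite -leqNgt => di; case: (split_ordP i) di => j -> /=.
    by have := ltn_ord j; lia.
  by rewrite leq_add2l row_mxEr => /c2I.
by rewrite mulmxA mul_row_block mulmx0 add0r -(mulmxA _ P') P'P mulmx1 subrK.
Qed.

Lemma invertible1 n : invertible (1%:M : 'M[A]_n).
Proof. by exists 1%:M; rewrite mulmx1. Qed.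

Lemma initial_sub_r B x :
  initial_sub B r x <-> exists c : 'rV[A]_r, x = row_mx c 0 *m B.
Proof.
split=> [[c [cI ->]]|[c ->]].
  exists (lsubmx c); congr (_ *m _); rewrite -{1}[c]hsubmxK; congr (row_mx _ _).
  by apply/rowP => j; rewrite !mxE cI //= -leqNgt leq_addr.
exists (row_mx c 0); split=> // i; case: (split_ordP i) => j -> // _.
by rewrite row_mxEr mxE.
Qed.

Lemma row_lshift_block P S Q i :
  row (lshift k i) (block_mx P 0 S Q) = row_mx (row i P) 0.
Proof. by rewrite /block_mx rowKu row_row_mx row0. Qed.

Lemma initial_sub_block_r B P S Q : invertible P ->
  initial_sub (block_mx P 0 S Q *m B) r = initial_sub B r.
Proof.
move=> [P' [_ P'P]]; apply/seteqP; split=> x /initial_sub_r[c ->]; apply/initial_sub_r.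
  by exists (c *m P); rewrite mulmxA mul_row_block mulmx0 !mul0mx !addr0.
exists (c *m P'); rewrite mulmxA mul_row_block mulmx0 !mul0mx !addr0.
by rewrite -mulmxA P'P mulmx1.
Qed.

Lemma block_invertible P S Q : invertible P -> invertible Q ->
  invertible (block_mx P 0 S Q).
Proof.
move=> [P' [PP _]] [Q' [QQ _]].
apply: (@invertible_right _ _ _ (block_mx P' 0 (- (Q' *m S *m P')) Q')).
rewrite mulmx_block PP QQ !mul0mx !mulmx0 !addr0 add0r.
by rewrite mulmxN !mulmxA QQ mul1mx subrr -scalar_mx_block.
Qed.

(** In both transition matrices the first [r] rows involve only the first [r] basis vectors, so the
    upper right blocks vanish and the diagonal blocks are mutually inverse. *)
Lemma change_of_flag_basis B B0 : invertible B -> invertible B0 ->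
  initial_sub B r = initial_sub B0 r -> exists P S Q,
  [/\ B = block_mx P 0 S Q *m B0, invertible P & invertible Q].
Proof.
move=> [C [BC CB]] [C0 [BC0 CB0]] e.
have ur (D D' D'' : 'M[A]_(r + k)) : invertible D -> initial_sub D r = initial_sub D' r ->
    D' *m D'' = 1%:M -> ursubmx (D *m D'') = 0.
  move=> iD DD D1; apply/row_matrixP => i.
  have : initial_sub D' r (row (lshift k i) D).
    by rewrite -DD; apply/row_in_coord_sub => //=; exact: ltn_ord.
  move=> /initial_sub_r[c hc]; rewrite row0.
  have : row (lshift k i) (D *m D'') = row_mx c 0.
    by rewrite row_mul hc -mulmxA D1 mulmx1.
  by move=> h; apply/rowP => j; have /rowP/(_ (rshift r j)) := h;
     rewrite row_mxEr !mxE.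
have u1 : ursubmx (B *m C0) = 0 by apply: (ur B B0) => //; exists C.
have u2 : ursubmx (B0 *m C) = 0 by apply: (ur B0 B) => //; exists C0.
have : (B *m C0) *m (B0 *m C) = 1%:M.
  by rewrite mulmxA -(mulmxA B) CB0 mulmx1.
rewrite -[B *m C0]submxK -[B0 *m C]submxK u1 u2 mulmx_block.
rewrite !mulmx0 !mul0mx !addr0 add0r scalar_mx_block => /eq_block_mx[PP _ _ QQ].
exists (ulsubmx (B *m C0)), (dlsubmx (B *m C0)), (drsubmx (B *m C0)); split.
- by rewrite -{1}u1 submxK -mulmxA CB0 mulmx1.
- exact: invertible_right PP.
- exact: invertible_right QQ.
Qed.

End Blocks.

Section SortedBasis.
Variables (A : comNzRingType) (n : nat) (B : 'M[A]_n) (key : 'I_n -> nat).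
Hypothesis iB : invertible B.

(** Rows are permuted by increasing key, ties broken by index; [pos i] counts the indices preceding
    [i]. A single permutation serves all the sets [I] at once. *)
Lemma sorted_basis : exists (B' : 'M[A]_n) (pos : 'I_n -> 'I_n),
  [/\ invertible B', forall i, row (pos i) B' = row i B &
   forall I : pred 'I_n, (forall i j, I i -> ~~ I j -> (key i < key j)%N) ->
     (forall i, I i = (pos i < #|I|)%N) /\ coord_sub B I = initial_sub B' #|I|].
Proof.
pose lt (i j : 'I_n) := (key i < key j)%N || ((key i == key j) && (i < j)%N).
have lt_irr i : lt i i = false by rewrite /lt !ltnn andbF.
have lt_tr i j l : lt i j -> lt j l -> lt i l by rewrite /lt; lia.
have lt_tot i j : i != j -> lt i j || lt j i.
  by move=> ij; have : (i != j :> nat) by []; rewrite /lt; lia.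
have posP i : (#|[pred j | lt j i]| < n)%N.
  rewrite -[X in (_ < X)%N]card_ord; apply: proper_card; apply/properP; split.
    by apply/fintype.subsetP.
  by exists i => //; rewrite inE lt_irr.
pose pos i := Ordinal (posP i).
have pos_lt i j : lt i j -> (pos i < pos j)%N.
  move=> ij; apply: proper_card; apply/properP; split.
    by apply/fintype.subsetP => l; rewrite !inE => li; exact: lt_tr ij.
  by exists i; rewrite inE ?lt_irr.
have pos_inj : injective pos.
  move=> i j e; apply/eqP/negPn/negP => /lt_tot/orP[] /pos_lt; by rewrite e ltnn.
have [C [BC CB]] := iB.
pose pi := perm pos_inj.
have B'E i : row (pos i) (row_perm pi^-1 B) = row i B.
  by apply/rowP => l; rewrite !mxE -(permE pos_inj) permK.
exists (row_perm pi^-1 B), pos; split=> //.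
  rewrite row_permE; apply: invertible_mul => //.
  by apply: (@invertible_right _ _ _ (perm_mx pi)); rewrite -perm_mxM mulVg perm_mx1.
move=> I hI.
have IP i : I i = (pos i < #|I|)%N.
  apply/idP/idP => Ii.
    apply: proper_card; apply/properP; split.
      apply/fintype.subsetP => j; rewrite !inE => ji; apply: contraT => Ij.
      have := hI _ _ Ii Ij; move: ji; rewrite /lt; lia.
    by exists i; rewrite ?inE ?lt_irr.
  apply: contraTT Ii => Ii; rewrite -leqNgt; apply: subset_leq_card.
  apply/fintype.subsetP => j Ij; rewrite inE.
  by rewrite /lt (hI _ _ Ij Ii).
split=> //; apply/seteqP; split=> x [c [cI ->]].
  exists (\row_j c ord0 ((pi^-1)%g j)); split.
    move=> j; rewrite -leqNgt => jI; rewrite mxE cI // IP -leqNgt.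
    by rewrite -(permE pos_inj) permKV.
  rewrite !mulmx_sum_row [RHS](reindex_inj (@perm_inj _ pi)) /=.
  by apply: eq_bigr => i _; rewrite mxE permK permE B'E.
exists (\row_j c ord0 (pi j)); split.
  by move=> j; rewrite IP => jI; rewrite mxE cI // permE.
rewrite !mulmx_sum_row (reindex_inj (@perm_inj _ pi)) /=.
by apply: eq_bigr => i _; rewrite mxE permE B'E.
Qed.

End SortedBasis.

Section PartialBasesAndFlags.
Variables (A : comNzRingType) (n m : nat).
Local Notation vert := ('rV[A]_n + set 'rV[A]_n)%type.

(** The number [q] separates vectors from flag terms: the vectors are among the first [q] rows and
    every term has rank at least [q], so they extend to a basis of the smallest term. With no term
    present, [q <= m] is the bound on their number. *)
Definition flagged (r : nat) : complex vert := fun s => s <> [::] /\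
  exists (B : 'M[A]_n) q, [/\ invertible B, (q <= m)%N & forall z, z \in s ->
    match z with
    | inl v => exists i : 'I_n, (i < q)%N /\ v = row i B
    | inr V => exists d, [/\ (q <= d)%N, (r <= d)%N, (0 < d <= m)%N &
                 V = initial_sub B d]
    end].

Lemma simplicial_flagged r : simplicial (flagged r).
Proof.
split=> [s []//|s t [_ [B [q [iB qm h]]]] t0 ts]; split=> //.
by exists B, q; split=> // z /ts; exact: h.
Qed.

Definition is_vec (z : vert) : bool := if z is inl _ then true else false.
Definition is_flag (r : nat) (z : vert) : bool :=
  if z is inr V then `[< exists B, invertible B /\ V = initial_sub B r >] else false.

Hypothesis mn : (m < n)%N.

Lemma initial_sub_inj (B B' : 'M[A]_n) d d' : invertible B -> invertible B' ->
  (d <= n)%N -> (d' <= n)%N -> initial_sub B d = initial_sub B' d' -> d = d'.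
Proof.
move=> iB iB' dn dn' e; have h := initial_sub_rank iB dn.
by rewrite e in h; exact: free_rank_uniq h (initial_sub_rank iB' dn').
Qed.

Lemma old_flagged r s : (r <= m)%N ->
  old (flagged r) (is_flag r) s <-> flagged r.+1 s.
Proof.
move=> rm; split.
  move=> [[s0 [B [q [iB qm h]]]] nf]; split=> //; exists B, q; split=> // z zs.
  have := h z zs; have := nf z zs; case: z {zs} => // V /= /asboolP nV [d [qd rd dm e]].
  exists d; split=> //; rewrite ltn_neqAle rd andbT; apply/eqP => dr.
  by apply: nV; exists B; rewrite dr.
move=> [s0 [B [q [iB qm h]]]]; split.
  split=> //; exists B, q; split=> // -[v|V] /h //.
  by move=> [d [qd rd dm e]]; exists d; split=> //; exact: ltnW.
move=> [v|V] /h //= [d [qd rd dm e]]; apply/asboolPn => -[B' [iB' e']].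
have : d = r by apply: (initial_sub_inj iB iB'); [lia|lia|rewrite -e -e'].
by move: rd; lia.
Qed.

Lemma is_flag_uniq r s z z' : (r <= m)%N -> flagged r s -> z \in s -> z' \in s ->
  is_flag r z -> is_flag r z' -> z = z'.
Proof.
move=> rm [_ [B [q [iB qm h]]]] /h + /h.
case: z z' => [//|V] [//|V'] [d [_ _ dm ->]] [d' [_ _ dm' ->]].
move=> /asboolP[B1 [iB1 e1]] /asboolP[B2 [iB2 e2]].
have dn : (d <= n)%N by move: dm mn; clear; lia.
have dn' : (d' <= n)%N by move: dm' mn; clear; lia.
have rn : (r <= n)%N by move: rm mn; clear; lia.
by rewrite (initial_sub_inj iB iB1 dn rn e1) (initial_sub_inj iB iB2 dn' rn e2).
Qed.

End PartialBasesAndFlags.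

Lemma simplicial_Bcomplex (A : comNzRingType) n : simplicial (Bcomplex A n).
Proof.
split=> [s []//|s t /BcomplexP[_ [B [iB h]]] t0 ts]; apply/BcomplexP; split=> //.
by exists B; split=> // v /ts; exact: h.
Qed.

Lemma simplicial_tits (A : comNzRingType) n m : (m < n)%N -> simplicial (tits_trunc A n m).
Proof.
move=> mn; split=> [s [[]]//|s t /(tits_truncP _ mn)[_ [B [iB h]]] t0 ts].
by apply/(tits_truncP _ mn); split=> //; exists B; split=> // v /ts; exact: h.
Qed.

(** * Links of a summand of rank r: its partial bases and the flags above it *)

Section Links.
Variables (A : comNzRingType) (r k m : nat).
Hypotheses (r0 : (0 < r)%N) (rm : (r <= m)%N) (mn : (m < r + k)%N).
Variables (B0 : 'M[A]_(r + k)).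
Hypothesis iB0 : invertible B0.
Local Notation V0 := (initial_sub B0 r).
Local Notation vert := ('rV[A]_(r + k) + set 'rV[A]_(r + k))%type.
Local Notation K := (@flagged A (r + k) m r).

Lemma flagged_inr B q s : invertible B -> (q <= m)%N ->
  (forall z, z \in (inr V0 : vert) :: s ->
    match z with
    | inl v => exists i : 'I_(r + k), (i < q)%N /\ v = row i B
    | inr V => exists d, [/\ (q <= d)%N, (r <= d)%N, (0 < d <= m)%N &
                 V = initial_sub B d]
    end) -> (q <= r)%N /\ V0 = initial_sub B r.
Proof.
move=> iB qm /(_ _ (mem_head _ _))[d [qd rd dm e]].
have er : d = r by apply/esym; apply: (initial_sub_inj iB0 iB _ _ e); lia.
by rewrite er in qd e; split.
Qed.

(** [B0] identifies the summand with R^r. The block [P] of the transition matrix turns a basis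
    adapted to the summand into a basis of R^r; an identity block leads back. *)
Lemma kconn_link_vec l : kconn (Bcomplex A r) l ->
  kconn (linkA K (@is_vec A (r + k)) (inr V0)) l.
Proof.
have [C0 [BC0 CB0]] := iB0.
pose i (x : 'rV[A]_r) : vert := inl (row_mx x 0 *m B0).
pose p (z : vert) : 'rV[A]_r := if z is inl v then lsubmx (v *m C0) else 0.
have pi x : p (i x) = x by rewrite /p /i -mulmxA BC0 mulmx1 row_mxKl.
have back s z : linkA K (@is_vec A (r + k)) (inr V0) s -> z \in s ->
    exists2 P, invertible P & exists B, [/\ invertible B, forall j : 'I_r,
       row (lshift k j) B = row_mx (row j P) 0 *m B0 &
       forall z, z \in s -> exists j : 'I_r, z = inl (row (lshift k j) B)].
  move=> [_ sv [_ [B [q [iB qm h]]]]] zs.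
  have [qr e] := flagged_inr iB qm h.
  have [P [S [Q [BE iP iQ]]]] := change_of_flag_basis iB iB0 (esym e).
  exists P => //; exists B; split=> // [j|z' zs'].
    by rewrite BE row_mul row_lshift_block.
  have := h z'; rewrite inE zs' orbT => /(_ isT); have := sv z' zs'.
  case: z' {zs'} => //= v _ [a [aq ->]].
  have ar : (a < r)%N by lia.
  by exists (Ordinal ar); congr (inl (row _ B)); exact: val_inj.
apply: (kconn_retract (i := i) (p := p)).
- exact: simplicial_Bcomplex.
- exact/simplicial_linkA/simplicial_flagged.
- move=> s /BcomplexP[s0 [b [ib sb]]]; split.
  + by case: (s) s0.
  + by move=> w /mapP[x _ ->].
  split=> //; exists (block_mx b 0 0 1%:M *m B0), r; split=> //.
    apply: invertible_mul => //; apply: block_invertible => //; exact: invertible1.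
  move=> z; rewrite inE => /orP[/eqP ->|/mapP[x /sb[j ->] ->]].
    exists r; split=> //; first by rewrite r0.
    by rewrite initial_sub_block_r.
  exists (lshift k j); split; first exact: (ltn_ord j).
  by rewrite row_mul row_lshift_block.
- move=> s Ls; apply/BcomplexP; split.
    by case: Ls => + _ _; case: (s).
  have [z zs] : exists z, z \in s by case: Ls => + _ _; case: (s) => // z s' _; exists z; rewrite mem_head.
  have [P iP [B [iB BP sB]]] := back s z Ls zs.
  exists P; split=> // _ /mapP[z' zs' ->]; have [j ->] := sB z' zs'.
  by exists j; rewrite BP; exact: pi.
- move=> s z Ls zs; have [P iP [B [iB BP sB]]] := back s z Ls zs.
  have [j ->] := sB z zs; rewrite BP -/(i _); by rewrite pi.
Qed.

(** Submodules containing the summand correspond to submodules of the quotient, which the last [k]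
    coordinates in [B0] identify with R^k; ranks drop by [r]. *)
Lemma kconn_link_flag l : (r < m)%N -> kconn (tits_trunc A k (m - r)) l ->
  kconn (linkB K (@is_flag A (r + k) r) (@is_vec A (r + k)) (inr V0)) l.
Proof.
move=> rm'; have [C0 [BC0 CB0]] := iB0.
have mk : (m - r < k)%N by lia.
pose i (W : set 'rV[A]_k) : vert := inr [set x | W (rsubmx (x *m C0))].
pose p (z : vert) : set 'rV[A]_k := if z is inr V then [set u | V (row_mx 0 u *m B0)] else set0.
have pi W : p (i W) = W.
  by apply/funext => u; rewrite /p /i /= -mulmxA BC0 mulmx1 row_mxKr.
have iE (Q : 'M[A]_k) P S d : invertible P ->
    i (initial_sub Q d) = inr (initial_sub (block_mx P 0 S Q *m B0) (r + d)).
  move=> iP; rewrite initial_sub_block //; congr inr; apply/seteqP; split=> x /=.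
    move=> [c [cI e]]; exists (lsubmx (x *m C0)), c; split.
      by move=> j dj; apply: cI; rewrite -leqNgt.
    by rewrite -e hsubmxK -mulmxA CB0 mulmx1.
  move=> [c1 [c2 [c2I ->]]]; exists c2; split; first by move=> j; rewrite -leqNgt; exact: c2I.
  by rewrite -mulmxA BC0 mulmx1 row_mxKr.
have back s : linkB K (@is_flag A (r + k) r) (@is_vec A (r + k)) (inr V0) s ->
    exists2 Q, invertible Q & forall z, z \in s -> exists d,
      (0 < d <= m - r)%N /\ z = i (initial_sub Q d).
  move=> [_ sv [_ [B [q [iB qm h]]]]].
  have [qr e] := flagged_inr iB qm h.
  have [P [S [Q [BE iP iQ]]]] := change_of_flag_basis iB iB0 (esym e).
  exists Q => // z zs; have := h z; rewrite inE zs orbT => /(_ isT).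
  have := sv z zs; case: z {zs} => //= V /asboolPn nV [d [qd rd dm Ve]].
  have dr : d <> r by move=> dr; apply: nV; exists B; split=> //; rewrite dr in Ve.
  exists (d - r)%N; split; first by lia.
  by rewrite (iE Q P S) // subnKC // -BE -Ve.
apply: (kconn_retract (i := i) (p := p)).
- exact: simplicial_tits.
- exact/simplicial_linkB/simplicial_flagged.
- move=> s /(tits_truncP _ mk)[s0 [Q [iQ sQ]]].
  have iB : invertible (block_mx 1%:M 0 0 Q *m B0).
    by apply: invertible_mul => //; apply: block_invertible => //; exact: invertible1.
  have iE' d : i (initial_sub Q d) = inr (initial_sub (block_mx 1%:M 0 0 Q *m B0) (r + d)).
    by apply: iE; exact: invertible1.
  split.
  + by case: (s) s0.
  + move=> w /mapP[W /sQ[d [dm ->]] ->]; rewrite iE' /=.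
    apply/asboolPn => -[B' [iB' /(initial_sub_inj iB iB')]] h.
    have : (r + d)%N = r by apply: h; lia.
    lia.
  split=> //; exists (block_mx 1%:M 0 0 Q *m B0), r; split=> //.
  move=> z; rewrite inE => /orP[/eqP ->|/mapP[W /sQ[d [dm ->]] ->]].
    exists r; split=> //; first by rewrite r0.
    by rewrite initial_sub_block_r //; exact: invertible1.
  by rewrite iE'; exists (r + d)%N; split=> //; lia.
- move=> s Ls; apply/(tits_truncP _ mk); split.
    by case: Ls => + _ _; case: (s).
  have [Q iQ sQ] := back s Ls; exists Q; split=> // _ /mapP[z zs ->].
  by have [d [dm ->]] := sQ z zs; exists d; rewrite pi.
- by move=> s z Ls zs; have [Q iQ sQ] := back s Ls; have [d [_ ->]] := sQ z zs; rewrite pi.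
Qed.

(** Let [B] serve the vectors and [B'] the flag terms. Replacing the block [P] of the transition
    matrix by 1 gives a basis with the first [r] rows of [B] and the higher initial submodules of
    [B']. *)
Lemma flagged_join s t :
  s = [::] \/ linkA K (@is_vec A (r + k)) (inr V0) s ->
  t = [::] \/ linkB K (@is_flag A (r + k) r) (@is_vec A (r + k)) (inr V0) t ->
  K (inr V0 :: s ++ t).
Proof.
move=> Ls Lt.
have [B [iB eB sB]] : exists B, [/\ invertible B, V0 = initial_sub B r &
    forall z, z \in s -> exists j : 'I_r, z = inl (row (lshift k j) B)].
  case: Ls => [->|[_ sv [_ [B [q [iB qm h]]]]]]; first by exists B0.
  have [qr e] := flagged_inr iB qm h; exists B; split=> // z zs.
  have := h z; rewrite inE zs orbT => /(_ isT); have := sv z zs.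
  case: z {zs} => //= v _ [a [aq ->]].
  have ar : (a < r)%N by lia.
  by exists (Ordinal ar); congr (inl (row _ B)); exact: val_inj.
have [B' [iB' eB' tB]] : exists B', [/\ invertible B', V0 = initial_sub B' r &
    forall z, z \in t -> exists d, (0 < r + d <= m)%N /\ z = inr (initial_sub B' (r + d))].
  case: Lt => [->|[_ tv [_ [B' [q [iB' qm h]]]]]]; first by exists B0.
  have [qr e] := flagged_inr iB' qm h; exists B'; split=> // z zs.
  have := h z; rewrite inE zs orbT => /(_ isT); have := tv z zs.
  case: z {zs} => //= V _ [d [qd rd dm ->]].
  by exists (d - r)%N; rewrite subnKC.
have e : initial_sub B' r = initial_sub B r by rewrite -eB'.
have [P [S [Q [BE iP iQ]]]] := change_of_flag_basis iB' iB e.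
pose B2 := block_mx 1%:M 0 S Q *m B.
have i1 : invertible (1%:M : 'M[A]_r) by exact: invertible1.
have B2E d : initial_sub B2 (r + d) = initial_sub B' (r + d).
  by rewrite BE !initial_sub_block.
split=> //; exists B2, r; split=> //.
  by apply: invertible_mul => //; exact: block_invertible.
move=> z; rewrite inE mem_cat => /or3P[/eqP ->|/sB[j ->]|/tB[d [dm ->]]].
- exists r; split=> //; first by rewrite r0.
  by rewrite eB /B2 initial_sub_block_r.
- exists (lshift k j); split; first exact: (ltn_ord j).
  rewrite /B2 row_mul row_lshift_block -(row_lshift_block _ 0 1%:M).
  by rewrite -scalar_mx_block -row_mul mul1mx.
- by exists (r + d)%N; rewrite B2E; split=> //; lia.
Qed.

End Links.

(** * Connectivity of the truncated Tits complex *)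

Section Connectivity.
Variables (A : comNzRingType).

Lemma kconn_vacuous (V : choiceType) (K : complex V) l : l < -1 -> kconn K l.
Proof. by move=> l1; split=> [|j]; move: l1; lia. Qed.

(** No rank lies in [m+1, m], so only vectors remain, and [q <= m] bounds their number. *)
Lemma kconn_flagged_skel n m : (m < n)%N -> kconn (Bcomplex A n) (m%:Z - 2) ->
  kconn (@flagged A n m m.+1) (m%:Z - 2).
Proof.
move=> mn kB; pose p (z : ('rV[A]_n + set 'rV[A]_n)%type) : 'rV[A]_n :=
  if z is inl v then v else 0.
have vec s z : @flagged A n m m.+1 s -> z \in s -> exists v, z = inl v.
  move=> [_ [B [q [_ _ h]]]] /h; case: z => [v _|V [d [_ md /andP[_ dm] _]]].
    by exists v.
  by move: (leq_ltn_trans dm md); rewrite ltnn.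
apply: (kconn_retract (i := inl) (p := p)) (kconn_skel (@simplicial_Bcomplex A n) kB).
- exact/simplicial_skel/simplicial_Bcomplex.
- exact: simplicial_flagged.
- move=> s [/BcomplexP[s0 [B [iB sB]]] sm]; split; first by case: (s) s0.
  pose I : pred 'I_n := fun i => row i B \in s.
  (* The key is 0 for rows in [s] and 1 for the others, so the vectors of [s] come first. *)
  have [B' [pos [iB' posE hI]]] := sorted_basis (fun i => ~~ I i) iB.
  have [|IP _] := hI I; first by move=> i j /= -> /negbTE ->.
  exists B', #|I|; split=> //.
    apply: leq_trans sm; rewrite cardE -(size_map (fun i => row i B)).
    apply: uniq_leq_size.
      by rewrite map_inj_uniq ?enum_uniq //; exact: row_inj.
    by move=> _ /mapP[i + ->]; rewrite mem_enum mem_undup.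
  move=> _ /mapP[v vs ->]; have [i e] := sB v vs.
  by exists (pos i); rewrite posE -IP; split=> //; rewrite /I -e.
- move=> s fs; have [s0 [B [q [iB qm h]]]] := fs.
  have rowP' v : v \in map p s -> exists i : 'I_n, (i < q)%N /\ v = row i B.
    by move=> /mapP[z zs ->]; have [v' e] := vec s z fs zs; have := h z zs; rewrite e.
  split.
    apply/BcomplexP; split; first by case: (s) s0.
    by exists B; split=> // v /rowP'[i [_ ->]]; exists i.
  apply: leq_trans qm.
  have qn : size [seq row i B | i <- enum [pred i : 'I_n | (i < q)%N]] =
            #|[pred i : 'I_n | (i < q)%N]| by rewrite size_map -cardE.
  have cq : (#|[pred i : 'I_n | (i < q)%N]| <= q)%N.
    have [qn'|nq] := leqP q n; first by rewrite card_initial.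
    by apply: leq_trans (max_card _) _; rewrite card_ord ltnW.
  apply: leq_trans cq; rewrite -qn; apply: uniq_leq_size; first exact: undup_uniq.
  move=> v; rewrite mem_undup => /rowP'[i [iq ->]].
  by apply: map_f; rewrite mem_enum inE.
- by move=> s z fs zs; have [v ->] := vec s z fs zs.
Qed.


Hypothesis kB : forall k, (0 < k)%N -> kconn (Bcomplex A k) (k%:Z - 2).

(** Cone vertices are the summands of rank [r]; the A-side consists of vectors, the B-side of flag
    terms of larger rank. *)
Lemma kconn_flagged_step n m r : (0 < r)%N -> (r <= m)%N -> (m < n)%N ->
  (forall m' n', (m' < m)%N -> (m' < n')%N ->
    kconn (tits_trunc A n' m') (m'%:Z - 2)) ->
  kconn (@flagged A n m r.+1) (m%:Z - 2) -> kconn (@flagged A n m r) (m%:Z - 2).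
Proof.
move=> r0 rm mn IH kS.
have [k nk] : exists k, n = (r + k)%N by exists (n - r)%N; lia.
subst n.
have oldE : old (@flagged A (r + k) m r) (@is_flag A (r + k) r) = @flagged A (r + k) m r.+1.
  by apply/funext => s; apply/propext; exact: old_flagged.
apply: (@kconn_cone _ _ (@is_flag A (r + k) r) (@is_vec A (r + k)) m r) => //.
- exact: simplicial_flagged.
- by case.
- by move=> s v w fs vs ws; exact: (is_flag_uniq mn rm fs).
- case=> // V s t /asboolP[B [iB ->]]; exact: (flagged_join r0 rm mn iB).
- case=> // V /asboolP[B [iB ->]].
  by apply: (kconn_link_vec r0 rm mn iB); exact: kB.
- case=> // V /asboolP[B [iB ->]].
  (* For [r = m] no flag term lies above the summand, and the required connectivity is -2. *)
  have [rm'|mr] := ltnP r m; last by apply: kconn_vacuous; lia.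
  by apply: (kconn_link_flag r0 rm mn iB) => //; apply: IH; lia.
- by rewrite oldE.
Qed.

Lemma kconn_flagged n m : (0 < m)%N -> (m < n)%N ->
  (forall m' n', (m' < m)%N -> (m' < n')%N ->
    kconn (tits_trunc A n' m') (m'%:Z - 2)) ->
  kconn (@flagged A n m 1) (m%:Z - 2).
Proof.
move=> m0 mn IH.
suff h j : (j <= m)%N -> kconn (@flagged A n m (m.+1 - j)) (m%:Z - 2).
  by have := h m (leqnn _); rewrite subSnn.
elim: j => [|j IHj] jm.
  rewrite subn0; apply: kconn_flagged_skel => //.
  by apply: kconn_le (kB _); lia.
apply: kconn_flagged_step => //; [lia|lia|].
by rewrite (_ : (m.+1 - j.+1).+1 = (m.+1 - j)%N); [apply: IHj; lia|lia].
Qed.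

End Connectivity.

(** * Retraction of partial bases with flags onto flags *)

Section Spans.
Variables (A : comNzRingType) (n : nat).

Definition span_seq (s : seq 'rV[A]_n) : set 'rV[A]_n :=
  [set x | exists c : 'rV[A]_n -> A, x = \sum_(v <- undup s) c v *: v].

Lemma span_rows (B : 'M[A]_n) s : invertible B ->
  (forall v, v \in s -> exists i, v = row i B) ->
  span_seq s = coord_sub B (fun i => row i B \in s).
Proof.
move=> iB sB; pose I : pred 'I_n := fun i => row i B \in s.
have row_inj := row_inj iB.
have sumE (c : 'rV[A]_n -> A) :
    \sum_(v <- undup s) c v *: v = \sum_(i | I i) c (row i B) *: row i B.
  have pe : perm_eq (undup s) [seq row i B | i <- enum I].
    apply: uniq_perm; rewrite ?undup_uniq ?map_inj_uniq ?enum_uniq // => v.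
    rewrite mem_undup; apply/idP/mapP => [vs|[i + ->]]; last by rewrite mem_enum.
    have [i e] := sB v vs; exists i => //; rewrite mem_enum.
    by rewrite -[_ \in _]/(row i B \in s) -e.
  by rewrite (perm_big _ pe) /= big_map big_enum.
apply/seteqP; split=> x [c].
  rewrite sumE => ->; exists (\row_i if I i then c (row i B) else 0); split.
    by move=> i; rewrite -/(I i) mxE => /negbTE ->.
  rewrite mulmx_sum_row [LHS]big_mkcond /=; apply: eq_bigr => i _.
  by rewrite mxE; case: ifP => //; rewrite scale0r.
move=> [cI ->]; exists (fun v => if [pick i | row i B == v] is Some i then c ord0 i else 0).
rewrite sumE mulmx_sum_row [RHS]big_mkcond /=; apply: eq_bigr => i _.
case: ifPn => Ii; last by rewrite cI ?scale0r.
case: pickP => [j /eqP/row_inj -> //|/(_ i)]; by rewrite eqxx.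
Qed.

End Spans.

Section Final.
Variables (A : comNzRingType) (n m : nat).
Hypotheses (m0 : (0 < m)%N) (mn : (m < n)%N).

(** One reordering of the basis makes every member of the chain [R] an initial segment and leaves
    the initial submodules of rank at least [q] unchanged. Spans and flag terms are then initial
    submodules of a single basis. *)
Lemma flagged_to_tits s (R : seq (seq 'rV[A]_n)) (ws : seq (set 'rV[A]_n)) :
  @flagged A n m 1 s ->
  (forall rho, rho \in R -> rho <> [::] /\ forall u, u \in rho -> inl u \in s) ->
  (forall rho rho', rho \in R -> rho' \in R ->
     {subset rho <= rho'} \/ {subset rho' <= rho}) ->
  (forall w, w \in ws -> inr w \in s) -> map (@span_seq A n) R ++ ws <> [::] ->
  tits_trunc A n m (map (@span_seq A n) R ++ ws).
Proof.
move=> [_ [B [q [iB qm h]]]] sR chain sw ne.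
pose In rho : pred 'I_n := fun i => row i B \in (rho : seq 'rV[A]_n).
have InB i rho : In rho i = (row i B \in rho) by [].
have row_inj := row_inj iB.
have Rrow rho v : rho \in R -> v \in rho -> exists i : 'I_n, (i < q)%N /\ v = row i B.
  by move=> rR vr; have [_ /(_ v vr)/h] := sR rho rR.
have Rq rho (i : 'I_n) : rho \in R -> In rho i -> (i < q)%N.
  by move=> rR /(Rrow _ _ rR)[j [jq /row_inj ->]].
(* A row before [q] counts the members of [R] that miss it, so the smaller sets of the chain come
   first; the rows from [q] on follow in their old order. *)
pose key (i : 'I_n) := if (i < q)%N then count (fun rho => ~~ In rho i) R
                       else ((size R).+1 + i)%N.
have [B' [pos [iB' _ srt]]] := sorted_basis key iB.
have keyR rho (i j : 'I_n) : rho \in R -> In rho i -> ~~ In rho j -> (key i < key j)%N.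
  move=> rR ri rj; rewrite /key (Rq rho) //.
  case: ifP => [jq|_]; last first.
    by apply: leq_ltn_trans (count_size _ _) _; lia.
  (* Every member of [R] missing [i] also misses [j], and [rho] misses only [j], whence the strict
     inequality of keys. *)
  have sub : subpred (fun rho' => (rho' \in R) && ~~ In rho' i)
                     (fun rho' => ~~ In rho' j).
    move=> rho' /andP[r'R r'i]; have [rr|rr] := chain _ _ rR r'R.
      by case/negP: r'i; exact: rr.
    by apply: contra rj; exact: rr.
  have cE (P : pred (seq 'rV[A]_n)) : count P R = count (fun x => (x \in R) && P x) R.
    by apply: eq_in_count => x ->.
  rewrite [X in (X < _)%N]cE.
  have disj : count (predU (fun x => (x \in R) && ~~ In x i) (pred1 rho)) R
            = (count (fun x => (x \in R) && ~~ In x i) R + count (pred1 rho) R)%N.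
    rewrite -count_predUI (eq_count (a1 := predI _ _) (a2 := pred0)) ?count_pred0 ?addn0 //.
    by move=> x /=; apply/negbTE/negP => /andP[/andP[_ xi] /eqP e]; move: xi; rewrite e ri.
  apply: (@leq_trans (count (predU (fun x => (x \in R) && ~~ In x i) (pred1 rho)) R)).
    by rewrite disj -[X in (X < _)%N]addn0 ltn_add2l -has_count; apply/hasP; exists rho => //=.
  apply: sub_count => x /orP[/sub//|/eqP ->//].
have keyI d (i j : 'I_n) : (q <= d)%N -> (i < d)%N -> ~~ (j < d)%N -> (key i < key j)%N.
  move=> qd id; rewrite -leqNgt => dj; rewrite /key [(j < q)%N]ltnNge (leq_trans qd dj) /=.
  case: ifP => [_|_]; last by lia.
  by apply: leq_ltn_trans (count_size _ _) _; lia.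
apply/(tits_truncP _ mn); split=> //; exists B'; split=> // V.
rewrite mem_cat => /orP[/mapP[rho rR ->]|/sw/h[d [qd d0 dm ->]]].
  rewrite (span_rows iB); last by move=> v vr; have [i [_ ->]] := Rrow _ _ rR vr; exists i.
  have [_ e] := srt (In rho) (fun i j => keyR rho i j rR).
  exists #|In rho|; split=> //; apply/andP; split.
    case: (sR rho rR) => + _; case: rho rR {e} => // v rho rR _.
    have [i [_ e]] := Rrow _ v rR (mem_head _ _).
    by apply/card_gt0P; exists i; rewrite -[_ \in _]/(row i B \in v :: rho) -e mem_head.
  apply: leq_trans qm; have [qn|nq] := leqP q n; last first.
    by apply: leq_trans (max_card _) _; rewrite card_ord ltnW.
  rewrite -[X in (_ <= X)%N](card_initial qn); apply: subset_leq_card.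
  by apply/fintype.subsetP => i ri; rewrite inE; exact: Rq ri.
have [_ e] := srt (fun i => (i < d)%N) (fun i j => keyI d i j qd).
exists d; split; first by rewrite dm.
rewrite /initial_sub e.
by rewrite -[#|_|]/(#|[pred i : 'I_n | (i < d)%N]|) card_initial //; lia.
Qed.

(** A sphere of flags is filled in [flagged 1] and the filling is brought back by [layer_cake],
    which fixes points carrying no vector, hence the boundary. *)
Lemma kconn_tits : kconn (@flagged A n m 1) (m%:Z - 2) ->
  kconn (tits_trunc A n m) (m%:Z - 2).
Proof.
move=> [_ ext]; have sT := simplicial_tits A mn.
have sF := @simplicial_flagged A n m 1.
have lc := layer_cake sF sT flagged_to_tits.
split=> [_|j jm f cf].
  have i1 := invertible1 A n.
  (* For nonemptiness: the span of one basis vector, of rank 1 with 1 <= m < n. *)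
  pose V := initial_sub (1%:M : 'M[A]_n) 1.
  have TV : tits_trunc A n m [:: V].
    apply/(tits_truncP _ mn); split=> //; exists 1%:M; split=> // W.
    by rewrite inE => /eqP ->; exists 1%N.
  exists (fun w => if w == V then 1 else 0); apply: (real_intro (F := [:: V]) sT TV) => //.
  - by move=> w; rewrite inE => /negbTE ->.
  - by move=> w; case: ifP; rewrite ?ler01 ?lexx.
  - by move=> w; rewrite inE => /negbTE ->.
  - by rewrite big_seq1 eqxx.
have [F0 hF0] := cf.1; pose F := undup F0.
have fF x v : sphere x -> v \notin F -> f x v = 0.
  by rewrite mem_undup => sx; exact: hF0.
have uF : uniq F by exact: undup_uniq.
pose ir (V : set 'rV[A]_n) : ('rV[A]_n + set 'rV[A]_n)%type := inr V.
have ST s : tits_trunc A n m s -> @flagged A n m 1 (map ir s).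
  move=> /(tits_truncP _ mn)[s0 [B [iB sB]]]; split; first by case: (s) s0.
  exists B, 0%N; split=> // _ /mapP[V /sB[d [dm ->]] ->]; exists d; split=> //.
  by case/andP: dm.
have [g [cg gE]] := ext j jm _ (cont_map_push sT sF ST uF fF cf).
have [g' [cg' g'E]] := lc _ _ _ cg.
exists g'; split=> // x sx; rewrite g'E; last first.
- by move=> u; rewrite gE // /push big1.
- exact: sphere_disk.
apply/funext => w; rewrite gE // /push.
have [wF|wF] := boolP (w \in F); last first.
  rewrite fF // big_seq_cond big1 // => w' /andP[w'F /eqP[e]].
  by move: wF; rewrite -e w'F.
rewrite (big_rem w) //= eqxx big_seq_cond big1 ?addr0 // => w' /andP[].
rewrite (mem_rem_uniq _ uF) inE => /andP[/negP nw _] /eqP[e].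
by case: nw; rewrite e.
Qed.

End Final.

Theorem mainTheorem12 (A : comNzRingType) (n m : nat) :
  (0 < m)%N -> (m < n)%N ->
  (forall k : nat, (1 <= k)%N -> cohen_macaulay (Bcomplex A k) (k%:Z - 1)%R) ->
  (forall k l : nat, (l < k)%N ->
     ((2 <= l)%N -> k_connected (tits_trunc A k l) 0%R) /\
     ((3 <= l)%N -> k_connected (tits_trunc A k l) 1%R)) ->
  k_connected (tits_trunc A n m) (m%:Z - 2)%R.
Proof.
move=> _ mn cm _.
have kB k : (0 < k)%N -> kconn (Bcomplex A k) (k%:Z - 2).
  move=> /cm[_ [/(kconnP _ (@simplicial_Bcomplex A k)) h _]].
  by apply: kconn_le h; lia.
apply/kconnP; first exact: simplicial_tits.
(* The links involve smaller [m] together with smaller [n], so the induction on [m] keeps [n]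
   arbitrary. *)
elim/ltn_ind: m n mn => m IH n mn.
have [->|m0] := posnP m; first by apply: kconn_vacuous.
apply: kconn_tits => //; apply: kconn_flagged => // m' n' m'm m'n'.
exact: IH.
Qed.
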